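(* For every $f\in\mathcal{H}(\mathbb{R}^d)$ there exists a unique $u\in\mathcal{H}^1_T(\mathbb{R}^d)$ that is a generalized solution of the Cauchy problem $$u_t=\tfrac12\triangle u,\qquad u_0=f,$$ i.e. such that $u_t=\frac12\triangle u$ in $\mathcal{H}^0_T(\mathbb{R}^d)$ and $u_0=f$ in $\mathcal{H}(\mathbb{R}^d)$.
   Context: Norms and sequence spaces. Let $d\ge1$, $T>0$, $\mathbb{N}_0=\{0,1,2,\dots\}$. The Hermite polynomials are $H_n(x)=(-1)^ne^{x^2/2}\frac{d^n}{dx^n}e^{-x^2/2}$, the Hermite functions are $h_n(x)=(\sqrt{2\pi}\,n!)^{-1/2}e^{-x^2/4}H_n(x)$, and $h_\alpha(x_1,\dots,x_d)=\prod_{j=1}^d h_{\alpha_j}(x_j)$ for $\alpha\in\mathbb{N}_0^d$. For $\varphi$ in the (real-valued) Schwartz space $\mathcal{S}(\mathbb{R}^d)$ and $n\in\mathbb{N}_0$ put $|\varphi|_n^2=\sum_{\beta\in\mathbb{N}_0^d}(2|\beta|+d)^{2n}\left(\int_{\mathbb{R}^d}\varphi h_\beta\,dx\right)^2$, where $|\beta|=\sum_j\beta_j$. Let $\mathbf{s}_d$ be the set of real families $(a_\beta)_{\beta\in\mathbb{N}_0^d}$ with $\sum_\beta(2|\beta|+d)^{2n}|a_\beta|^2<\infty$ for all $n\in\mathbb{N}_0$, and $\mathbf{s}_d'$ the set of real families $(b_\beta)_{\beta\in\mathbb{N}_0^d}$ for which there are $C\in\mathbb{R}$, $m\in\mathbb{N}_0$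 with $|b_\beta|\le C(2|\beta|+d)^m$ for all $\beta$. Algebras. $\mathcal{H}(\mathbb{R}^d)=\mathcal{H}'_d/\mathcal{H}_d$, where $\mathcal{H}'_d$ (resp. $\mathcal{H}_d$) is the set of families $(f_\beta)_{\beta\in\mathbb{N}_0^d}$ in $\mathcal{S}(\mathbb{R}^d)$ such that for each $n\in\mathbb{N}_0$, $(|f_\beta|_n)_\beta\in\mathbf{s}_d'$ (resp. $\mathbf{s}_d$). $\mathcal{S}^0_T(\mathbb{R}^d)$ (resp. $\mathcal{S}^1_T(\mathbb{R}^d)$) is the set of functions $f:[0,T]\times\mathbb{R}^d\to\mathbb{R}$ with $f(t,\cdot)\in\mathcal{S}(\mathbb{R}^d)$ for each $t$ and $f(\cdot,x)\in C([0,T])$ (resp. $C^1([0,T])$) for each $x$. $\mathcal{H}'_{T,0,d}$ (resp. $\mathcal{H}_{T,0,d}$) is the set of families $(f_\beta)_{\beta\in\mathbb{N}_0^d}$ in $\mathcal{S}^0_T(\mathbb{R}^d)$ such that for each $n$, $(\sup_{t\in[0,T]}|f_\beta(t,\cdot)|_n)_\beta\in\mathbf{s}_d'$ (resp. $\mathbf{s}_d$). $\mathcal{H}'_{T,1,d}$ (resp. $\mathcal{H}_{T,1,d}$) is the set of families $(f_\beta)$ in $\mathcal{S}^1_T(\mathbb{R}^d)$ such that for each $n$ both $(\sup_{t}|f_\beta(t,\cdot)|_n)_\beta$ and $(\sup_t|\frac{\partial f_\beta}{\partial t}(t,\cdot)|_n)_\beta$ belong to $\mathbf{s}_d'$ (resp.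 $\mathbf{s}_d$); in particular $\frac{\partial f_\beta}{\partial t}(t,\cdot)\in\mathcal{S}(\mathbb{R}^d)$. $\mathcal{H}^k_T(\mathbb{R}^d)=\mathcal{H}'_{T,k,d}/\mathcal{H}_{T,k,d}$ for $k=0,1$. $[f_\beta]$ denotes the class of $(f_\beta)$. For $u=[u_\beta]\in\mathcal{H}^1_T(\mathbb{R}^d)$: $u_t=[\partial u_\beta/\partial t]\in\mathcal{H}^0_T(\mathbb{R}^d)$, $\triangle u=[\triangle_xu_\beta]\in\mathcal{H}^0_T(\mathbb{R}^d)$ (spatial Laplacian), and $u_0=[u_\beta(0,\cdot)]\in\mathcal{H}(\mathbb{R}^d)$. *)

(* Defs.v *)
From HB Require Import structures.
From mathcomp Require Import all_boot all_order all_algebra.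
From mathcomp Require Import all_classical all_reals all_analysis.

Set Implicit Arguments.
Unset Strict Implicit.
Unset Printing Implicit Defensive.
Import Order.TTheory GRing.Theory Num.Theory.
Import numFieldNormedType.Exports.

Local Open Scope classical_set_scope.
Local Open Scope ring_scope.

(* The library's sigma-finite instance on [m1 \x m2] is shadowed by the one for
   finite measures, hence this restatement. *)
Lemma sigma_finite_prod d1 d2 (T1 : measurableType d1) (T2 : measurableType d2)
    (R : realType) (m1 : {sigma_finite_measure set T1 -> \bar R})
    (m2 : {sigma_finite_measure set T2 -> \bar R}) :
  sigma_finite setT (m1 \x m2)%E.
Proof.
have /sigma_finiteP[F [TF ndF Foo]] := sigma_finiteT m1.
have /sigma_finiteP[G [TG ndG Goo]] := sigma_finiteT m2.
exists (fun n => F n `*` G n).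
  rewrite -setXTT TF TG predeqE => -[x y]; split.
    move=> [/= [n _ Fnx] [k _ Gky]]; exists (maxn n k) => //; split.
    - by move: x Fnx; exact/subsetPset/ndF/leq_maxl.
    - by move: y Gky; exact/subsetPset/ndG/leq_maxr.
  by move=> [n _ []/= ? ?]; split; exists n.
move=> k; have [? ?] := Foo k; have [? ?] := Goo k.
split; first exact: measurableX.
by rewrite product_measure1E// lte_mul_pinfty// ge0_fin_numE.
Qed.

Section prod_cons.
Context d (T : measurableType d) (R : realType) (n : nat).
Variable m1 : {sigma_finite_measure set T -> \bar R}.
Variable mn : {sigma_finite_measure set (n.-tuple T) -> \bar R}.
Local Open Scope ereal_scope.

Definition tuple_cons (p : T * n.-tuple T) : n.+1.-tuple T :=
  [tuple of p.1 :: p.2].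

Definition prod_cons : set (n.+1.-tuple T) -> \bar R :=
  pushforward (m1 \x mn) tuple_cons.

Let measurable_tuple_cons : measurable_fun setT tuple_cons.
Proof. exact: measurable_cons. Qed.

Let prod_cons0 : prod_cons set0 = 0.
Proof. by rewrite /prod_cons /pushforward preimage_set0 measure0. Qed.

Let prod_cons_ge0 A : 0 <= prod_cons A.
Proof. exact: measure_ge0. Qed.

Let prod_cons_sigma_additive : semi_sigma_additive prod_cons.
Proof.
move=> F mF tF mUF; rewrite /prod_cons /pushforward preimage_bigcup.
apply: measure_semi_sigma_additive.
- by move=> k; rewrite -[X in measurable X]setTI; exact: measurable_tuple_cons.
- apply/trivIsetP => /= i j _ _ ij; rewrite -preimage_setI.
  by move/trivIsetP : tF => /(_ _ _ _ _ ij) ->//; rewrite preimage_set0.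
- by rewrite -preimage_bigcup -[X in measurable X]setTI;
    exact: measurable_tuple_cons.
Qed.

HB.instance Definition _ := isMeasure.Build _ _ _ prod_cons
  prod_cons0 prod_cons_ge0 prod_cons_sigma_additive.

Let prod_cons_sigma_finite : sigma_finite setT prod_cons.
Proof.
have [F FT mF] := sigma_finite_prod m1 mn.
pose g (t : n.+1.-tuple T) : T * n.-tuple T :=
  (tnth t ord0, [tuple of behead t]).
have mg : measurable_fun setT g.
  apply/measurable_fun_pairP; split; first exact: measurable_tnth.
  exact: measurable_behead.
have gK p : g (tuple_cons p) = p.
  by case: p => x t; congr pair => //; apply/val_inj.
exists (fun i => g @^-1` F i).
  by rewrite -preimage_bigcup -FT preimage_setT.
move=> i; have [mFi Fioo] := mF i; split.
  by rewrite -[X in measurable X]setTI; exact: mg.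
rewrite /prod_cons /pushforward -comp_preimage.
by rewrite (_ : g \o _ = id) ?preimage_id//; apply/funext => p; exact: gK.
Qed.

HB.instance Definition _ := Measure_isSigmaFinite.Build _ _ _ prod_cons
  prod_cons_sigma_finite.

End prod_cons.


Fixpoint power_measure d (T : measurableType d) (R : realType)
    (m1 : {sigma_finite_measure set T -> \bar R}) (n : nat) :
    {sigma_finite_measure set (n.-tuple T) -> \bar R} :=
  match n with
  | 0 => \d_([tuple] : 0.-tuple T)
  | m.+1 => prod_cons m1 (power_measure m1 m)
  end.

Definition lebesgue_tuple (R : realType) (d : nat) :
    {sigma_finite_measure set (d.-tuple (measurableTypeR R)) -> \bar R} :=
  power_measure (@lebesgue_measure R) d.

(* The integral over R^d; the sigma-algebra lives on tuples, the topology and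
   the derivatives on row vectors. *)
Definition integral_rV (R : realType) (d : nat) (g : 'rV[R]_d -> R) : R :=
  \int[lebesgue_tuple R d]_t g (\row_i tnth t i).

Definition hermite (R : realType) (n : nat) (x : R) : R :=
  (-1) ^+ n * expR (x ^+ 2 / 2) * derive1n n (fun y : R => expR (- (y ^+ 2 / 2))) x.

Definition hermite_fun (R : realType) (n : nat) (x : R) : R :=
  (Num.sqrt (Num.sqrt (2 * pi) * n`!%:R))^-1 * expR (- (x ^+ 2 / 4)) * hermite n x.

Definition multi_index (d : nat) := {ffun 'I_d -> nat}.

Definition hermite_mfun (R : realType) (d : nat) (b : multi_index d) (x : 'rV[R]_d) : R :=
  \prod_(j < d) hermite_fun (b j) (x 0 j).

Definition hermite_weight (R : realType) (d : nat) (b : multi_index d) : R :=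
  (2 * (\sum_j b j) + d)%:R.

Definition hermite_coef (R : realType) (d : nat) (phi : 'rV[R]_d -> R)
    (b : multi_index d) : R :=
  integral_rV (fun x => phi x * hermite_mfun b x).

(* |phi|_n, as an extended real: it is finite when phi is a Schwartz function,
   but the suprema over time taken below need not be. *)
Definition hermite_norm (R : realType) (d n : nat) (phi : 'rV[R]_d -> R) : \bar R :=
  sqrte (\esum_(b in [set: multi_index d])
    (hermite_weight R b ^+ (2 * n) * hermite_coef phi b ^+ 2)%:E).

Definition partial (R : realType) (d : nat) (i : 'I_d) (phi : 'rV[R]_d -> R) :
    'rV[R]_d -> R :=
  'D_(delta_mx 0 i) phi.

Definition partials (R : realType) (d : nat) (s : seq 'I_d) (phi : 'rV[R]_d -> R) :
    'rV[R]_d -> R :=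
  foldr (@partial R d) phi s.

Definition laplacian (R : realType) (d : nat) (phi : 'rV[R]_d -> R) (x : 'rV[R]_d) : R :=
  \sum_(i < d) partial i (partial i phi) x.

Definition smooth (R : realType) (d : nat) (phi : 'rV[R]_d -> R) : Prop :=
  forall s : seq 'I_d, continuous (partials s phi) /\
    forall i x, derivable (partials s phi) x (delta_mx 0 i).

Definition schwartz (R : realType) (d : nat) : set ('rV[R]_d -> R) :=
  [set phi | smooth phi /\
    forall (s : seq 'I_d) (k : nat), exists C : R,
      forall x : 'rV[R]_d, `|x| ^+ k * `|partials s phi x| <= C].

Definition rapid_seq (R : realType) (d : nat) : set (multi_index d -> R) :=
  [set a | forall n : nat, (\esum_(b in [set: multi_index d])
    (hermite_weight R b ^+ (2 * n) * `|a b| ^+ 2)%:E < +oo)%E].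

Definition tempered_seq (R : realType) (d : nat) : set (multi_index d -> R) :=
  [set a | exists (C : R) (m : nat), forall b, `|a b| <= C * hermite_weight R b ^+ m].

(* Both sequence spaces consist of real families: an extended real family
   belongs to S when all its terms are finite and the real family is in S. *)
Definition in_seq_space (R : realType) (d : nat) (S : set (multi_index d -> R))
    (X : multi_index d -> \bar R) : Prop :=
  exists2 a, S a & X = EFin \o a.

(* An element of E / N is a coset of N, i.e. a set of elements. *)

Definition coset_set (V : zmodType) (N : set V) (v : V) : set V :=
  [set w | N (w - v)].

Definition quotient_set (V : zmodType) (E N : set V) : set (set V) :=
  [set coset_set N v | v in E].

(* The map [v] |-> [P v] to cosets of N: the union of the cosets [P v] over all
   representatives v, which are all equal when P is compatible with the
   quotients. *)
Definition quotient_map (V W : zmodType) (N : set W) (P : V -> W) (U : set V) : set W :=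
  \bigcup_(v in U) coset_set N (P v).

Section space_algebra.
Context {R : realType} (d : nat).
Local Notation family := (multi_index d -> 'rV[R]_d -> R).

Definition space_families (S : set (multi_index d -> R)) : set family :=
  [set f | (forall b, schwartz (f b)) /\
    forall n, in_seq_space S (fun b => hermite_norm n (f b))].

Definition H_moderate := space_families (@tempered_seq R d).
Definition H_negligible := space_families (@rapid_seq R d).
Definition H_algebra : set (set family) := quotient_set H_moderate H_negligible.

End space_algebra.

(* A function on [0, T] x R^d is represented
   by a total function of time of which only the values on [0, T] matter:
   families that agree on [0, T] differ by a negligible one. *)

Section time_algebras.
Context {R : realType} (d : nat) (T : R).
Local Notation tfun := (R -> 'rV[R]_d -> R).
Local Notation tfamily := (multi_index d -> tfun).

Definition time_quotient (f : tfun) (t : R) (x : 'rV[R]_d) (s : R) : R :=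
  (f s x - f t x) / (s - t).

(* The derivative in [0, T], which is one-sided at 0 and at T. *)
Definition time_derivative (f : tfun) (t : R) (x : 'rV[R]_d) : R :=
  lim (time_quotient f t x s @[s --> within `[0, T] t^']).

Definition S0 : set tfun :=
  [set f | (forall t : R, 0 <= t <= T -> schwartz (f t)) /\
    forall x, {within `[0, T], continuous (f ^~ x)}].

Definition S1 : set tfun :=
  [set f | (forall t : R, 0 <= t <= T -> schwartz (f t)) /\
    forall x,
      (forall t : R, 0 <= t <= T ->
        cvg (time_quotient f t x s @[s --> within `[0, T] t^'])) /\
      {within `[0, T], continuous (time_derivative f ^~ x)}].

Definition sup_norm (n : nat) (f : tfun) : \bar R :=
  ereal_sup [set hermite_norm n (f t) | t in `[0, T]].

Definition time_families0 (S : set (multi_index d -> R)) : set tfamily :=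
  [set f | (forall b, S0 (f b)) /\
    forall n, in_seq_space S (fun b => sup_norm n (f b))].

Definition time_families1 (S : set (multi_index d -> R)) : set tfamily :=
  [set f | [/\ forall b, S1 (f b),
    forall b (t : R), 0 <= t <= T -> schwartz (time_derivative (f b) t) &
    forall n, in_seq_space S (fun b => sup_norm n (f b)) /\
      in_seq_space S (fun b => sup_norm n (time_derivative (f b)))]].

Definition H0_moderate := time_families0 (@tempered_seq R d).
Definition H0_negligible := time_families0 (@rapid_seq R d).
Definition H0_algebra : set (set tfamily) := quotient_set H0_moderate H0_negligible.

Definition H1_moderate := time_families1 (@tempered_seq R d).
Definition H1_negligible := time_families1 (@rapid_seq R d).
Definition H1_algebra : set (set tfamily) := quotient_set H1_moderate H1_negligible.

Definition class_dt : set tfamily -> set tfamily :=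
  quotient_map H0_negligible (fun u b => time_derivative (u b)).

Definition class_laplacian : set tfamily -> set tfamily :=
  quotient_map H0_negligible (fun u b t => laplacian (u b t)).

Definition class_scale (a : R) : set tfamily -> set tfamily :=
  quotient_map H0_negligible (fun u b t x => a * u b t x).

Definition class_initial : set tfamily -> set (multi_index d -> 'rV[R]_d -> R) :=
  quotient_map (@H_negligible R d) (fun u b => u b 0).

Definition generalized_solution (f : set (multi_index d -> 'rV[R]_d -> R))
    (u : set tfamily) : Prop :=
  class_dt u = class_scale (2^-1) (class_laplacian u) /\ class_initial u = f.

End time_algebras.

(* Main.v *)
(* Everything is transported to Hermite coefficients. A Schwartz function is the
   sum of its Hermite series, and multiplication of the rapidly decreasing
   coefficients by the matrix of [1/2 * laplacian] (banded, but not diagonal)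
   satisfies the energy inequality [<lam^2n a, L a> <= C |a|_n^2]: integration by
   parts leaves a negative square and a bounded commutator with the weight.
   Hence the truncated linear systems are bounded in each norm uniformly in the
   truncation and converge to a heat flow that is bounded in every norm on
   [0, T] (existence, with moderate bounds preserved). The same inequality,
   applied to the coefficients of the difference of two solutions, whose
   derivative is obtained by dominated convergence, bounds every norm of this
   difference by those of its initial value and of its residual in the equation;
   both are negligible, hence so is the difference (uniqueness). *)
Require Import Defs.
From mathcomp Require Import all_boot all_order all_algebra.
From mathcomp Require Import all_classical all_reals all_analysis.
From mathcomp Require Import measurable_realfun.
From mathcomp Require Import ring lra zify.

Set Implicit Arguments.
Unset Strict Implicit.
Unset Printing Implicit Defensive.
Import Order.TTheory GRing.Theory Num.Theory.
Import numFieldNormedType.Exports.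

Local Open Scope classical_set_scope.
Local Open Scope ring_scope.

(** * Hermite polynomials and functions *)

(** Since the norms are defined through Hermite coefficients, the work is done there, and functions
    must be recovered from coefficients at the end. The finiteness of the norms required of a family
    makes the coefficients of its members rapidly decreasing, and completeness of the Hermite
    functions then identifies each member with its Hermite series. Completeness is wanted pointwise,
    for bounded continuous functions, and is obtained from Gaussian moments.

    The obstacle is that the Hermite basis diagonalises the harmonic oscillator and not the
    Laplacian: the entries of the matrix grow like the weight, so boundedness in weighted norms is a
    matter of cancellation. A second concern is uniformity over the family index: the constants
    [flow_const], [heat_const] and [perturbed_const] depend on [d], [n] and [T] only and multiply
    the data linearly, so moderate data give moderate solutions and negligible data negligible ones.
    Passing from sup to square-sum norms costs [d] powers of the weight and each use of the heat
    operator costs two; this is harmless because the definitions quantify over all [n]. *)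

Section hermite1d.
Context {R : realType}.
Implicit Types (n : nat) (x y : R).

(** Probabilists' Hermite polynomials. The recurrence is that of the polynomial factor in the
    derivatives of [exp (- x^2 / 2)]: differentiating [p exp (- x^2 / 2)] turns [p] into minus
    [x p - p']. *)
Fixpoint He n : {poly R} := if n is m.+1 then 'X * He m - (He m)^`() else 1.

Lemma deriv_HeS n : (He n.+1)^`() = He n *+ n.+1.
Proof.
elim: n => [|n IH]; first by rewrite /= (derivC 1) subr0 mulr1 derivX.
have {1}-> : He n.+2 = 'X * He n.+1 - (He n.+1)^`() by [].
rewrite derivB derivM derivX mul1r IH derivMn mulrnAr.
by rewrite -addrA -mulrnBl [RHS]mulrS.
Qed.

Lemma deriv_He n : (He n)^`() = He n.-1 *+ n.
Proof. by case: n => [|n]; rewrite ?deriv_HeS//= derivC mulr0n. Qed.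

Lemma mulX_He n : 'X * He n = He n.+1 + He n.-1 *+ n.
Proof. by rewrite -deriv_He /= subrK. Qed.

Lemma is_derive_gauss (c x : R) :
  is_derive x 1 (fun y => expR (- (c * y ^+ 2))) (- (2 * c * x) * expR (- (c * x ^+ 2))).
Proof.
apply: is_derive_eq; rewrite !scaler1 /GRing.scale /=; ring.
Qed.

Lemma derive1n_gauss n :
  derive1n n (fun y : R => expR (- (y ^+ 2 / 2))) =
  (fun x => (-1) ^+ n * (He n).[x] * expR (- (2^-1 * x ^+ 2))).
Proof.
elim: n => [|n IH].
  by apply/funext => x; rewrite derive1n0 expr0 hornerC !mul1r mulrC.
apply/funext => x; rewrite derive1nS IH derive1E.
have D := is_derive_gauss 2^-1 x.
rewrite (@derive_val _ _ _ _ _ _ _ (is_deriveM _ D)) /=.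
rewrite !hornerE /GRing.scale /= exprS.
by field.
Qed.

Lemma hermiteE n x : hermite n x = (He n).[x].
Proof.
rewrite /hermite derive1n_gauss.
set s := (-1) ^+ n; have ss : s * s = 1 by rewrite -expr2 sqrr_sign.
have ee : expR (x ^+ 2 / 2) * expR (- (2^-1 * x ^+ 2)) = 1.
  by rewrite mulrC -expRD mulrC addNr expR0.
transitivity (s * s * (expR (x ^+ 2 / 2) * expR (- (2^-1 * x ^+ 2))) * (He n).[x]).
  by ring.
by rewrite ss ee !mul1r.
Qed.

Definition hnorm n : R := (Num.sqrt (Num.sqrt (2 * pi) * n`!%:R))^-1.

Lemma hnorm_neq0 n : hnorm n != 0.
Proof.
rewrite invr_eq0 sqrtr_eq0 -ltNge mulr_gt0 ?ltr0n ?fact_gt0// sqrtr_gt0.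
by rewrite mulr_gt0 ?pi_gt0.
Qed.

Lemma hnormS n : Num.sqrt n.+1%:R * hnorm n.+1 = hnorm n.
Proof.
rewrite /hnorm factS natrM mulrCA sqrtrM ?ler0n// invfM mulVKf//.
Qed.

Lemma hermite_funE n x :
  hermite_fun n x = hnorm n * expR (- (4^-1 * x ^+ 2)) * (He n).[x].
Proof. by rewrite /hermite_fun hermiteE -/(hnorm n) (mulrC 4^-1). Qed.

(** At [n = 0] the index [n.-1] is a dummy and both sides vanish; thanks to this convention the
    ladder relations below need no case distinction. *)
Lemma hnormM n (e h : R) :
  hnorm n * e * (h *+ n) = Num.sqrt n%:R * (hnorm n.-1 * e * h).
Proof.
case: n => [|n]; first by rewrite mulr0n mulr0 sqrtr0 !mul0r.
have E : Num.sqrt n.+1%:R * Num.sqrt n.+1%:R = n.+1%:R :> R.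
  by rewrite -expr2 sqr_sqrtr.
rewrite /= -(hnormS n) -(mulr_natr h).
move: (Num.sqrt n.+1%:R) E => s <-; ring.
Qed.

(** [mulX_He] after normalisation. With [is_derive_hermite_fun] it presents [x] and [d/dx] as the
    sum and half the difference of the lowering and raising operators of the harmonic oscillator,
    the source of all banded matrices below. *)
Lemma mulX_hermite_fun n x : x * hermite_fun n x =
  Num.sqrt n%:R * hermite_fun n.-1 x + Num.sqrt n.+1%:R * hermite_fun n.+1 x.
Proof.
rewrite !hermite_funE; set e := expR _.
have -> : x * (hnorm n * e * (He n).[x]) = hnorm n * e * ('X * He n).[x].
  by rewrite hornerM hornerX; ring.
rewrite mulX_He hornerD hornerMn mulrDr addrC; congr (_ + _); last first.
  by rewrite -(hnormS n); ring.
exact: hnormM.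
Qed.

Lemma is_derive_hermite_fun n x : is_derive x 1 (hermite_fun n)
  (2^-1 * (Num.sqrt n%:R * hermite_fun n.-1 x - Num.sqrt n.+1%:R * hermite_fun n.+1 x)).
Proof.
have -> : hermite_fun n = (fun x => hnorm n * expR (- (4^-1 * x ^+ 2)) * (He n).[x]).
  by apply/funext => y; rewrite hermite_funE.
have D := is_derive_gauss 4^-1 x.
apply: is_derive_eq; rewrite /GRing.scale /=.
have := mulX_hermite_fun n x; rewrite hermite_funE.
have -> : hnorm n * expR (- (4^-1 * x ^+ 2)) * (He n)^`().[x] =
  Num.sqrt n%:R * hermite_fun n.-1 x.
  by rewrite deriv_He hermite_funE hornerMn hnormM.
move=> E.
have -> : Num.sqrt n.+1%:R * hermite_fun n.+1 x =
  x * (hnorm n * expR (- (4^-1 * x ^+ 2)) * (He n).[x]) -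
  Num.sqrt n%:R * hermite_fun n.-1 x by rewrite E; ring.
by field.
Qed.

End hermite1d.

(** * Real-valued integrals *)

Section rintegral.
Context d (T : measurableType d) (R : realType) (mu : {measure set T -> \bar R}).
Implicit Types f g h : T -> R.

Definition intg f := mu.-integrable [set: T] (EFin \o f).

Lemma intg_measurable f : intg f -> measurable_fun [set: T] f.
Proof. by move=> /measurable_int/measurable_EFinP. Qed.

Lemma intg_le f g : measurable_fun [set: T] f -> (forall x, `|f x| <= g x) ->
  intg g -> intg f.
Proof.
move=> mf fg; apply: le_integrable => //; first exact/measurable_EFinP.
by move=> x _ /=; rewrite lee_fin (le_trans (fg x))// ler_norm.
Qed.

Lemma intgD f g : intg f -> intg g -> intg (fun x => f x + g x).
Proof.
move=> fi gi; have := integrableD measurableT fi gi.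
by apply: eq_integrable => // x _ /=; rewrite EFinD.
Qed.

Lemma intgZ r f : intg f -> intg (fun x => r * f x).
Proof.
move=> fi; have := integrableZl measurableT r fi.
by apply: eq_integrable => // x _ /=; rewrite EFinM.
Qed.

Lemma intg_sum I (s : seq I) (F : I -> T -> R) :
  (forall i, intg (F i)) -> intg (fun x => \sum_(i <- s) F i x).
Proof.
move=> Fi; have := integrable_sum measurableT s (P := xpredT) (fun i _ => Fi i).
by apply: eq_integrable => // x _ /=; rewrite sumEFin.
Qed.

Lemma intg_bounded_mul f g (M : R) : measurable_fun [set: T] g ->
  (forall x, `|g x| <= M) -> intg f -> intg (fun x => g x * f x).
Proof.
move=> mg gM fi; apply: (@intg_le _ (fun x => M * `|f x|)).
- by apply: measurable_funM => //; exact: intg_measurable.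
- by move=> x; rewrite normrM ler_wpM2r.
- by apply: intgZ; exact: (integrable_norm fi).
Qed.

Lemma RintD f g : intg f -> intg g ->
  \int[mu]_x (f x + g x) = \int[mu]_x f x + \int[mu]_x g x.
Proof. by move=> fi gi; rewrite RintegralD. Qed.

Lemma RintB f g : intg f -> intg g ->
  \int[mu]_x (f x - g x) = \int[mu]_x f x - \int[mu]_x g x.
Proof. by move=> fi gi; rewrite RintegralB. Qed.

Lemma RintZ r f : intg f -> \int[mu]_x (r * f x) = r * \int[mu]_x f x.
Proof. by move=> fi; rewrite RintegralZl. Qed.

Lemma Rint0 : \int[mu]_x (0 : R) = 0.
Proof. by rewrite /Rintegral integral0. Qed.

Lemma Rint_sum I (s : seq I) (F : I -> T -> R) : (forall i, intg (F i)) ->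
  \int[mu]_x (\sum_(i <- s) F i x) = \sum_(i <- s) \int[mu]_x F i x.
Proof.
move=> Fi; elim: s => [|i s IH].
  by under eq_Rintegral do rewrite big_nil; rewrite Rint0 big_nil.
under eq_Rintegral do rewrite big_cons.
by rewrite RintD ?IH ?big_cons//; exact: intg_sum.
Qed.

Lemma Rint_le f g : intg f -> intg g -> (forall x, f x <= g x) ->
  \int[mu]_x f x <= \int[mu]_x g x.
Proof. by move=> fi gi fg; apply: le_Rintegral. Qed.

Lemma Rint_norm_le f g : intg f -> intg g -> (forall x, `|f x| <= g x) ->
  `|\int[mu]_x f x| <= \int[mu]_x g x.
Proof.
move=> fi gi fg; apply: (le_trans (le_normr_Rintegral measurableT fi)).
by apply: Rint_le => //; exact: (integrable_norm fi).
Qed.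

Lemma Rint_dominated (f_ : nat -> T -> R) f g :
  (forall n, measurable_fun [set: T] (f_ n)) ->
  (forall x, f_ n x @[n --> \oo] --> f x) -> intg g ->
  (forall n x, `|f_ n x| <= g x) ->
  (\int[mu]_x f_ n x) @[n --> \oo] --> \int[mu]_x f x.
Proof.
move=> mf ff gi fg.
have mf_ n : measurable_fun [set: T] (EFin \o f_ n) by exact/measurable_EFinP.
have ff_ x : (f_ n x)%:E @[n --> \oo] --> (f x)%:E.
  by apply: cvg_EFin; [exact: nearW | exact: ff].
have mfl : measurable_fun [set: T] (EFin \o f).
  by apply: (emeasurable_fun_cvg _ _ mf_) => x _; exact: ff_.
have [fi _ cvgf] := @dominated_convergence _ _ _ mu _ measurableT
  (fun n => EFin \o f_ n) (EFin \o f) (EFin \o g) mf_ mfl (aeW _ (fun x _ => ff_ x))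
  gi (aeW _ (fun x n _ => fg n x)).
apply: fine_cvg; rewrite fineK; last exact: integrable_fin_num.
exact: cvgf.
Qed.

End rintegral.
Arguments intg {d T R}.

(** * Orthonormality and completeness of the Hermite functions *)

Section gauss1d.
Context {R : realType}.
Local Notation mu := (@lebesgue_measure R).
Implicit Types (c x y : R) (p q : {poly R}).

Lemma integral_gauss c y : 0 < c ->
  intg mu (fun x => expR (- (c * (x - y) ^+ 2))) /\
  \int[mu]_x expR (- (c * (x - y) ^+ 2)) = Num.sqrt (pi / c).
Proof.
(* With variance [1 / (2 c)] the normal density of mean [y] is a multiple of the Gaussian with
   exponent [c]. *)
move=> c0; pose s := Num.sqrt (2 * c)^-1.
have s0 : s != 0 by rewrite sqrtr_eq0 -ltNge invr_gt0 mulr_gt0.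
have E x : normal_pdf y s x = (Num.sqrt (pi / c))^-1 * expR (- (c * (x - y) ^+ 2)).
  rewrite normal_pdfE// /normal_peak /normal_fun /s sqr_sqrtr; last first.
    by rewrite invr_ge0 mulr_ge0// ltW.
  have c0' := lt0r_neq0 c0.
  congr ((Num.sqrt _)^-1 * expR _); rewrite -mulr_natr; last by field.
  by rewrite -mulr_natr; field.
have P : 0 < Num.sqrt (pi / c) by rewrite sqrtr_gt0 divr_gt0 ?pi_gt0.
have N := integrable_normal_pdf y s; have I1 := integral_normal_pdf y s.
have I : intg mu (fun x => expR (- (c * (x - y) ^+ 2))).
  have := @intgZ _ _ _ mu (Num.sqrt (pi / c)) _ N; apply: eq_integrable => // x _ /=.
  by rewrite E mulrA divff ?mul1r// gt_eqF.
split => //.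
have : \int[mu]_x normal_pdf y s x = 1 by rewrite /Rintegral I1.
under eq_Rintegral do rewrite E.
rewrite RintZ// => H; apply: (mulfI (x := (Num.sqrt (pi / c))^-1)).
  by rewrite invr_eq0 gt_eqF.
by rewrite H mulVf// gt_eqF.
Qed.

Definition pg c p x := p.[x] * expR (- (c * x ^+ 2)).

(** Induction on [p]: half of the exponent absorbs the polynomial of lower degree and the other half
    the new factor [x], because [|x| <= 1 + x^2 <= (1 + 2 / c) exp (c x^2 / 2)]. *)
Lemma poly_gauss_bound c p : 0 < c -> exists2 C : R, 0 <= C &
  forall x, `|p.[x]| <= C * expR (c * x ^+ 2).
Proof.
elim/poly_ind: p c => [|p r IH] c c0.
  by exists 0 => // x; rewrite horner0 normr0 mul0r.
have c20 : 0 < c / 2 by rewrite divr_gt0.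
have [C C0 HC] := IH _ c20.
exists (C * (1 + (c / 2)^-1) + `|r|).
  by rewrite addr_ge0// mulr_ge0// addr_ge0// invr_ge0 ltW.
move=> x; rewrite hornerMXaddC (le_trans (ler_normD _ _))// mulrDl lerD//; last first.
  rewrite ler_peMr// -expR0 ler_expR mulr_ge0 ?sqr_ge0// ltW//.
have -> : expR (c * x ^+ 2) = expR (c / 2 * x ^+ 2) * expR (c / 2 * x ^+ 2).
  by rewrite -expRD; congr expR; field.
rewrite normrM mulrACA ler_pM//.
apply: (@le_trans _ _ ((1 + (c / 2)^-1) * (1 + c / 2 * x ^+ 2))); last first.
  by rewrite ler_wpM2l ?expR_ge1Dx// addr_ge0// invr_ge0 ltW.
have -> : (1 + (c / 2)^-1) * (1 + c / 2 * x ^+ 2) =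
    1 + x ^+ 2 + ((c / 2)^-1 + c / 2 * x ^+ 2).
  by field; rewrite gt_eqF.
have i0 : 0 <= (c / 2)^-1 by rewrite invr_ge0 ltW.
have s0 : 0 <= c / 2 * x ^+ 2 by rewrite mulr_ge0 ?sqr_ge0// ltW.
apply: ler_wpDr; first exact: addr_ge0.
rewrite -real_normK ?num_real//; have := normr_ge0 x; nra.
Qed.

Lemma continuous_pg c p : continuous (pg c p).
Proof.
move=> x; apply: cvgM; first exact: continuous_horner.
apply: (@continuous_comp _ _ _ (fun x => - (c * x ^+ 2)) expR); last exact: continuous_expR.
apply: cvgN; apply: cvgM; first exact: cvg_cst.
exact: exprn_continuous.
Qed.

Lemma pg_bound c p : 0 < c -> exists2 C : R, 0 <= C &
  forall x, `|pg c p x| <= C * expR (- (c / 2 * x ^+ 2)).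
Proof.
move=> c0; have [C C0 HC] := poly_gauss_bound p (divr_gt0 c0 (ltr0Sn R 1)).
exists C => // x; rewrite normrM (ger0_norm (expR_ge0 _)).
apply: (le_trans (ler_wpM2r (expR_ge0 _) (HC x))).
by rewrite -[leLHS]mulrA -expRD (_ : _ + _ = - (c / 2 * x ^+ 2))//; field.
Qed.

Lemma intg_pg c p : 0 < c -> intg mu (pg c p).
Proof.
move=> c0; have [C C0 HC] := pg_bound p c0.
apply: intg_le; [|exact: HC|].
  by apply: continuous_measurable_fun; exact: continuous_pg.
apply: intgZ; have [+ _] := @integral_gauss (c / 2) 0 (divr_gt0 c0 (ltr0Sn R 1)).
by under eq_fun do rewrite subr0.
Qed.

Lemma is_derive_pg c p x : is_derive x 1 (pg c p) (pg c (p^`() - (2 * c) *: ('X * p)) x).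
Proof.
have D := is_derive_gauss c x.
rewrite /pg; apply: is_derive_eq; rewrite /GRing.scale /= hornerD hornerN hornerZ hornerM hornerX; ring.
Qed.

Lemma continuous_derive_Rintegral (F f : R -> R) (a b : R) : a < b ->
  (forall x, is_derive x 1 F (f x)) -> continuous f ->
  \int[mu]_(x in `[a, b]) f x = F b - F a.
Proof.
move=> ab dF cf; rewrite /Rintegral (@continuous_FTC2 _ _ F)//.
- exact: continuous_subspaceT.
- have cF : continuous F.
    by move=> x; apply/differentiable_continuous/derivable1_diffP; case: (dF x).
  split => [x _||]; first by case: (dF x).
  - by apply: cvg_at_right_filter; exact: cF.
  - by apply: cvg_at_left_filter; exact: cF.
- by move=> x _; rewrite derive1E; case: (dF x).
Qed.

Lemma cvg_invn : n%:R^-1 @[n --> \oo] --> (0 : R).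
Proof. by rewrite -cvg_shiftS; exact: cvg_harmonic. Qed.

Lemma pg_cvg0 c p : 0 < c ->
  pg c p n%:R @[n --> \oo] --> (0 : R) /\ pg c p (- n%:R) @[n --> \oo] --> (0 : R).
Proof.
move=> c0; have [C C0 HC] := pg_bound p c0.
have H (u : nat -> R) : (forall n, `|u n| = n%:R) -> pg c p (u n) @[n --> \oo] --> (0 : R).
  move=> un; apply/norm_cvg0P.
  apply: (@squeeze_cvgr _ _ _ _ (cst 0) (fun n => C * ((c / 2)^-1 * n%:R^-1))).
  - near=> n; rewrite normr_ge0 (le_trans (HC _))// ler_wpM2l//.
    have n0 : (0 < n)%N by near: n; exists 1%N.
    have c2 : 0 < c / 2 by rewrite divr_gt0.
    rewrite -real_normK ?num_real// un expRN -invfM lef_pV2 ?posrE ?expR_gt0//; last first.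
      by rewrite mulr_gt0// ltr0n.
    apply: le_trans (expR_ge1Dx _); apply: ler_wpDl => //.
    by rewrite ler_pM2l// expr2 -natrM ler_nat leq_pmulr.
  - exact: cvg_cst.
  - have -> : (0 : R) = C * ((c / 2)^-1 * 0) by rewrite !mulr0.
    apply: cvgM; first exact: cvg_cst.
    apply: cvgM; first exact: cvg_cst.
    exact: cvg_invn.
by split; apply: H => n; rewrite ?normrN normr_nat.
Unshelve. all: by end_near. Qed.

(** The integrand is the derivative of [pg c p], which vanishes at both infinities: the fundamental
    theorem of calculus on [[-n, n]], then dominated convergence. This is integration by parts for
    Gaussian weights. *)
Lemma Rintegral_pg_deriv c p : 0 < c ->
  \int[mu]_x pg c (p^`() - (2 * c) *: ('X * p)) x = 0.
Proof.
move=> c0; set q := _ - _.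
have : (\int[mu]_(x in `[- n%:R, n%:R]) pg c q x) @[n --> \oo] --> \int[mu]_x pg c q x.
  under eq_fun do rewrite Rintegral_mkcond.
  refine (@Rint_dominated _ _ R mu _ _ (fun x => `|pg c q x|) _ _ _ _).
  - move=> n; apply/(measurable_restrictT _ _).1 => //.
    apply: measurable_funTS; apply: continuous_measurable_fun; exact: continuous_pg.
  - move=> x; apply: cvg_near_cst; near=> n.
    rewrite patchE mem_set//= in_itv /= -ler_norml.
    near: n; exact: nbhs_infty_ger.
  - exact: (integrable_norm (intg_pg q c0)).
  - by move=> n x; rewrite patchE; case: ifP => // _; rewrite normr0.
have [h1 h2] := pg_cvg0 p c0.
move/cvg_lim => <- //; apply/cvg_lim => //.
rewrite -[X in _ --> X](subr0 0); apply: cvg_trans (cvgB h1 h2).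
apply: near_eq_cvg; near=> n.
rewrite [LHS]/GRing.add /= (@continuous_derive_Rintegral (pg c p) (pg c q) _ _ _
  (is_derive_pg c p) (@continuous_pg c q))//.
rewrite gtrN// ltr0n; near: n; by exists 1%N.
Unshelve. all: by end_near. Qed.

(** Integrating by parts trades a raising step in one factor for a lowering step in the other, with
    the factor [n]; both indices descend together until one of them is zero. *)
Lemma Rintegral_He m n :
  \int[mu]_x pg 2^-1 (He m * He n) x = if m == n then n`!%:R * Num.sqrt (2 * pi) else 0.
Proof.
have c0 : 0 < 2^-1 :> R by rewrite invr_gt0.
have rec m' n' : \int[mu]_x pg 2^-1 (He m'.+1 * He n') x =
    n'%:R * \int[mu]_x pg 2^-1 (He m' * He n'.-1) x.
  rewrite -RintZ; last exact: intg_pg.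
  rewrite -[RHS]subr0 -(Rintegral_pg_deriv (He m' * He n') c0) -RintB; last 2 first.
  - by apply: intgZ; exact: intg_pg.
  - exact: intg_pg.
  apply: eq_Rintegral => x _; rewrite /pg derivM [He m'.+1]/=.
  have E : ((He n')^`()).[x] = n'%:R * (He n'.-1).[x].
    by rewrite deriv_He hornerMn mulr_natl.
  rewrite !(hornerD, hornerN, hornerM, hornerZ, hornerX) E mulfV//.
  move: (He _).[x] (He _).[x] (He _).[x] (expR _) (n'%:R) => a b c e k.
  move: (_.[x]) => g; ring.
elim: m n => [|m IH] [|n]; last first.
- rewrite rec IH eqSS /=; case: eqP => [_|_]; last by rewrite mulr0.
  by rewrite factS natrM mulrA.
- by rewrite rec mul0r.
- have -> : He 0 * He n.+1 = He n.+1 * He 0 :> {poly R} by rewrite mulrC.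
  by rewrite rec mul0r.
rewrite eqxx fact0 [1%:R]mulr1n mul1r.
have [_] := integral_gauss 0 c0; rewrite invrK mulrC => <-.
by apply: eq_Rintegral => x _; rewrite /pg /= mulr1 hornerC mul1r subr0.
Qed.

Lemma hermite_fun_pg n : hermite_fun n = (fun x => hnorm n * pg 4^-1 (He n) x).
Proof. by apply/funext => x; rewrite hermite_funE /pg -!mulrA [_.[_] * _]mulrC. Qed.

Lemma hermite_fun_mul_pg m n x :
  hermite_fun m x * hermite_fun n x = hnorm m * hnorm n * pg 2^-1 (He m * He n) x.
Proof.
rewrite !hermite_funE /pg hornerM.
have -> : expR (- (2^-1 * x ^+ 2)) = expR (- (4^-1 * x ^+ 2)) * expR (- (4^-1 * x ^+ 2)).
  by rewrite -expRD; congr expR; field.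
ring.
Qed.

Lemma intg_hermite_fun n : intg mu (hermite_fun n).
Proof. by rewrite hermite_fun_pg; apply: intgZ; apply: intg_pg; rewrite invr_gt0. Qed.

Lemma intg_hermite_fun2 m n : intg mu (fun x => hermite_fun m x * hermite_fun n x).
Proof.
under eq_fun do rewrite hermite_fun_mul_pg.
by apply: intgZ; apply: intg_pg; rewrite invr_gt0.
Qed.

Lemma continuous_hermite_fun n : continuous (@hermite_fun R n).
Proof.
rewrite hermite_fun_pg => x; apply: cvgM; first exact: cvg_cst.
exact: continuous_pg.
Qed.

Lemma hermite_fun_orthonormal m n :
  \int[mu]_x (hermite_fun m x * hermite_fun n x) = (m == n)%:R.
Proof.
under eq_Rintegral do rewrite hermite_fun_mul_pg.
rewrite RintZ; last by apply: intg_pg; rewrite invr_gt0.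
rewrite Rintegral_He; case: eqP => [->|]; last by rewrite mulr0.
have := hnorm_neq0 (R := R) n; rewrite /hnorm invr_eq0 => h.
rewrite -invfM -expr2 sqr_sqrtr ?mulr_ge0 ?sqrtr_ge0// [X in _ * X]mulrC mulVf//.
by move: h; rewrite sqrtr_eq0 -ltNge mulrC => /lt0r_neq0.
Qed.

(** A Sobolev argument: [h^2] is the integral of [2 h h'] from minus infinity, and
    [2 h h' <= h^2 + h'^2]. The ladder formula bounds [h'^2] by half the sum of two weighted
    squares, so by orthonormality the total is at most [1 + (2 n + 1) / 2]. A bound polynomial in
    [n] is all that rapid decrease of coefficients requires. *)
Lemma hermite_fun_sqr_le n x : hermite_fun n x ^+ 2 <= n.+2%:R.
Proof.
pose h k := @hermite_fun R k.
pose B y := h n y * h n y + 2^-1 * (n%:R * (h n.-1 y * h n.-1 y) + n.+1%:R * (h n.+1 y * h n.+1 y)).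
have iB : intg mu B.
  apply: intgD; first exact: intg_hermite_fun2.
  by apply: intgZ; apply: intgD; apply: intgZ; exact: intg_hermite_fun2.
have B0 y : 0 <= B y.
  have hh k : 0 <= h k y * h k y by rewrite -expr2 sqr_ge0.
  apply: addr_ge0 => //; apply: mulr_ge0; first by rewrite invr_ge0.
  by apply: addr_ge0; apply: mulr_ge0.
have IB : \int[mu]_y B y <= n.+2%:R.
  rewrite RintD; [|exact: intg_hermite_fun2|]; last first.
    by apply: intgZ; apply: intgD; apply: intgZ; exact: intg_hermite_fun2.
  rewrite RintZ; last by apply: intgD; apply: intgZ; exact: intg_hermite_fun2.
  rewrite RintD; [|by apply: intgZ; exact: intg_hermite_fun2..].
  rewrite !RintZ; [|exact: intg_hermite_fun2..].
  rewrite !hermite_fun_orthonormal !eqxx !mulr1.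
  rewrite -[n.+2%:R]natr1 -[n.+1%:R]natr1 [true%:R]mulr1n.
  by have := ler0n R n; lra.
pose f y := 2 * h n y * (2^-1 * (Num.sqrt n%:R * h n.-1 y - Num.sqrt n.+1%:R * h n.+1 y)).
have df y : is_derive y 1 (fun y => h n y ^+ 2) (f y).
  have D := is_derive_hermite_fun n y.
  by apply: is_derive_eq; rewrite /GRing.scale /= /f ?expr1 -/(h _) -/(h _) ?scaler_nat ?mulr_natl; rewrite /h; ring.
have cf : continuous f.
  move=> y; have ch k := @continuous_hermite_fun k y.
  apply: cvgM; first by apply: cvgM; [exact: cvg_cst|exact: ch].
  apply: cvgM; first exact: cvg_cst.
  by apply: cvgB; apply: cvgM; [exact: cvg_cst|exact: ch|exact: cvg_cst|exact: ch].
have fB y : f y <= B y.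
  rewrite /B /f -[in X in _ <= X](sqr_sqrtr (ler0n R n)) -[in X in _ <= X](sqr_sqrtr (ler0n R n.+1)).
  move: (h n y) (h n.-1 y) (h n.+1 y) (Num.sqrt n%:R) (Num.sqrt n.+1%:R) => a b c s t.
  have := sqr_ge0 (a - 2^-1 * (s * b - t * c)); have := sqr_ge0 (s * b + t * c); nra.
have le_a a : a < x -> h n x ^+ 2 - h n a ^+ 2 <= n.+2%:R.
  move=> ax; rewrite -(continuous_derive_Rintegral ax df cf) (le_trans _ IB)//.
  apply: (@le_trans _ _ (\int[mu]_(y in `[a, x]) B y)).
    apply: le_Rintegral => //; last exact: integrableS iB.
    apply: continuous_compact_integrable; first exact: segment_compact.
    exact: continuous_subspaceT.
  rewrite Rintegral_mkcond; apply: Rint_le => //.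
    have mB := intg_measurable iB.
    apply: intg_le iB.
      apply/(measurable_restrictT _ _).1 => //.
      by apply: measurable_funTS.
    by move=> y; rewrite patchE; case: ifP => _; rewrite ?normr0// ger0_norm.
  by move=> y; rewrite patchE; case: ifP.
have cvg0 : h n (- k%:R) ^+ 2 @[k --> \oo] --> (0 : R).
  have c0 : 0 < 4^-1 :> R by rewrite invr_gt0.
  have [_ H] := pg_cvg0 (He n) c0.
  have -> : (0 : R) = (hnorm n * 0) ^+ 2 by rewrite mulr0 expr0n.
  rewrite /h hermite_fun_pg.
  under eq_fun do rewrite expr2.
  by rewrite expr2; apply: cvgM; apply: cvgM; [exact: cvg_cst|exact: H|exact: cvg_cst|exact: H].
suff : h n x ^+ 2 - 0 <= n.+2%:R by rewrite subr0.
have C : h n x ^+ 2 - h n (- k%:R) ^+ 2 @[k --> \oo] --> h n x ^+ 2 - 0.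
  by apply: cvgB cvg0; exact: cvg_cst.
apply: (cvgr_to_le C).
near=> k; apply: le_a; rewrite ltrNl.
near: k; exact: nbhs_infty_gtr.
Unshelve. all: by end_near. Qed.

Lemma hermite_fun_le n x : `|hermite_fun n x| <= n.+2%:R.
Proof.
have := hermite_fun_sqr_le n x; rewrite -real_normK ?num_real//.
have : 1 <= n.+2%:R :> R by rewrite ler1n.
have := normr_ge0 (hermite_fun n x); nra.
Qed.

(* [exp q] is a limit of polynomials dominated by [exp (a x^2 + b)], so a
   function orthogonal to all polynomials times the Gaussian [exp (- c x^2)] is
   also orthogonal to them after multiplication by [exp q]. *)
Lemma dominated_exp_moments c p q (g : R -> R) (M a b : R) : 0 < c ->
  measurable_fun setT g -> (forall x, `|g x| <= M) -> a < c ->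
  (forall x, `|q.[x]| <= a * x ^+ 2 + b) ->
  (forall r, \int[mu]_x (g x * pg c r x) = 0) ->
  \int[mu]_x (g x * (expR q.[x] * pg c p x)) = 0.
Proof.
move=> c0 mg gM ac qab H.
have ca : 0 < c - a by rewrite subr_gt0.
pose P n : {poly R} := \sum_(0 <= k < n) (k`!%:R^-1) *: q ^+ k.
have PE n x : (P n).[x] = series (exp_coeff q.[x]) n.
  rewrite /P /series /= horner_sum; apply: eq_bigr => k _.
  by rewrite hornerZ horner_exp /exp_coeff /= mulrC.
have Pe x : (P n).[x] @[n --> \oo] --> expR q.[x].
  under eq_fun do rewrite PE.
  exact: is_cvg_series_exp_coeff.
have Pb n x : `|(P n).[x]| <= expR (a * x ^+ 2 + b).
  rewrite PE; apply: le_trans (_ : expR `|q.[x]| <= _); last by rewrite ler_expR.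
  rewrite (le_trans (ler_norm_sum _ _ _))//.
  apply: le_trans (_ : series (exp_coeff `|q.[x]|) n <= _).
    rewrite /series /=; apply: ler_sum => k _.
    by rewrite /exp_coeff /= normrM normrX normfV normr_nat.
  apply: nondecreasing_cvgn_le; last exact: is_cvg_series_exp_coeff.
  by apply: nondecreasing_series => k _ _; rewrite exp_coeff_ge0.
have cvg : (\int[mu]_x (g x * ((P n).[x] * pg c p x))) @[n --> \oo] -->
    \int[mu]_x (g x * (expR q.[x] * pg c p x)).
  refine (@Rint_dominated _ _ R mu _ _ (fun x => M * expR b * `|pg (c - a) p x|) _ _ _ _).
  - move=> n; apply: measurable_funM => //; apply: measurable_funM.
      by apply: continuous_measurable_fun; exact: continuous_horner.
    by apply: continuous_measurable_fun; exact: continuous_pg.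
  - move=> x; apply: cvgM; first exact: cvg_cst.
    by apply: cvgM (Pe x) _; exact: cvg_cst.
  - by apply: intgZ; exact: (integrable_norm (intg_pg p ca)).
  - move=> n x; rewrite normrM -mulrA ler_pM// /pg !normrM mulrCA [leRHS]mulrCA.
    rewrite ler_wpM2l// !(ger0_norm (expR_ge0 _)).
    apply: (le_trans (ler_wpM2r (expR_ge0 _) (Pb n x))).
    by rewrite -!expRD ler_expR; lra.
move/cvg_lim : cvg => <- //; apply: cvg_lim => //; apply: cvg_near_cst.
apply: nearW => n; rewrite -[RHS](H (P n * p)); apply: eq_Rintegral => x _.
by rewrite /pg hornerM !mulrA.
Qed.

Lemma hermite_moments (g : R -> R) (M : R) : measurable_fun setT g ->
  (forall x, `|g x| <= M) ->
  (forall n, \int[mu]_x (g x * hermite_fun n x) = 0) ->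
  forall p, \int[mu]_x (g x * pg 4^-1 p x) = 0.
Proof.
move=> mg gM H.
have c0 : 0 < 4^-1 :> R by rewrite invr_gt0.
have ig p : intg mu (fun x => g x * pg 4^-1 p x).
  by apply: (@intg_bounded_mul _ _ _ mu _ _ M) => //; exact: intg_pg.
(* The factor [He n] is carried along so that the induction on [p] can replace ['X * He n] by
   [He n.+1] and [He n.-1]. *)
suff S p n : \int[mu]_x (g x * pg 4^-1 (p * He n) x) = 0.
  by move=> p; have := S p 0%N; rewrite /= mulr1.
elim/poly_ind: p n => [|p r IH] n.
  under eq_Rintegral do rewrite mul0r /pg horner0 mul0r mulr0.
  exact: Rint0.
have E x : g x * pg 4^-1 ((p * 'X + r%:P) * He n) x =
  g x * pg 4^-1 (p * He n.+1) x + (n%:R * (g x * pg 4^-1 (p * He n.-1) x) +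
  r / hnorm n * (g x * hermite_fun n x)).
  rewrite hermite_fun_pg mulrDl -mulrA mulX_He mulrDr /pg.
  rewrite !(hornerD, hornerM, hornerC, hornerMn) -mulr_natr.
  by field; exact: hnorm_neq0.
under eq_Rintegral do rewrite E.
have i1 : intg mu (fun x => g x * hermite_fun n x).
  by apply: (@intg_bounded_mul _ _ _ mu _ _ M) => //; exact: intg_hermite_fun.
rewrite RintD//; last by apply: intgD; apply: intgZ.
rewrite RintD//; [|by apply: intgZ..].
by rewrite !RintZ// !IH H !mulr0 !addr0.
Qed.

(* Taking [q = - (c / 2) x^2] replaces the exponent [c] by [3 / 2 * c], and
   iterating makes it as large as desired. *)
Lemma gauss_moments_doubling (g : R -> R) (M : R) : measurable_fun setT g ->
  (forall x, `|g x| <= M) ->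
  (forall p, \int[mu]_x (g x * pg 4^-1 p x) = 0) ->
  forall A : R, exists2 c, A <= c & 0 < c /\ forall p, \int[mu]_x (g x * pg c p x) = 0.
Proof.
move=> mg gM H A.
(* The exponents reached are [(3 / 2)^m / 4]; Bernoulli's linear lower bound suffices. *)
have S m : exists2 c, (4^-1 * (1 + m%:R / 2) <= c) &
    0 < c /\ forall p, \int[mu]_x (g x * pg c p x) = 0.
  elim: m => [|m [c mc [c0 Hc]]].
    by exists 4^-1; [rewrite mul0r addr0 mulr1|split => //; rewrite invr_gt0].
  exists (c + c / 2); first by rewrite -[m.+1%:R]natr1; have := ler0n R m; lra.
  split=> [|p]; first by rewrite addr_gt0// divr_gt0.
  have c2 : c / 2 < c by rewrite ltr_pdivrMr// ltr_pMr// ltr1n.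
  have q x : `|((- (c / 2)) *: 'X^2).[x]| <= c / 2 * x ^+ 2 + 0.
    rewrite hornerZ hornerXn addr0 normrM normrN (ger0_norm (sqr_ge0 _)).
    by rewrite ger0_norm// ltW// divr_gt0.
  have := dominated_exp_moments p c0 mg gM c2 q Hc.
  move=> <-; apply: eq_Rintegral => x _; congr (_ * _).
  rewrite hornerZ hornerXn /pg [RHS]mulrCA -expRD; congr (_ * expR _); ring.
have [c c1 c2] := S (Num.bound (8 * `|A|)); exists c => //; apply: le_trans c1.
have /archi_boundP : 0 <= 8 * `|A| by rewrite mulr_ge0.
by have := ler_norm A; move=> *; lra.
Qed.

(* Taking [q] affine recentres the sharp Gaussian at [y]; as its width tends to
   [0], the vanishing integrals tend to a multiple of [g y]. *)
Theorem hermite_complete1 (g : R -> R) (M : R) : continuous g ->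
  (forall x, `|g x| <= M) ->
  (forall n, \int[mu]_x (g x * hermite_fun n x) = 0) -> forall y, g y = 0.
Proof.
move=> cg gM H y.
have mg : measurable_fun setT g by exact: continuous_measurable_fun.
have D := gauss_moments_doubling mg gM (hermite_moments mg gM H).
have M0 : 0 <= M by exact: le_trans (gM 0).
apply/eqP; rewrite -normr_eq0 eq_le normr_ge0 andbT; apply/ler_addgt0Pl => e e0; rewrite addr0.
have e20 : 0 < e / 2 by rewrite divr_gt0.
have /cvgrPdist_le /(_ _ e20) /nbhs_ballP[dl /= dl0 Hd] := cg y.
(* Such a [c] gives [8 M exp (- c dl^2 / 2) <= e], because [exp z >= z]. *)
have [c Ac [c0 Hc]] := D (2 / dl ^+ 2 * (8 * M / e)).
pose k a x := expR (- (a * (x - y) ^+ 2)).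
have [ik Ik] := integral_gauss y c0.
have c20 : 0 < c / 2 by rewrite divr_gt0.
have [ik2 Ik2] := integral_gauss y c20.
have J0 : 0 < Num.sqrt (pi / c) by rewrite sqrtr_gt0 divr_gt0 ?pi_gt0.
have Z : \int[mu]_x (g x * k c x) = 0.
  have c2 : c / 2 < c by rewrite ltr_pdivrMr// ltr_pMr// ltr1n.
  have q x : `|((2 * c * y) *: 'X - (c * y ^+ 2)%:P).[x]| <=
      c / 2 * x ^+ 2 + 3 * c * y ^+ 2.
    rewrite hornerD hornerN hornerZ hornerX hornerC ler_norml.
    have := sqr_ge0 (x - 2 * y); have := sqr_ge0 (x + 2 * y).
    have := mulr_ge0 (ltW c0) (sqr_ge0 (x + 2 * y)).
    have := mulr_ge0 (ltW c0) (sqr_ge0 (x - 2 * y)).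
    have := mulr_ge0 (ltW c0) (sqr_ge0 y).
    by move=> *; apply/andP; split; nra.
  have := dominated_exp_moments 1 c0 mg gM c2 q Hc.
  move=> <-; apply: eq_Rintegral => x _; congr (_ * _).
  rewrite hornerD hornerN hornerZ hornerX hornerC /pg hornerC mul1r -expRD /k.
  congr expR; ring.
(* Near [y] continuity bounds the difference. Away from [y] half of the exponent is spent on a small
   constant, and the other half keeps the bound integrable. *)
have key x : `|(g y - g x) * k c x| <=
    e / 2 * k c x + 2 * M * expR (- (c / 2 * dl ^+ 2)) * k (c / 2) x.
  rewrite normrM (ger0_norm (expR_ge0 _)).
  have [xd|xd] := ltP `|y - x| dl.
    apply: ler_wpDr; first by rewrite !mulr_ge0 ?expR_ge0.
    by rewrite ler_wpM2r ?expR_ge0//; exact: Hd.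
  apply: ler_wpDl; first by rewrite mulr_ge0 ?expR_ge0// ltW.
  rewrite -[leRHS]mulrA; apply: ler_pM; rewrite ?normr_ge0 ?expR_ge0//.
    by rewrite (le_trans (ler_normB _ _))// mulr_natl mulr2n lerD.
  have xy : (x - y) ^+ 2 = `|y - x| ^+ 2 by rewrite real_normK ?num_real// -sqrrN opprB.
  rewrite /k -expRD ler_expR xy.
  have : dl ^+ 2 <= `|y - x| ^+ 2 by rewrite lerXn2r// nnegrE// ltW.
  nra.
have i1 : intg mu (fun x => (g y - g x) * k c x).
  apply: (@intg_bounded_mul _ _ _ _ _ _ (M + M)) => //.
    by apply: measurable_funB.
  by move=> x; rewrite (le_trans (ler_normB _ _))// lerD.
have := Rint_norm_le i1 _ key.
have -> : \int[mu]_x ((g y - g x) * k c x) = g y * Num.sqrt (pi / c).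
  under eq_Rintegral do rewrite mulrBl.
  rewrite RintB; [|exact: intgZ|exact: (@intg_bounded_mul _ _ _ mu _ _ M)].
  by rewrite Z subr0 RintZ// Ik.
rewrite RintD; [|exact: intgZ..]; rewrite !RintZ// Ik Ik2 => /(_ (intgD (intgZ _ ik) (intgZ _ ik2))).
have -> : Num.sqrt (pi / (c / 2)) = Num.sqrt 2 * Num.sqrt (pi / c).
  by rewrite -sqrtrM//; congr Num.sqrt; field; exact: lt0r_neq0.
set z := expR _.
rewrite normrM (ger0_norm (ltW J0)) !mulrA -mulrDl ler_pM2r// => /le_trans; apply.
have s2 : Num.sqrt 2 <= 2 :> R.
  by rewrite -[leRHS](ger0_norm (ler0n R 2)) -sqrtr_sqr ler_wsqrtr// expr2 -natrM ler_nat.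
have E : z * (8 * M) <= e.
  rewrite /z expRN [leLHS]mulrC ler_pdivrMr ?expR_gt0// [leRHS]mulrC -ler_pdivrMr//.
  apply: le_trans (expR_ge1Dx _); apply: ler_wpDl => //.
  have d20 : 0 < dl ^+ 2 by rewrite exprn_gt0.
  have -> : 8 * M / e = 2^-1 * (2 / dl ^+ 2 * (8 * M / e)) * dl ^+ 2.
    by field; rewrite gt_eqF// gt_eqF.
  by rewrite ler_pM2r// mulrC ler_pM2r ?invr_gt0.
have z0 : 0 <= z by exact: expR_ge0.
have := mulr_ge0 z0 M0; have := sqrtr_ge0 (2 : R); nra.
Qed.

End gauss1d.

(** * Hermite functions in several variables *)

Section tuple_integral.
Context {R : realType}.
Local Notation mu := (@lebesgue_measure R).
Local Notation leb := (@lebesgue_tuple R).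

Definition vec d (t : d.-tuple R) : 'rV[R]_d := \row_i tnth t i.

Lemma cvg_rV d T (F : set_system T) (FF : Filter F) (u : T -> 'rV[R]_d) (x : 'rV[R]_d) :
  (forall i, u n 0 i @[n --> F] --> x 0 i) -> u n @[n --> F] --> x.
Proof.
move=> H; apply/cvg_ballP => e e0; near=> n; split=> // i j; rewrite ord1.
move: j; near: n; apply: filter_forall => j.
by have /cvg_ballP := H j; apply.
Unshelve. all: by end_near. Qed.

(** Rounding to a lattice of step [1 / (n + 1)] bridges the topology of row vectors and the
    sigma-algebra of tuples: only countably many values are taken, so any function of the rounded
    point is measurable, and continuity lets the step tend to zero. *)
Definition grid d n (t : d.-tuple R) : 'rV[R]_d :=
  \row_i ((Num.floor (n.+1%:R * tnth t i))%:~R / n.+1%:R).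

Lemma cvg_grid d (t : d.-tuple R) : grid n t @[n --> \oo] --> vec t.
Proof.
apply: cvg_rV => i; rewrite mxE; under eq_fun do rewrite mxE.
apply: (@squeeze_cvgr _ _ _ _ (fun n => tnth t i - harmonic n) (cst (tnth t i))).
- apply: nearW => n; have n0 : 0 < n.+1%:R :> R by [].
  have /andP[h1 h2] := floor_itv (n.+1%:R * tnth t i).
  apply/andP; split; last by rewrite /= ler_pdivrMr// (mulrC (tnth t i)).
  rewrite /= ler_pdivlMr// mulrBl mulVf ?gt_eqF// lerBlDr (mulrC (tnth t i)) ltW//.
  by move: h2; rewrite intrD.
- rewrite -[X in _ --> X]subr0; apply: cvgB; [exact: cvg_cst|exact: cvg_harmonic].
- exact: cvg_cst.
Qed.

Lemma measurable_grid d n (phi : 'rV[R]_d -> R) :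
  measurable_fun [set: d.-tuple (measurableTypeR R)] (fun t => phi (grid n t)).
Proof.
move=> _ Y mY; rewrite setTI.
pose k (t : d.-tuple R) := [ffun i => Num.floor (n.+1%:R * tnth t i)].
pose g (z : {ffun 'I_d -> int}) : 'rV[R]_d := \row_i ((z i)%:~R / n.+1%:R).
have gk t : grid n t = g (k t) by apply/rowP => i; rewrite !mxE ffunE.
have -> : (fun t => phi (grid n t)) @^-1` Y =
    \bigcup_(z : {ffun 'I_d -> int}) (if phi (g z) \in Y then k @^-1` [set z] else set0).
  apply/seteqP; split=> t /=.
    by move=> Yt; exists (k t) => //; rewrite -gk mem_set.
  by move=> [z _]; case: ifP => // /set_mem Yz /= kz; rewrite gk kz.
apply: countable_bigcupT_measurable; first exact: countableP.
move=> z; case: ifP => _ //.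
have -> : k @^-1` [set z] = \bigcap_(i in [set: 'I_d])
    ((fun t : d.-tuple R => tnth t i) @^-1`
      [set x | Num.floor (n.+1%:R * x) = z i]).
  apply/seteqP; split=> t /=; first by move=> <- i _ /=; rewrite ffunE.
  by move=> H; apply/ffunP => i; rewrite ffunE; exact: H.
apply: fin_bigcap_measurable => // i _; rewrite -[X in measurable X]setTI.
apply: measurable_tnth => //.
have -> : [set x : R | Num.floor (n.+1%:R * x) = z i] =
    [set` `[((z i)%:~R / n.+1%:R), ((z i + 1)%:~R / n.+1%:R)[].
  apply/seteqP; split=> x /=; rewrite in_itv /= ler_pdivrMr// ltr_pdivlMr// (mulrC x).
    by move=> <-; exact: floor_itv.
  exact: floor_def.
exact: measurable_itv.
Qed.

Lemma measurable_vec d (phi : 'rV[R]_d -> R) : continuous phi ->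
  measurable_fun [set: d.-tuple (measurableTypeR R)] (fun t => phi (vec t)).
Proof.
move=> cphi.
have H (t : d.-tuple R) : phi (grid n t) @[n --> \oo] --> phi (vec t).
  by move=> A /(cphi (vec t)); exact: cvg_grid.
apply: (@measurable_fun_cvg _ _ _ _ (fun n t => phi (grid n t))).
- by move=> n; exact: measurable_grid.
- by move=> t _; exact: H.
Qed.

Definition vcons d (x : R) (v : 'rV[R]_d) : 'rV[R]_d.+1 :=
  \row_i oapp (fun j => v 0 j) x (unlift ord0 i).

Lemma vcons0 d x (v : 'rV[R]_d) : vcons x v 0 ord0 = x.
Proof. by rewrite mxE unlift_none. Qed.

Lemma vconsS d x (v : 'rV[R]_d) i : vcons x v 0 (lift ord0 i) = v 0 i.
Proof. by rewrite mxE liftK. Qed.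

Lemma vec_cons d (p : R * d.-tuple R) :
  vec (tuple_cons (T := measurableTypeR R) p) = vcons p.1 (vec p.2).
Proof.
apply/rowP => i; rewrite [LHS]mxE.
case: (unliftP ord0 i) => [j ->|->]; last by rewrite vcons0.
by rewrite vconsS mxE /tuple_cons tnthS.
Qed.

Lemma integral_tuple_cons d (f : d.+1.-tuple (measurableTypeR R) -> R) :
  measurable_fun setT f ->
  intg (mu \x leb d)%E (fun p => f (tuple_cons p)) ->
  intg (leb d.+1) f /\
  \int[leb d.+1]_t f t = \int[(mu \x leb d)%E]_p f (tuple_cons p).
Proof.
move=> mf fi.
have mc : measurable_fun setT (@tuple_cons _ (measurableTypeR R) d).
  exact: measurable_cons.
split.
  by apply: (@integrable_pushforward _ _ _ _ R _ mc (mu \x leb d)%E setT (EFin \o f)) => //; exact/measurable_EFinP.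
congr fine.
by apply: (@integral_pushforward _ _ _ _ R _ mc (mu \x leb d)%E setT (EFin \o f)) => //; exact/measurable_EFinP.
Qed.

Lemma Rintegral_fubini d1 d2 (T1 : measurableType d1) (T2 : measurableType d2)
    (m1 : {sigma_finite_measure set T1 -> \bar R})
    (m2 : {sigma_finite_measure set T2 -> \bar R}) (f : T1 * T2 -> R) :
  intg (m1 \x m2)%E f -> (forall x, intg m2 (fun y => f (x, y))) ->
  \int[(m1 \x m2)%E]_p f p = \int[m1]_x \int[m2]_y f (x, y).
Proof.
move=> fi fx; congr fine; rewrite -(integral12_prod_meas1 fi).
apply: eq_integral => x _; rewrite /Rintegral fineK//.
exact: integrable_fin_num (fx x).
Qed.

Lemma intg_prod d1 d2 (T1 : measurableType d1) (T2 : measurableType d2)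
    (m1 : {sigma_finite_measure set T1 -> \bar R})
    (m2 : {sigma_finite_measure set T2 -> \bar R}) (f : T1 -> R) (g : T2 -> R) :
  intg m1 f -> intg m2 g -> intg (m1 \x m2)%E (fun p => f p.1 * g p.2).
Proof.
move=> fi gi; have mf := intg_measurable fi; have mg := intg_measurable gi.
have mfg : measurable_fun setT (EFin \o (fun p : T1 * T2 => f p.1 * g p.2)).
  apply/measurable_EFinP; apply: measurable_funM.
    by apply: (measurableT_comp mf); exact: measurable_fst.
  by apply: (measurableT_comp mg); exact: measurable_snd.
apply/(integrable12ltyP _ _ mfg).
have Eg x : (\int[m2]_y `|(EFin \o (fun p : T1 * T2 => f p.1 * g p.2)%R) (x, y)|
    = (`|f x| * \int[m2]_y `|g y|)%R%:E)%E.
  rewrite EFinM /Rintegral fineK; last first.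
    by apply: integrable_fin_num => //; exact: (integrable_norm gi).
  rewrite -integralZl//; last exact: (integrable_norm gi).
  by apply: eq_integral => y _; rewrite /= normrM EFinM.
under eq_integral do rewrite Eg mulrC EFinM.
rewrite integralZl//; last exact: (integrable_norm fi).
rewrite lte_mul_pinfty//.
- by rewrite lee_fin Rintegral_ge0.
- by have /integrableP[_] := fi.
Qed.

Lemma continuous_prod (T : topologicalType) I (s : seq I) (F : I -> T -> R) :
  (forall i, continuous (F i)) -> continuous (fun x => \prod_(i <- s) F i x).
Proof.
move=> cF x; elim: s => [|i s IH].
  rewrite /continuous_at big_nil; under eq_fun do rewrite big_nil.
  exact: cvg_cst.
rewrite /continuous_at big_cons; under eq_fun do rewrite big_cons.
by apply: cvgM IH; exact: cF.
Qed.

Lemma continuous_hermite_mfun d (b : multi_index d) : continuous (@hermite_mfun R d b).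
Proof.
apply: continuous_prod => j x.
apply: (@continuous_comp _ _ _ (fun y : 'rV[R]_d => y 0 j)); first exact: coord_continuous.
exact: continuous_hermite_fun.
Qed.

Definition mfun_bound d (b : multi_index d) : R := \prod_(j < d) (b j).+2%:R.

Lemma hermite_mfun_le d (b : multi_index d) x : `|hermite_mfun b x| <= mfun_bound b.
Proof.
rewrite normr_prod; apply: ler_prod => j _.
by rewrite normr_ge0 hermite_fun_le.
Qed.

Definition btail d (b : multi_index d.+1) : multi_index d := [ffun j => b (lift ord0 j)].

Definition bcons d n (b : multi_index d) : multi_index d.+1 :=
  [ffun i => oapp b n (unlift ord0 i)].

Lemma bcons0 d n (b : multi_index d) : bcons n b ord0 = n.
Proof. by rewrite ffunE unlift_none. Qed.

Lemma btail_cons d n (b : multi_index d) : btail (bcons n b) = b.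
Proof. by apply/ffunP => j; rewrite !ffunE liftK. Qed.

Lemma multi_index_eqS d (a b : multi_index d.+1) :
  (a == b) = (a ord0 == b ord0) && (btail a == btail b).
Proof.
apply/eqP/andP => [->|[/eqP h0 /eqP/ffunP hS]]; first by rewrite !eqxx.
apply/ffunP => i; case: (unliftP ord0 i) => [j ->|->] //.
by have := hS j; rewrite !ffunE.
Qed.

Lemma hermite_mfun_vcons d (b : multi_index d.+1) x (v : 'rV[R]_d) :
  hermite_mfun b (vcons x v) = hermite_fun (b ord0) x * hermite_mfun (btail b) v.
Proof.
rewrite /hermite_mfun big_ord_recl vcons0; congr (_ * _).
by apply: eq_bigr => j _; rewrite vconsS ffunE.
Qed.

Lemma measurable_hermite_mfun d (b : multi_index d) :
  measurable_fun [set: d.-tuple (measurableTypeR R)] (fun t => hermite_mfun b (vec t)).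
Proof. by apply: measurable_vec; exact: continuous_hermite_mfun. Qed.

Lemma intg_hermite_mfun d (b : multi_index d) :
  intg (leb d) (fun t => hermite_mfun b (vec t)).
Proof.
elim: d b => [|d IH] b.
  have -> : (fun t => hermite_mfun b (vec t)) = cst (1 : R).
    by apply/funext => t; rewrite /hermite_mfun big_ord0.
  apply/integrableP; split.
    by apply/measurable_EFinP; exact: measurable_cst.
  by rewrite integral_dirac//= normr1 diracT mul1e ltry.
apply: (integral_tuple_cons _ _).1; first exact: measurable_hermite_mfun.
have := intg_prod (intg_hermite_fun (b ord0)) (IH (btail b)).
apply: eq_integrable => // p _.
by rewrite /= vec_cons hermite_mfun_vcons.
Qed.

Lemma intg_mul_hermite d (b : multi_index d) (phi : 'rV[R]_d -> R) (M : R) :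
  continuous phi -> (forall x, `|phi x| <= M) ->
  intg (leb d) (fun t => phi (vec t) * hermite_mfun b (vec t)).
Proof.
move=> cphi phiM; apply: (@intg_bounded_mul _ _ _ _ _ _ M) => //.
- exact: measurable_vec.
- exact: intg_hermite_mfun.
Qed.

Lemma continuous_vcons d x : continuous (@vcons d x).
Proof.
move=> v; apply: (@cvg_rV _ _ (nbhs v) _ (vcons x)) => i.
case: (unliftP ord0 i) => [j ->|->].
  by rewrite vconsS; under eq_fun do rewrite vconsS; exact: coord_continuous.
by rewrite vcons0; under eq_fun do rewrite vcons0; exact: cvg_cst.
Qed.

(** Fubini: a coefficient is a one-dimensional coefficient of the coefficients of the slices.
    Completeness and orthonormality are proved by induction on [d] along this formula. *)
Lemma hermite_coef_cons d (phi : 'rV[R]_d.+1 -> R) (M : R) (b : multi_index d.+1) :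
  continuous phi -> (forall x, `|phi x| <= M) ->
  hermite_coef phi b = \int[mu]_x (hermite_coef (fun v => phi (vcons x v)) (btail b) *
                                    hermite_fun (b ord0) x).
Proof.
move=> cphi phiM.
have cphix x : continuous (fun v => phi (vcons x v)).
  by move=> v; apply: continuous_comp; [exact: continuous_vcons|exact: cphi].
have i1 x := intg_mul_hermite (btail b) (cphix x) (fun v => phiM (vcons x v)).
have cF : continuous (fun x => phi x * hermite_mfun b x).
  by move=> x; exact: (cvgM (cphi x) (@continuous_hermite_mfun _ b x)).
have mF := measurable_vec cF.
have iF : intg (mu \x leb d)%E (fun p => phi (vec (tuple_cons p)) *
    hermite_mfun b (vec (tuple_cons (T := measurableTypeR R) p))).
  have H := intg_prod (intg_hermite_fun (b ord0)) (intg_hermite_mfun (btail b)).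
  apply: (intg_le _ _ (intgZ M (integrable_norm H))).
    apply: (measurableT_comp mF); exact: measurable_cons.
  move=> p; rewrite normrM ler_pM//= vec_cons hermite_mfun_vcons//.
rewrite /hermite_coef /integral_rV.
have [_ ->] := integral_tuple_cons mF iF.
rewrite Rintegral_fubini//; last first.
  move=> x; have := intgZ (hermite_fun (b ord0) x) (i1 x).
  by apply: eq_integrable => // t _ /=; rewrite vec_cons hermite_mfun_vcons mulrCA.
apply: eq_Rintegral => x _; rewrite mulrC -RintZ//.
by apply: eq_Rintegral => t _ /=; rewrite vec_cons hermite_mfun_vcons mulrCA.
Qed.

Lemma hermite_coef_bound d (b : multi_index d) : exists2 C : R, 0 <= C &
  forall phi (M : R), continuous phi -> (forall x, `|phi x| <= M) ->
    `|hermite_coef phi b| <= C * M.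
Proof.
have iN := integrable_norm (intg_hermite_mfun b).
exists (\int[leb d]_t `|hermite_mfun b (vec t)|); first exact: Rintegral_ge0.
move=> phi M cphi phiM; rewrite mulrC -RintZ//.
apply: Rint_norm_le; [exact: (intg_mul_hermite b cphi phiM)|exact: intgZ|].
by move=> t; rewrite normrM ler_wpM2r.
Qed.

Lemma hermite_coef_dominated d (b : multi_index d) (u : nat -> 'rV[R]_d -> R) phi (M : R) :
  (forall n, continuous (u n)) -> (forall n x, `|u n x| <= M) ->
  (forall x, u n x @[n --> \oo] --> phi x) ->
  hermite_coef (u n) b @[n --> \oo] --> hermite_coef phi b.
Proof.
move=> cu uM uphi.
refine (@Rint_dominated _ _ R (leb d) _ _ (fun t => M * `|hermite_mfun b (vec t)|) _ _ _ _).
- move=> n; apply: measurable_funM; first exact: measurable_vec.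
  exact: measurable_hermite_mfun.
- by move=> t; apply: cvgM; [exact: uphi|exact: cvg_cst].
- by apply: intgZ; exact: (integrable_norm (intg_hermite_mfun b)).
- by move=> n t; rewrite normrM ler_wpM2r.
Qed.

Lemma hermite_coef0 (phi : 'rV[R]_0 -> R) (b : multi_index 0) : continuous phi ->
  hermite_coef phi b = phi 0.
Proof.
move=> cphi; rewrite /hermite_coef /integral_rV /Rintegral integral_dirac//=.
  by rewrite indicE mem_set// mul1r /hermite_mfun big_ord0 mulr1; congr phi; apply/rowP => -[].
apply/measurable_EFinP; apply: (measurable_vec (phi := fun x => phi x * hermite_mfun b x)).
by move=> x; exact: (cvgM (cphi x) (@continuous_hermite_mfun _ b x)).
Qed.

(** For each index in the last variables, the coefficient of the slice is a bounded continuous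
    function of the first variable, all of whose one-dimensional coefficients vanish. It is
    therefore zero, and the induction hypothesis applies to every slice. *)
Theorem hermite_complete d (phi : 'rV[R]_d -> R) (M : R) : continuous phi ->
  (forall x, `|phi x| <= M) -> (forall b, hermite_coef phi b = 0) -> forall x, phi x = 0.
Proof.
elim: d phi => [|d IH] phi cphi phiM H x.
  have := H [ffun => 0%N]; rewrite hermite_coef0// => <-.
  by congr phi; apply/rowP => -[].
have cphix y : continuous (fun v => phi (vcons y v)).
  by move=> v; apply: continuous_comp; [exact: continuous_vcons|exact: cphi].
have -> : x = vcons (x 0 ord0) (\row_j x 0 (lift ord0 j)).
  apply/rowP => i; case: (unliftP ord0 i) => [j ->|->]; last by rewrite vcons0.
  by rewrite vconsS mxE.
apply: (IH (fun v => phi (vcons (x 0 ord0) v))) => // b.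
have [C C0 HC] := hermite_coef_bound b.
apply: (@hermite_complete1 _ (fun y => hermite_coef (fun v => phi (vcons y v)) b) (C * M)).
- move=> y; apply/(@cvg_nbhsP _ R^o) => w wy.
  apply: (hermite_coef_dominated (M := M)) => // v.
  apply: (cvg_comp (fun n => vcons (w n) v) phi); last exact: cphi.
  apply: cvg_rV => i; case: (unliftP ord0 i) => [j ->|->].
    by rewrite vconsS; under eq_fun do rewrite vconsS; exact: cvg_cst.
  by rewrite vcons0; under eq_fun do rewrite vcons0.
- by move=> y; exact: HC.
- move=> n; rewrite -[RHS](H (bcons n b)) (hermite_coef_cons _ cphi phiM).
  by rewrite btail_cons bcons0.
Qed.

Lemma hermite_mfun_orthonormal d (a b : multi_index d) :
  hermite_coef (hermite_mfun a) b = (a == b)%:R :> R.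
Proof.
elim: d a b => [|d IH] a b.
  rewrite hermite_coef0; last exact: continuous_hermite_mfun.
  rewrite /hermite_mfun big_ord0 (_ : a = b) ?eqxx//.
  by apply/ffunP => -[].
rewrite (hermite_coef_cons _ (@continuous_hermite_mfun _ a) (hermite_mfun_le a)).
have E x : hermite_coef (fun v => hermite_mfun a (vcons x v)) (btail b) =
    (btail a == btail b)%:R * hermite_fun (a ord0) x.
  rewrite -IH mulrC -RintZ; last first.
    exact: (intg_mul_hermite _ (@continuous_hermite_mfun _ _) (hermite_mfun_le _)).
  by apply: eq_Rintegral => t _; rewrite hermite_mfun_vcons mulrA.
under eq_Rintegral do rewrite E -mulrA.
rewrite RintZ; last exact: intg_hermite_fun2.
by rewrite hermite_fun_orthonormal multi_index_eqS -natrM mulnb andbC.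
Qed.

End tuple_integral.

(** * Sums over multi-indices *)

Section box_sums.
Context {R : realType} (d : nat).
Implicit Types (a b : multi_index d) (F G : multi_index d -> R) (K : nat) (i : 'I_d).
Local Notation lam := (@hermite_weight R d).

(** The cubes [[0, K)^d] exhaust the multi-indices. They serve both as partial sums and as Galerkin
    truncations. *)
Definition box K : seq (multi_index d) :=
  [seq [ffun j => val (g j)] | g : {ffun 'I_d -> 'I_K}].

Lemma mem_box K b : (b \in box K) = [forall j, (b j < K)%N].
Proof.
apply/mapP/forallP => [[g _ ->] j|H]; first by rewrite ffunE; exact: ltn_ord.
exists [ffun j => Ordinal (H j)]; first by rewrite mem_enum.
by apply/ffunP => j; rewrite !ffunE.
Qed.

Lemma box_uniq K : uniq (box K).
Proof.
rewrite map_inj_uniq ?enum_uniq// => g h /ffunP gh.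
by apply/ffunP => j; apply/val_inj; have := gh j; rewrite !ffunE.
Qed.

Lemma box_sub K K' : (K <= K')%N -> {subset box K <= box K'}.
Proof.
move=> KK b; rewrite !mem_box => /forallP H; apply/forallP => j.
exact: leq_trans (H j) KK.
Qed.

Lemma box_near b : \forall K \near \oo, b \in box K.
Proof.
exists (\sum_j b j).+1 => // K /= bK; rewrite mem_box; apply/forallP => j.
by apply: leq_trans bK; rewrite ltnS (bigD1 j)//= leq_addr.
Qed.

Lemma sum_box_sub K K' F : (K <= K')%N ->
  \sum_(b <- box K) F b = \sum_(b <- box K' | b \in box K) F b.
Proof.
move=> KK; rewrite -[RHS]big_filter; apply: perm_big; apply: uniq_perm.
- exact: box_uniq.
- by rewrite filter_uniq// box_uniq.
- move=> b; rewrite mem_filter; case bK: (b \in box K) => //=.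
  by rewrite (box_sub KK bK).
Qed.

Lemma le_sum_box K K' F : (forall b, 0 <= F b) -> (K <= K')%N ->
  \sum_(b <- box K) F b <= \sum_(b <- box K') F b.
Proof.
by move=> F0 KK; rewrite (sum_box_sub F KK) big_mkcond; apply: ler_sum => b _; case: ifP.
Qed.

Definition incr i b : multi_index d := [ffun j => if j == i then (b j).+1 else b j].
(** Where [b i = 0] the index is left unchanged; wherever this would matter, the term carries the
    factor [Num.sqrt 0] or an indicator of [0 < b i]. *)
Definition decr i b : multi_index d := [ffun j => if j == i then (b j).-1 else b j].

Lemma incrE i b : incr i b i = (b i).+1. Proof. by rewrite ffunE eqxx. Qed.
Lemma decrE i b : decr i b i = (b i).-1. Proof. by rewrite ffunE eqxx. Qed.

Lemma incrK i : cancel (incr i) (decr i).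
Proof. by move=> b; apply/ffunP => j; rewrite !ffunE; case: eqP. Qed.

Lemma decrK i b : (0 < b i)%N -> incr i (decr i b) = b.
Proof.
move=> b0; apply/ffunP => j; rewrite !ffunE; case: eqP => // ->.
by rewrite prednK.
Qed.

Lemma incr_in_box i K b : (incr i b \in box K) = (b \in box K) && ((b i).+1 < K)%N.
Proof.
rewrite !mem_box; apply/forallP/andP => [H|[/forallP H bK] j].
  split; last by have := H i; rewrite incrE.
  apply/forallP => j; have := H j; rewrite ffunE; case: eqP => // _.
  exact: ltnW.
by rewrite ffunE; case: eqP => [->|].
Qed.

Lemma sum_box_incr i K F :
  \sum_(b <- box K | (0 < b i)%N) F b =
  \sum_(b <- box K | incr i b \in box K) F (incr i b).
Proof.
rewrite -big_filter -[RHS]big_filter -(big_map (incr i) xpredT).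
apply: perm_big; apply: uniq_perm.
- by rewrite filter_uniq// box_uniq.
- rewrite (map_inj_uniq (can_inj (@incrK i))) filter_uniq//.
  exact: box_uniq.
- move=> b; rewrite mem_filter; apply/andP/mapP => [[b0 bK]|[c]].
    exists (decr i b); last by rewrite decrK.
    rewrite mem_filter decrK// bK /=; move: bK.
    by rewrite -{1}(decrK b0) incr_in_box => /andP[].
  by rewrite mem_filter => /andP[cK _] ->; rewrite incrE.
Qed.

Lemma weight_incr i b : lam (incr i b) = lam b + 2.
Proof.
rewrite /hermite_weight -natrD; congr _%:R.
suff -> : (\sum_j incr i b j = (\sum_j b j).+1)%N by rewrite mulnS; lia.
rewrite (bigD1 i)//= incrE (bigD1 i (P := xpredT))//= -addSn; congr (_ + _)%N.
by apply: eq_bigr => j /negbTE ji; rewrite ffunE ji.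
Qed.

Lemma weight_ge_coord i b : (b i).+1%:R <= lam b.
Proof.
rewrite ler_nat (bigD1 i)//=; have := ltn_ord i; lia.
Qed.

Lemma weight_ge0 b : 0 <= lam b. Proof. exact: ler0n. Qed.

Hypothesis d_gt0 : (0 < d)%N.

Lemma weight_ge1 b : 1 <= lam b.
Proof. by apply: le_trans (weight_ge_coord (Ordinal d_gt0) b); rewrite ler1n. Qed.

Lemma weight_gt0 b : 0 < lam b.
Proof. exact: lt_le_trans (weight_ge1 b). Qed.

Lemma notin_box_weight K b : b \notin box K -> K.+1%:R <= lam b.
Proof.
rewrite mem_box => /forallPn[j]; rewrite -leqNgt => Kj.
by apply: le_trans (weight_ge_coord j b); rewrite ler_nat.
Qed.

Lemma weight_le_decr i b : lam b <= 3 * lam (decr i b).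
Proof.
have [b0|b0] := posnP (b i).
  have -> : decr i b = b.
    by apply/ffunP => j; rewrite ffunE; case: eqP => // ->; rewrite b0.
  by have := weight_ge1 b; lra.
rewrite -{1}(decrK b0) weight_incr; have := weight_ge1 (decr i b); lra.
Qed.

Lemma sum_inv_sqr K : \sum_(k < K) (k.+1%:R ^+ 2)^-1 <= 2 :> R.
Proof.
case: K => [|K]; first by rewrite big_ord0.
(* A telescoping majorant: an inverse square is at most the difference of two consecutive
   inverses. *)
suff : \sum_(k < K.+1) (k.+1%:R ^+ 2)^-1 <= 2 - K.+1%:R^-1 :> R.
  by move=> /le_trans; apply; rewrite gerBl invr_ge0.
elim: K => [|K IH]; first by rewrite big_ord_recr big_ord0 /= expr1n invr1; lra.
rewrite big_ord_recr /=; apply: (le_trans (lerD IH (lexx _))).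
rewrite -exprVn; set u := K.+1%:R^-1; set v := K.+2%:R^-1.
have uv : u - v = u * v.
  rewrite /u /v -[K.+2%:R]natr1 -[K.+1%:R]natr1; move: (K%:R : R) (ler0n R K) => k k0.
  by field; apply/andP; split; apply: lt0r_neq0; lra.
have vu : v <= u by rewrite lef_pV2 ?posrE// ler_nat.
have v0 : 0 <= v by rewrite invr_ge0.
nra.
Qed.

(** The weight dominates each [b j + 1], so the sum is at most a product of [d] one-dimensional sums
    of inverse squares. Hence the exponent [2 * d] and the factor [2 ^+ d] that recur in the
    sequel. *)
Lemma sum_box_weight K : \sum_(b <- box K) (lam b ^+ (2 * d))^-1 <= 2 ^+ d :> R.
Proof.
apply: (@le_trans _ _ (\prod_(j < d) \sum_(k < K) (k.+1%:R ^+ 2)^-1)); last first.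
  rewrite -[in leRHS](card_ord d) -prodr_const; apply: ler_prod => j _.
  by rewrite sumr_ge0 ?sum_inv_sqr// => k _; rewrite invr_ge0 exprn_ge0.
rewrite bigA_distr_bigA /= /box big_map big_enum /=; apply: ler_sum => g _.
rewrite prodfV lef_pV2 ?posrE ?exprn_gt0 ?weight_gt0//; last first.
  by apply: prodr_gt0 => j _; rewrite exprn_gt0.
set L := lam _; rewrite mulnC exprM -[X in _ <= _ ^+ X ^+ _](card_ord d).
rewrite -prodr_const -prodrXl.
apply: ler_prod => j _; rewrite exprn_ge0//= lerXn2r// ?nnegrE ?weight_ge0//.
by have := weight_ge_coord j [ffun j => val (g j)]; rewrite ffunE.
Qed.

Definition csum F : R := limn (fun K => \sum_(b <- box K) F b).

(** With [k = 0] the sum over all multi-indices converges absolutely; the extra power given by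
    [k = 1] makes its tails outside [box K] of order [1 / (K + 1)]. *)
Definition summable_by k (M : R) F := forall b, `|F b| <= M * (lam b ^+ (2 * d + k))^-1.

Lemma summable_by_ge0 k M F : summable_by k M F -> 0 <= M.
Proof.
move=> /(_ [ffun=> 0%N]) H; have := le_trans (normr_ge0 _) H.
by rewrite pmulr_lge0// invr_gt0 exprn_gt0// weight_gt0.
Qed.

Lemma summable_byW k M F : summable_by k M F -> summable_by 0 M F.
Proof.
move=> H b; have M0 := summable_by_ge0 H; apply: (le_trans (H b)).
rewrite ler_wpM2l// lef_pV2 ?posrE ?exprn_gt0 ?weight_gt0//.
by apply: ler_weXn2l; [exact: weight_ge1|rewrite leq_add2l].
Qed.

Lemma summable_byD k M N F G : summable_by k M F -> summable_by k N G ->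
  summable_by k (M + N) (fun b => F b + G b).
Proof. by move=> HF HG b; rewrite mulrDl (le_trans (ler_normD _ _))// lerD. Qed.

Lemma summable_byZ k M r F : summable_by k M F ->
  summable_by k (`|r| * M) (fun b => r * F b).
Proof. by move=> HF b; rewrite normrM -mulrA ler_wpM2l. Qed.

Lemma summable_byB k M N F G : summable_by k M F -> summable_by k N G ->
  summable_by k (M + N) (fun b => F b - G b).
Proof. by move=> HF HG b; rewrite mulrDl (le_trans (ler_normB _ _))// lerD. Qed.

Lemma sum_box_summable M F K (P : pred (multi_index d)) : summable_by 0 M F ->
  `|\sum_(b <- box K | P b) F b| <= M * 2 ^+ d.
Proof.
move=> H; have M0 := summable_by_ge0 H.
apply: (le_trans (ler_norm_sum _ _ _)).
apply: (@le_trans _ _ (M * \sum_(b <- box K) (lam b ^+ (2 * d))^-1)).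
  rewrite mulr_sumr big_mkcond; apply: ler_sum => b _.
  have := H b; rewrite addn0; case: ifP => // _ /(le_trans _); apply.
  exact: normr_ge0.
by rewrite ler_wpM2l// sum_box_weight.
Qed.

Lemma csum_cvg M F : summable_by 0 M F ->
  \sum_(b <- box K) F b @[K --> \oo] --> csum F.
Proof.
(* A signed family is the difference of the nonnegative families [F + |F|] and [|F|]. *)
suff pos G N : (forall b, 0 <= G b) -> summable_by 0 N G ->
    cvgn (fun K => \sum_(b <- box K) G b).
  move=> H; have HN : summable_by 0 M (fun b => `|F b|).
    by move=> b; rewrite normr_id; exact: H.
  have E : (fun K => \sum_(b <- box K) F b) = (fun K => \sum_(b <- box K) (F b + `|F b|))
      \- (fun K => \sum_(b <- box K) `|F b|).
    by apply/funext => K /=; rewrite big_split /= addrK.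
  rewrite /csum E; apply: is_cvgB; [apply: pos (summable_byD H HN)|apply: pos HN] => b //.
  by rewrite -lerBlDl sub0r -normrN ler_norm.
move=> G0 H; apply: nondecreasing_is_cvgn.
  by move=> K K' KK; exact: le_sum_box.
exists (N * 2 ^+ d) => _ [K _ <-].
exact: le_trans (ler_norm _) (sum_box_summable _ _ H).
Qed.

Lemma csum_le M F : summable_by 0 M F -> `|csum F| <= M * 2 ^+ d.
Proof.
move=> H; apply: (cvgr_to_le (cvg_norm (csum_cvg H))).
by apply: nearW => K; exact: sum_box_summable.
Qed.

Lemma csumD M N F G : summable_by 0 M F -> summable_by 0 N G ->
  csum (fun b => F b + G b) = csum F + csum G.
Proof.
move=> HF HG; apply/cvg_lim => //.
under eq_fun do rewrite big_split.
by apply: cvgD; apply: csum_cvg; eassumption.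
Qed.

Lemma csumZ M r F : summable_by 0 M F -> csum (fun b => r * F b) = r * csum F.
Proof.
move=> HF; apply/cvg_lim => //.
under eq_fun do rewrite -mulr_sumr.
by apply: cvgM; [exact: cvg_cst|apply: csum_cvg; eassumption].
Qed.

Lemma csumB M N F G : summable_by 0 M F -> summable_by 0 N G ->
  csum (fun b => F b - G b) = csum F - csum G.
Proof.
move=> HF HG; rewrite -mulN1r -(csumZ _ HG) -(csumD HF (summable_byZ (-1) HG)).
by congr csum; apply/funext => b; rewrite mulN1r.
Qed.

Lemma csum_single b F : (forall c, c != b -> F c = 0) -> csum F = F b.
Proof.
move=> H; apply/cvg_lim => //; apply: cvg_near_cst.
apply: filterS (box_near b) => K bK.
rewrite (bigD1_seq b)//= ?box_uniq// big1 ?addr0//.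
Qed.

Lemma sum_box_outer M F K (P : pred (multi_index d)) : summable_by 1 M F ->
  (forall b, P b -> K.+1%:R <= lam b) -> forall K',
  `|\sum_(b <- box K' | P b) F b| <= M * 2 ^+ d / K.+1%:R.
Proof.
move=> H PK K'; have M0 := summable_by_ge0 H.
have G : summable_by 0 (M / K.+1%:R) (fun b => if P b then F b else 0).
  move=> b; case: ifP => Pb; last first.
    by rewrite normr0 mulr_ge0 ?divr_ge0 ?invr_ge0 ?exprn_ge0 ?weight_ge0.
  apply: (le_trans (H b)); rewrite addn0 addn1 exprSr invfM mulrA [leRHS]mulrAC.
  rewrite ler_wpM2l ?mulr_ge0 ?invr_ge0 ?exprn_ge0 ?weight_ge0//.
  by rewrite lef_pV2 ?posrE ?weight_gt0//; exact: PK.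
have := sum_box_summable K' xpredT G; rewrite -big_mkcond.
by rewrite mulrAC.
Qed.

Lemma csum_tail M F K : summable_by 1 M F ->
  `|csum F - \sum_(b <- box K) F b| <= M * 2 ^+ d / K.+1%:R.
Proof.
move=> H; have C : `|\sum_(b <- box K') F b - \sum_(b <- box K) F b| @[K' --> \oo] -->
    `|csum F - \sum_(b <- box K) F b|.
  by apply: cvg_norm; apply: cvgB; [exact: csum_cvg (summable_byW H)|exact: cvg_cst].
apply: (cvgr_to_le C); exists K => // K' /= KK.
rewrite (sum_box_sub F KK) (bigID (fun b => b \in box K)) /= addrC addrK.
by apply: (sum_box_outer H) => b; exact: notin_box_weight.
Qed.

(** Shifting the index does not preserve the boxes; the terms that leave [box K] have weight at
    least [K + 1], and the extra power of the weight sends their sum to zero. *)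
Lemma csum_incr i M F : summable_by 1 M F -> (forall b, b i = 0%N -> F b = 0) ->
  csum F = csum (fun b => F (incr i b)).
Proof.
move=> H F0; have M0 := summable_by_ge0 H.
have le_lam b k : (lam (incr i b) ^+ k)^-1 <= (lam b ^+ k)^-1.
  rewrite lef_pV2 ?posrE ?exprn_gt0 ?weight_gt0// lerXn2r// ?nnegrE ?weight_ge0//.
  by rewrite weight_incr lerDl.
have HI : summable_by 1 M (fun b => F (incr i b)).
  by move=> b; apply: (le_trans (H _)); rewrite ler_wpM2l.
apply/cvg_lim => //.
rewrite -[csum _]subr0.
have E K : \sum_(b <- box K) F b = \sum_(b <- box K) F (incr i b) -
    \sum_(b <- box K | incr i b \notin box K) F (incr i b).
  rewrite [X in X - _](bigID (fun b => incr i b \in box K)) /= addrK -sum_box_incr.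
  rewrite (bigID (fun b => (0 < b i)%N)) /= [X in _ + X]big1 ?addr0// => b.
  by rewrite -eqn0Ngt => /eqP; exact: F0.
under eq_fun do rewrite E.
apply: cvgB; first exact: csum_cvg (summable_byW HI).
apply/norm_cvg0P.
apply: (@squeeze_cvgr _ _ _ _ (cst 0) (fun K => M * 2 ^+ d * harmonic K)).
- apply: nearW => K; rewrite normr_ge0 /=.
  have HG : summable_by 0 (M / K.+1%:R)
      (fun b => if incr i b \notin box K then F (incr i b) else 0).
    move=> b; case: ifP => bK; last first.
      by rewrite normr0 mulr_ge0 ?divr_ge0 ?invr_ge0 ?exprn_ge0 ?weight_ge0.
    apply: (le_trans (H _)); rewrite addn0 addn1 exprS invfM mulrA.
    rewrite ler_pM ?mulr_ge0 ?invr_ge0 ?exprn_ge0 ?weight_ge0//.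
    by rewrite ler_wpM2l// lef_pV2 ?posrE ?weight_gt0//; exact: notin_box_weight.
  by have := sum_box_summable K xpredT HG; rewrite -big_mkcond mulrAC.
- exact: cvg_cst.
- rewrite -[X in _ --> X](mulr0 (M * 2 ^+ d)).
  by apply: cvgM; [exact: cvg_cst|exact: cvg_harmonic].
Qed.

End box_sums.

(** * Taylor estimates *)

Section derivative_criterion.
Context {R : realType}.

(** A remainder with an explicit constant can be summed term by term, unlike a bare limit;
    differentiability of Hermite series is proved in this form. *)
Lemma is_derive_quadratic (V : normedModType R) (f : V -> R) (x v : V) (df C : R) :
  (forall s : R, `|f (s *: v + x) - f x - s * df| <= C * s ^+ 2) ->
  is_derive x v f df.
Proof.
move=> H.
have C0 : 0 <= C by have := le_trans (normr_ge0 _) (H 1); rewrite expr1n mulr1.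
have D : h^-1 *: (f (h *: v + x) - f x) @[h --> (0 : R)^'] --> df.
  apply/cvgrPdist_le => e e0; near=> h.
  have h0 : h != 0 by near: h; exact: nbhs_dnbhs_neq.
  have -> : df - h^-1 *: (f (h *: v + x) - f x) =
      - h^-1 * (f (h *: v + x) - f x - h * df).
    by rewrite /GRing.scale /=; field.
  rewrite normrM normrN normfV ler_pdivrMl ?normr_gt0//.
  apply: (le_trans (H h)).
  have -> : C * h ^+ 2 = `|h| * (C * `|h|) by rewrite [RHS]mulrCA -expr2 real_normK ?num_real.
  rewrite ler_pM2l ?normr_gt0//.
  apply: (@le_trans _ _ ((C + 1) * `|h|)); first by rewrite ler_wpM2r// lerDl.
  rewrite mulrC -ler_pdivlMr ?ltr_wpDl//.
  near: h; apply: dnbhs0_le; rewrite divr_gt0// ltr_wpDl//.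
by apply: DeriveDef; [apply/cvg_ex; exists df|exact/cvg_lim].
Unshelve. all: by end_near. Qed.

Lemma mean_value_bound (f df : R -> R) (a b M : R) : a <= b ->
  (forall x, a < x < b -> is_derive x 1 f (df x)) ->
  {within `[a, b], continuous f} ->
  (forall x, a < x < b -> `|df x| <= M) -> `|f b - f a| <= M * (b - a).
Proof.
move=> ab H cf dM.
have [ab'|ab'] := ltP a b; last first.
  have -> : a = b by apply/le_anti; rewrite ab ab'.
  by rewrite !subrr normr0 mulr0.
have [c /[!in_itv]/= cab ->] := MVT ab' (fun x xab => H x ltac:(by rewrite in_itv in xab)) cf.
by rewrite normrM [`|b - a|]ger0_norm ?ler_wpM2r ?subr_ge0// dM.
Qed.

Lemma derive_le0_left (f df : R -> R) (a b t : R) : a <= t <= b ->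
  (forall x, a < x < b -> is_derive x 1 f (df x)) ->
  (forall x, a < x < b -> df x <= 0) ->
  {within `[a, b], continuous f} -> f t <= f a.
Proof.
move=> /andP[at_ tb] H df0 cf.
apply: (@ler0_derive1_nincr _ f a b) => // [x|x].
  by rewrite in_itv /= => /H[].
by rewrite in_itv /= => xab; rewrite derive1E; have [_ ->] := H x xab; exact: df0.
Qed.

End derivative_criterion.

(** * First and second derivatives of the Hermite functions, with bounds polynomial in the index *)

Section hermite_taylor.
Context {R : realType}.
Implicit Types (n : nat) (x s : R).
Local Notation h := (@hermite_fun R).

Definition dh n x : R := 2^-1 * (Num.sqrt n%:R * h n.-1 x - Num.sqrt n.+1%:R * h n.+1 x).
Definition ddh n x : R := 2^-1 * (Num.sqrt n%:R * dh n.-1 x - Num.sqrt n.+1%:R * dh n.+1 x).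

Lemma sqrt_nat_le n : Num.sqrt n%:R <= n%:R :> R.
Proof.
case: n => [|n]; first by rewrite sqrtr0.
rewrite -[leRHS](ger0_norm (ler0n R _)) -sqrtr_sqr ler_wsqrtr// expr2 ler_peMl//.
by rewrite ler1n.
Qed.

Lemma sqrt_natS_le n : Num.sqrt n%:R <= n.+1%:R :> R.
Proof. by apply: (le_trans (sqrt_nat_le n)); rewrite ler_nat. Qed.

Lemma ladder_le (u v A : R) n : `|u| <= A -> `|v| <= A ->
  `|2^-1 * (Num.sqrt n%:R * u - Num.sqrt n.+1%:R * v)| <= n.+1%:R * A.
Proof.
move=> uA vA; have A0 : 0 <= A by exact: le_trans uA.
rewrite normrM ger0_norm ?invr_ge0// ler_pdivrMl//.
rewrite (le_trans (ler_normB _ _))// !normrM !(ger0_norm (sqrtr_ge0 _)).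
have -> : 2 * (n.+1%:R * A) = n.+1%:R * A + n.+1%:R * A by ring.
rewrite lerD// ler_pM ?sqrtr_ge0//.
- exact: sqrt_natS_le.
- exact: sqrt_nat_le.
Qed.

Lemma dh_le n x : `|dh n x| <= n.+3%:R ^+ 2.
Proof.
rewrite expr2; apply: (@le_trans _ _ (n.+1%:R * n.+3%:R)).
  apply: ladder_le; apply: (le_trans (hermite_fun_le _ _)) => //.
  by rewrite ler_nat; lia.
by rewrite ler_wpM2r// ler_nat; lia.
Qed.

Lemma ddh_le n x : `|ddh n x| <= n.+4%:R ^+ 3.
Proof.
rewrite exprS; apply: (@le_trans _ _ (n.+1%:R * n.+4%:R ^+ 2)).
  apply: ladder_le; apply: (le_trans (dh_le _ _)) => //.
  by rewrite lerXn2r ?nnegrE// ler_nat; lia.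
by rewrite ler_wpM2r ?exprn_ge0// ler_nat; lia.
Qed.

Lemma is_derive_dh n x : is_derive x 1 (dh n) (ddh n x).
Proof.
have D k := is_derive_hermite_fun k x.
by rewrite /dh; apply: is_derive_eq; rewrite /GRing.scale /= /ddh /dh; ring.
Qed.

End hermite_taylor.

Section taylor.
Context {R : realType}.

Lemma is_derive_continuous (f : R -> R) (x df : R) : is_derive x 1 f df -> continuous_at x f.
Proof. by case=> D _; apply/differentiable_continuous/derivable1_diffP. Qed.

(** The mean value inequality is used twice, for [df] and for [f x - x * df c], which gives the
    constant [M] in place of [M / 2]. The expansion at the right end serves the case of decreasing
    arguments in [taylor2]. *)
Lemma taylor2_right (f df ddf : R -> R) (a b M : R) : a <= b ->
  (forall x : R, is_derive x 1 f (df x)) -> (forall x : R, is_derive x 1 df (ddf x)) ->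
  (forall x, a <= x <= b -> `|ddf x| <= M) ->
  `|f b - f a - (b - a) * df a| <= M * (b - a) ^+ 2 /\
  `|f a - f b - (a - b) * df b| <= M * (b - a) ^+ 2.
Proof.
move=> ab Df Ddf HM.
have M0 : 0 <= M by rewrite (le_trans _ (HM a _))// lexx ab.
have L x y : a <= x -> x <= y -> y <= b -> `|df y - df x| <= M * (b - a).
  move=> ax xy yb; apply: (@le_trans _ _ (M * (y - x))); last by rewrite ler_wpM2l// lerB.
  apply: (mean_value_bound (df := ddf)) => //.
    by apply: continuous_subspaceT => z; exact: is_derive_continuous (Ddf z).
  by move=> z /andP[xz zy]; apply: HM; rewrite (le_trans ax (ltW xz)) (le_trans (ltW zy) yb).
have key c : a <= c <= b -> `|f b - f a - (b - a) * df c| <= M * (b - a) ^+ 2.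
  move=> /andP[ac cb].
  have E : f b - f a - (b - a) * df c = (f b - b * df c) - (f a - a * df c) by ring.
  rewrite E expr2 mulrA.
  have Dg (x : R) : is_derive x 1 (fun x => f x - x * df c) (df x - df c).
    have D := Df x; apply: is_derive_eq; rewrite /GRing.scale /=; ring.
  apply: (mean_value_bound (f := fun x => f x - x * df c) (df := fun x => df x - df c)) => //.
    by apply: continuous_subspaceT => z; exact: is_derive_continuous (Dg z).
  move=> x /andP[ax xb]; have [xc|cx] := leP x c.
    by rewrite distrC; apply: L => //; exact: ltW.
  by apply: L => //; exact: ltW.
split; first by apply: key; rewrite lexx ab.
have -> : f a - f b - (a - b) * df b = - (f b - f a - (b - a) * df b) by ring.
by rewrite normrN; apply: key; rewrite lexx ab.
Qed.

Lemma taylor2 (f df ddf : R -> R) (x y M : R) :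
  (forall x : R, is_derive x 1 f (df x)) -> (forall x : R, is_derive x 1 df (ddf x)) ->
  (forall z, Num.min x y <= z <= Num.max x y -> `|ddf z| <= M) ->
  `|f y - f x - (y - x) * df x| <= M * (y - x) ^+ 2.
Proof.
move=> Df Ddf; have [xy|yx] := leP x y => H.
  by have [] := taylor2_right xy Df Ddf H.
by have [_] := taylor2_right (ltW yx) Df Ddf H; rewrite -[(x - y) ^+ 2]sqrrN opprB.
Qed.

End taylor.

Section continuity.
Context {R : realType} {T : topologicalType}.

Lemma continuous_sum I (s : seq I) (F : I -> T -> R) :
  (forall i, continuous (F i)) -> continuous (fun x => \sum_(i <- s) F i x).
Proof.
move=> cF x; elim: s => [|i s IH].
  rewrite /continuous_at big_nil; under eq_fun do rewrite big_nil.
  exact: cvg_cst.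
rewrite /continuous_at big_cons; under eq_fun do rewrite big_cons.
by apply: cvgD IH; exact: cF.
Qed.

Lemma continuous_scale_sqr (c : R) (f : T -> R) :
  continuous f -> continuous (fun x => (c * f x) ^+ 2).
Proof.
move=> cf x; rewrite /continuous_at expr2; under eq_fun do rewrite expr2.
by apply: cvgM; (apply: cvgM; [exact: cvg_cst|exact: cf]).
Qed.

Lemma uniform_approx_continuous (f : T -> R) :
  (forall e, 0 < e -> exists2 g, continuous g & forall x, `|f x - g x| <= e) ->
  continuous f.
Proof.
move=> H x; apply/cvgrPdist_le => e e0.
have e30 : 0 < e / 3 by rewrite divr_gt0.
have [g cg fg] := H _ e30.
have /cvgrPdist_le /(_ _ e30) := cg x; apply: filterS => y gxy.
have -> : f x - f y = (f x - g x) + (g x - g y) - (f y - g y) by ring.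
rewrite (le_trans (ler_normB _ _))// [leRHS](_ : _ = e / 3 + e / 3 + e / 3); last by field.
by apply: lerD => //; apply: (le_trans (ler_normD _ _)); exact: lerD.
Qed.

End continuity.

(** * Synthesis of Schwartz functions from rapidly decreasing coefficients *)

Section synthesis.
Context {R : realType} (d : nat).
Hypothesis d_gt0 : (0 < d)%N.
Implicit Types (a c : multi_index d -> R) (b : multi_index d) (x : 'rV[R]_d) (i : 'I_d).
Local Notation lam := (@hermite_weight R d).
Local Notation h := (@hermite_mfun R d).

(* Weighted sup norms: they control [hermite_norm n] and are controlled by it up
   to a loss of [d] powers of the weight, see [hermite_norm_sbound] and
   [sbound_hermite_norm]. *)
Definition sbound n (M : R) a := forall b, lam b ^+ n * `|a b| <= M.
Definition rapid a := forall n, exists M, sbound n M a.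

Lemma sbound_ge0 n M a : sbound n M a -> 0 <= M.
Proof.
by move=> /(_ [ffun=> 0%N]); apply: le_trans; rewrite mulr_ge0 ?exprn_ge0 ?weight_ge0.
Qed.

Lemma sboundW n m M a : (m <= n)%N -> sbound n M a -> sbound m M a.
Proof.
move=> mn H b; apply: le_trans (H b); rewrite ler_wpM2r//.
by apply: ler_weXn2l => //; exact: weight_ge1.
Qed.

Lemma sboundD n M N a c : sbound n M a -> sbound n N c ->
  sbound n (M + N) (fun b => a b + c b).
Proof.
move=> Ha Hc b; apply: le_trans (lerD (Ha b) (Hc b)).
by rewrite -mulrDr ler_wpM2l ?exprn_ge0 ?weight_ge0// ler_normD.
Qed.

Lemma sboundZ n M r a : sbound n M a -> sbound n (`|r| * M) (fun b => r * a b).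
Proof. by move=> H b; rewrite normrM mulrCA ler_wpM2l. Qed.

Lemma sboundB n M N a c : sbound n M a -> sbound n N c ->
  sbound n (M + N) (fun b => a b - c b).
Proof.
move=> Ha Hc b; apply: le_trans (lerD (Ha b) (Hc b)).
by rewrite -mulrDr ler_wpM2l ?exprn_ge0 ?weight_ge0// ler_normB.
Qed.

Lemma sbound_sum n M I (s : seq I) (F : I -> multi_index d -> R) :
  (forall k, sbound n M (F k)) -> sbound n ((size s)%:R * M) (fun b => \sum_(k <- s) F k b).
Proof.
move=> H b; elim: s => [|i s IH]; first by rewrite big_nil normr0 mulr0 mul0r.
rewrite big_cons /= -addn1 natrD mulrDl mul1r [leRHS]addrC.
apply: le_trans (lerD (H i b) IH).
by rewrite -mulrDr ler_wpM2l ?exprn_ge0 ?weight_ge0// ler_normD.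
Qed.

(** The weight budget: [q] powers pay for the growth of the factor multiplying [a], [2 * d] for
    summability and [k] for the rate of the tails. *)
Lemma sbound_summable q k C M a (F : multi_index d -> R) :
  0 <= C -> (forall b, `|F b| <= C * lam b ^+ q * `|a b|) ->
  sbound (q + (2 * d + k)) M a -> summable_by k (C * M) F.
Proof.
move=> C0 HF H b; apply: (le_trans (HF b)).
rewrite -!mulrA ler_wpM2l// ler_pdivlMr ?exprn_gt0 ?weight_gt0//.
by rewrite mulrAC -exprD.
Qed.

Lemma hermite_mfun_weight b x : `|h b x| <= 2 ^+ d * lam b ^+ d.
Proof.
apply: (le_trans (hermite_mfun_le b x)).
rewrite -exprMn -[X in _ ^+ X](card_ord d) -prodr_const; apply: ler_prod => j _.
rewrite ler0n /=; apply: (@le_trans _ _ (2 * (b j).+1%:R)).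
  by rewrite -natrM ler_nat; lia.
by rewrite ler_wpM2l// weight_ge_coord.
Qed.

Lemma prod_others_le i b x :
  `|\prod_(j < d | j != i) hermite_fun (b j) (x 0 j)| <= 2 ^+ d * lam b ^+ d.
Proof.
apply: (@le_trans _ _ (mfun_bound b)); last first.
  rewrite -exprMn -[X in _ ^+ X](card_ord d) -prodr_const; apply: ler_prod => j _.
  rewrite ler0n /=; apply: (@le_trans _ _ (2 * (b j).+1%:R)).
    by rewrite -natrM ler_nat; lia.
  by rewrite ler_wpM2l// weight_ge_coord.
rewrite normr_prod /mfun_bound big_mkcond; apply: ler_prod => j _.
case: ifP => _; first by rewrite normr_ge0 hermite_fun_le.
by rewrite ler01 ler1n.
Qed.

Definition synth a x : R := csum (fun b => a b * h b x).

(** The threshold [3 * d] of this section is [d] powers for the sup norm of the basis functions plus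
    [2 * d] for summability. *)
Lemma synth_term k M a x : sbound (3 * d + k) M a ->
  summable_by k (2 ^+ d * M) (fun b => a b * h b x).
Proof.
move=> H; apply: (@sbound_summable d _ _ _ a) => //.
  by move=> b; rewrite normrM mulrC ler_wpM2r// hermite_mfun_weight.
by have -> : (d + (2 * d + k) = 3 * d + k)%N by lia.
Qed.

Lemma synth_le M a x : sbound (3 * d) M a -> `|synth a x| <= 2 ^+ d * M * 2 ^+ d.
Proof. by move=> H; apply: csum_le => //; apply: synth_term; rewrite addn0. Qed.

Lemma synthD M N a c x : sbound (3 * d) M a -> sbound (3 * d) N c ->
  synth (fun b => a b + c b) x = synth a x + synth c x.
Proof.
move=> Ha Hc; rewrite /synth -(csumD d_gt0 (M := 2 ^+ d * M) (N := 2 ^+ d * N))//.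
- by congr csum; apply/funext => b; rewrite mulrDl.
- by apply: synth_term; rewrite addn0.
- by apply: synth_term; rewrite addn0.
Qed.

Lemma synthZ M r a x : sbound (3 * d) M a -> synth (fun b => r * a b) x = r * synth a x.
Proof.
move=> Ha; rewrite /synth -(csumZ d_gt0 r (M := 2 ^+ d * M))//.
- by congr csum; apply/funext => b; rewrite mulrA.
- by apply: synth_term; rewrite addn0.
Qed.

Lemma synthB M N a c x : sbound (3 * d) M a -> sbound (3 * d) N c ->
  synth (fun b => a b - c b) x = synth a x - synth c x.
Proof.
move=> Ha Hc; rewrite -mulN1r -(synthZ _ _ Hc) -(synthD _ Ha (sboundZ (-1) Hc)).
by congr synth; apply/funext => b; rewrite mulN1r.
Qed.

Lemma synth0 x : synth (fun=> 0) x = 0.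
Proof.
rewrite /synth (csum_single (b := [ffun=> 0%N])) ?mul0r// => b _.
by rewrite mul0r.
Qed.

Lemma synth_sum M I (s : seq I) (F : I -> multi_index d -> R) x :
  (forall k, sbound (3 * d) M (F k)) ->
  synth (fun b => \sum_(k <- s) F k b) x = \sum_(k <- s) synth (F k) x.
Proof.
move=> H; elim: s => [|i s IH].
  rewrite big_nil -[RHS](synth0 x); congr synth; apply/funext => b.
  by rewrite big_nil.
rewrite big_cons -IH -(synthD _ (H i) (sbound_sum s H)).
by congr synth; apply/funext => b; rewrite big_cons.
Qed.

Lemma continuous_synth a : rapid a -> continuous (synth a).
Proof.
move=> Ra; have [M H] := Ra (3 * d + 1)%N.
have T y K := csum_tail d_gt0 K (synth_term y H).
apply: uniform_approx_continuous => e e0.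
have [K HK] : exists K, 2 ^+ d * M * 2 ^+ d / K.+1%:R <= e.
  have : 2 ^+ d * M * 2 ^+ d * harmonic K @[K --> \oo] --> (0 : R).
    rewrite -[X in _ --> X](mulr0 (2 ^+ d * M * 2 ^+ d)).
    by apply: cvgM; [exact: cvg_cst|exact: cvg_harmonic].
  move=> /cvgrPdist_le /(_ e e0) /= [K _ /(_ K (leqnn K))] /=.
  rewrite sub0r normrN => HK; exists K.
  exact: le_trans (ler_norm _) HK.
exists (fun y => \sum_(b <- box d K) a b * h b y).
  apply: continuous_sum => b y.
  exact: (cvgM (cvg_cst _) (@continuous_hermite_mfun _ _ b y)).
by move=> y; exact: le_trans (T _ K) HK.
Qed.

Lemma hermite_coef_synth a b : rapid a -> hermite_coef (synth a) b = a b.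
Proof.
move=> Ra; have [M H] := Ra (3 * d)%N.
have ST x := synth_term (k := 0) x (eq_rect_r (fun n => sbound n M a) H (addn0 (3 * d))).
pose S K x := \sum_(b <- box d K) a b * h b x.
have cS K : continuous (S K).
  apply: continuous_sum => c y.
  exact: (cvgM (cvg_cst _) (@continuous_hermite_mfun _ _ c y)).
have C : hermite_coef (S K) b @[K --> \oo] --> hermite_coef (synth a) b.
  apply: (hermite_coef_dominated (M := 2 ^+ d * M * 2 ^+ d)) => // [K x|x].
    exact: (sum_box_summable d_gt0 K xpredT (ST x)).
  exact: (csum_cvg d_gt0 (ST x)).
have iS (c : multi_index d) : intg (lebesgue_tuple R d) (fun t => h c (vec t) * h b (vec t)).
  exact: (intg_mul_hermite _ (@continuous_hermite_mfun _ _ _) (hermite_mfun_le _)).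
have E K : b \in box d K -> hermite_coef (S K) b = a b.
  move=> bK; rewrite /hermite_coef /integral_rV /S.
  under eq_Rintegral do rewrite mulr_suml.
  under eq_Rintegral do under eq_bigr do rewrite -mulrA.
  rewrite (Rint_sum _ (F := fun (c : multi_index d) (t : d.-tuple (measurableTypeR R)) =>
    a c * (h c (vec t) * h b (vec t)))); last first.
    by move=> c; exact: intgZ.
  rewrite (bigD1_seq b) ?box_uniq//= RintZ// [X in _ * X]hermite_mfun_orthonormal eqxx mulr1.
  rewrite big1 ?addr0// => c cb.
  by rewrite RintZ// [X in _ * X]hermite_mfun_orthonormal (negbTE cb) mulr0.
apply/esym/(cvg_unique _ _ C) => //; apply: cvg_near_cst.
by apply: filterS (box_near b) => K; exact: E.
Qed.

(** The function and its Hermite series are bounded, continuous and have the same coefficients, so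
    completeness applies to their difference. *)
Lemma synth_coef (phi : 'rV[R]_d -> R) (M : R) : continuous phi ->
  (forall x, `|phi x| <= M) -> rapid (hermite_coef phi) ->
  phi = synth (hermite_coef phi).
Proof.
move=> cphi phiM Rc; have cs := continuous_synth Rc.
have [N HN] := Rc (3 * d)%N.
apply/funext => x; apply/eqP; rewrite -subr_eq0; apply/eqP.
apply: (@hermite_complete _ _ (fun x => phi x - synth (hermite_coef phi) x)
  (M + 2 ^+ d * N * 2 ^+ d)).
- by move=> y; exact: (cvgB (cphi y) (cs y)).
- by move=> y; rewrite (le_trans (ler_normB _ _))// lerD// synth_le.
move=> b; rewrite -[RHS](subrr (hermite_coef phi b)) -{2}(hermite_coef_synth b Rc).
rewrite [X in _ = X - _]/hermite_coef [X in _ = _ - X]/hermite_coef /integral_rV -RintB.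
- by apply: eq_Rintegral => t _; rewrite mulrBl.
- exact: (intg_mul_hermite b cphi phiM).
- exact: (intg_mul_hermite b cs (fun y => synth_le y HN)).
Qed.

(** With [p = q = 1] this is multiplication of the basis function by [x_i]; with [p = 1/2] and
    [q = - 1/2] it is its derivative in direction [i]. *)
Definition ladder i (p q : R) b x :=
  p * (Num.sqrt (b i)%:R * h (decr i b) x) + q * (Num.sqrt (b i).+1%:R * h (incr i b) x).

(** The transposed matrix of [ladder]: the action of the same operator on coefficients. *)
Definition adjoint i (p q : R) a b : R :=
  p * (Num.sqrt (b i).+1%:R * a (incr i b)) + q * (Num.sqrt (b i)%:R * a (decr i b)).

Lemma sqrt_coord_le i b : Num.sqrt (b i).+1%:R <= lam b.
Proof. by apply: (le_trans (sqrt_nat_le _)); exact: weight_ge_coord. Qed.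

Lemma sqrt_coord_le' i b : Num.sqrt (b i)%:R <= lam b.
Proof.
apply: le_trans (sqrt_coord_le i b); rewrite ler_wsqrtr// ler_nat; lia.
Qed.

(** The square roots cost one power of the weight. Reading [a] at a larger index is free, while
    reading it at [decr i b] costs a factor 3 per power, by [weight_le_decr]. *)
Lemma adjoint_sbound n i p q M a : `|p| <= 1 -> `|q| <= 1 -> sbound n.+1 M a ->
  sbound n ((1 + 3 ^+ n.+1) * M) (adjoint i p q a).
Proof.
move=> p1 q1 H b; have M0 := sbound_ge0 H.
have A : lam b ^+ n * (Num.sqrt (b i).+1%:R * `|a (incr i b)|) <= M.
  apply: le_trans (H (incr i b)); rewrite mulrA ler_wpM2r// exprSr.
  have lb : lam b <= lam (incr i b) by rewrite weight_incr lerDl.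
  rewrite ler_pM ?exprn_ge0 ?weight_ge0 ?sqrtr_ge0//.
    by rewrite lerXn2r ?nnegrE ?weight_ge0.
  exact: le_trans (sqrt_coord_le i b) lb.
have B : lam b ^+ n * (Num.sqrt (b i)%:R * `|a (decr i b)|) <= 3 ^+ n.+1 * M.
  apply: (@le_trans _ _ (3 ^+ n.+1 * (lam (decr i b) ^+ n.+1 * `|a (decr i b)|))); last first.
    by rewrite ler_wpM2l ?exprn_ge0//; exact: H.
  rewrite !mulrA ler_wpM2r// -exprMn.
  apply: (@le_trans _ _ (lam b ^+ n.+1)).
    by rewrite exprSr ler_wpM2l ?exprn_ge0 ?weight_ge0//; exact: sqrt_coord_le'.
  by rewrite lerXn2r ?nnegrE ?mulr_ge0 ?weight_ge0//; exact: weight_le_decr.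
rewrite mulrDl mul1r; apply: le_trans (lerD A B); rewrite -mulrDr.
rewrite ler_wpM2l ?exprn_ge0 ?weight_ge0// (le_trans (ler_normD _ _))//.
rewrite !normrM !(ger0_norm (sqrtr_ge0 _)).
by rewrite lerD// ler_piMl ?mulr_ge0 ?sqrtr_ge0.
Qed.

Lemma rapid_adjoint i p q a : `|p| <= 1 -> `|q| <= 1 -> rapid a -> rapid (adjoint i p q a).
Proof.
move=> p1 q1 Ra n; have [M H] := Ra n.+1.
by exists ((1 + 3 ^+ n.+1) * M); exact: adjoint_sbound.
Qed.

(** Summation by parts: each of the two shifted sums is reindexed by [csum_incr], whose condition at
    [b i = 0] holds because of the square root in front. *)
Lemma synth_adjoint i p q a x : rapid a ->
  synth (adjoint i p q a) x = csum (fun b => a b * ladder i p q b x).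
Proof.
move=> Ra.
have [M1 H1] := Ra (d.+1 + (2 * d + 1))%N.
have [M2 H2] := Ra (3 * d + 1).+1%N.
have c0 : 0 <= 2 ^+ d * 3 ^+ d :> R by rewrite mulr_ge0 ?exprn_ge0.
have S (s : multi_index d -> R) (f : multi_index d -> multi_index d) :
    (forall b, 0 <= s b <= lam b) -> (forall b, lam (f b) <= 3 * lam b) ->
    summable_by 1 (2 ^+ d * 3 ^+ d * M1) (fun b => s b * a b * h (f b) x).
  move=> Hs Hf; apply: (sbound_summable c0 _ H1) => b; have /andP[s0 sl] := Hs b.
  rewrite !normrM (ger0_norm s0) mulrAC ler_wpM2r//.
  have -> : 2 ^+ d * 3 ^+ d * lam b ^+ d.+1 = lam b * (2 ^+ d * (3 * lam b) ^+ d).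
    by rewrite exprMn exprS; ring.
  apply: ler_pM => //; apply: (le_trans (hermite_mfun_weight _ _)).
  rewrite ler_wpM2l ?exprn_ge0//.
  by rewrite lerXn2r ?nnegrE ?mulr_ge0 ?weight_ge0.
have wi b : lam (incr i b) <= 3 * lam b.
  by rewrite weight_incr; have := weight_ge1 (R := R) d_gt0 b; lra.
have wd b : lam (decr i b) <= 3 * lam b.
  apply: (@le_trans _ _ (lam b)); last by have := weight_ge1 (R := R) d_gt0 b; lra.
  rewrite ler_nat leq_add2r leq_mul2l /= leq_sum// => j _.
  by rewrite ffunE; case: eqP => // ->; exact: leq_pred.
have S1 := S (fun b => Num.sqrt (b i)%:R) _
  (fun b => introT andP (conj (sqrtr_ge0 _) (sqrt_coord_le' i b))) wd.
have S2 := S (fun b => Num.sqrt (b i).+1%:R) _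
  (fun b => introT andP (conj (sqrtr_ge0 _) (sqrt_coord_le i b))) wi.
have n0 : `|0 : R| <= 1 by rewrite normr0.
have n1 : `|1 : R| <= 1 by rewrite normr1.
have S3 := synth_term x (adjoint_sbound i n0 n1 H2).
have S4 := synth_term x (adjoint_sbound i n1 n0 H2).
have -> : synth (adjoint i p q a) x = p * csum (fun b => adjoint i 1 0 a b * h b x) +
    q * csum (fun b => adjoint i 0 1 a b * h b x).
  rewrite -(csumZ d_gt0 p (summable_byW d_gt0 S4)) -(csumZ d_gt0 q (summable_byW d_gt0 S3)).
  rewrite -(csumD d_gt0 (summable_byZ p (summable_byW d_gt0 S4))
     (summable_byZ q (summable_byW d_gt0 S3))).
  by congr csum; apply/funext => b; rewrite /adjoint; ring.
have -> : csum (fun b => a b * ladder i p q b x) =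
    p * csum (fun b => Num.sqrt (b i)%:R * a b * h (decr i b) x) +
    q * csum (fun b => Num.sqrt (b i).+1%:R * a b * h (incr i b) x).
  rewrite -(csumZ d_gt0 p (summable_byW d_gt0 S1)) -(csumZ d_gt0 q (summable_byW d_gt0 S2)).
  rewrite -(csumD d_gt0 (summable_byZ p (summable_byW d_gt0 S1))
     (summable_byZ q (summable_byW d_gt0 S2))).
  by congr csum; apply/funext => b; rewrite /ladder; ring.
rewrite (csum_incr d_gt0 (i := i) S1); last by move=> b ->; rewrite sqrtr0 !mul0r.
rewrite (csum_incr d_gt0 (i := i) S3); last first.
  by move=> b b0; rewrite /adjoint b0 sqrtr0 !mul0r mulr0 addr0 mul0r.
congr (_ * _ + _ * _); congr csum; apply/funext => b.
  by rewrite /adjoint incrK incrE; ring.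
by rewrite /adjoint incrK incrE; ring.
Qed.

Lemma ladder_prod i p q b x : ladder i p q b x =
  (p * (Num.sqrt (b i)%:R * hermite_fun (b i).-1 (x 0 i)) +
   q * (Num.sqrt (b i).+1%:R * hermite_fun (b i).+1 (x 0 i))) *
  \prod_(j < d | j != i) hermite_fun (b j) (x 0 j).
Proof.
have E (f : multi_index d -> multi_index d) : (forall j, j != i -> f b j = b j) ->
    h (f b) x = hermite_fun (f b i) (x 0 i) * \prod_(j < d | j != i) hermite_fun (b j) (x 0 j).
  move=> H; rewrite /hermite_mfun (bigD1 i)//=; congr (_ * _).
  by apply: eq_bigr => j /H ->.
rewrite /ladder !E ?incrE ?decrE; first by ring.
  by move=> j /negbTE ji; rewrite ffunE ji.
by move=> j /negbTE ji; rewrite ffunE ji.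
Qed.

Lemma hermite_mfun_coord i b x : h b x =
  hermite_fun (b i) (x 0 i) * \prod_(j < d | j != i) hermite_fun (b j) (x 0 j).
Proof. by rewrite /hermite_mfun (bigD1 i). Qed.

Lemma ladder_mul i b x : ladder i 1 1 b x = x 0 i * h b x.
Proof. by rewrite ladder_prod (hermite_mfun_coord i) mulrA mulX_hermite_fun !mul1r. Qed.

Lemma ladder_dh i b x : ladder i 2^-1 (- 2^-1) b x =
  dh (b i) (x 0 i) * \prod_(j < d | j != i) hermite_fun (b j) (x 0 j).
Proof. by rewrite ladder_prod /dh; congr (_ * _); ring. Qed.

(** Only the factor of index [i] moves. Its second derivative is at most
    [(b i + 4)^3 <= (4 * lam b)^3], hence the 64 and the three extra powers. *)
Lemma hermite_mfun_taylor i b x (s : R) :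
  `|h b (s *: delta_mx 0 i + x) - h b x - s * ladder i 2^-1 (- 2^-1) b x| <=
  64 * 2 ^+ d * lam b ^+ (d + 3) * s ^+ 2.
Proof.
rewrite ladder_dh !(hermite_mfun_coord i).
have -> : \prod_(j < d | j != i) hermite_fun (b j) ((s *: delta_mx 0 i + x) 0 j) =
    \prod_(j < d | j != i) hermite_fun (b j) (x 0 j).
  by apply: eq_bigr => j /negbTE ji; rewrite !mxE ji andbF mulr0 add0r.
have -> : (s *: delta_mx 0 i + x) 0 i = s + x 0 i by rewrite !mxE !eqxx mulr1.
rewrite mulrA -mulrBl -mulrBl normrM.
have T : `|hermite_fun (b i) (s + x 0 i) - hermite_fun (b i) (x 0 i) - s * dh (b i) (x 0 i)|
    <= (b i).+4%:R ^+ 3 * s ^+ 2.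
  have := @taylor2 R (hermite_fun (b i)) (dh (b i)) (ddh (b i)) (x 0 i) (s + x 0 i)
    ((b i).+4%:R ^+ 3) (is_derive_hermite_fun (b i)) (is_derive_dh (b i))
    (fun z _ => ddh_le (b i) z).
  by rewrite addrK.
apply: (le_trans (ler_pM (normr_ge0 _) (normr_ge0 _) T (prod_others_le i b x))).
have -> : 64 * 2 ^+ d * lam b ^+ (d + 3) * s ^+ 2 =
    ((4 * lam b) ^+ 3 * s ^+ 2) * (2 ^+ d * lam b ^+ d) by rewrite exprD; ring.
rewrite ler_wpM2r ?mulr_ge0 ?exprn_ge0 ?weight_ge0// ler_wpM2r ?sqr_ge0//.
rewrite lerXn2r ?nnegrE ?mulr_ge0 ?weight_ge0//.
apply: (@le_trans _ _ (4 * (b i).+1%:R)); first by rewrite -natrM ler_nat; lia.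
by rewrite ler_wpM2l// weight_ge_coord.
Qed.

Definition dpart i a := adjoint i 2^-1 (- 2^-1) a.

Lemma half_le1 : `|2^-1 : R| <= 1.
Proof. by rewrite ger0_norm ?invr_ge0// invf_le1// ler1n. Qed.

Lemma dpart_sbound n i M a : sbound n.+1 M a -> sbound n ((1 + 3 ^+ n.+1) * M) (dpart i a).
Proof. by apply: adjoint_sbound; rewrite ?normrN half_le1. Qed.

Lemma rapid_dpart i a : rapid a -> rapid (dpart i a).
Proof. by apply: rapid_adjoint; rewrite ?normrN half_le1. Qed.

(** Term-by-term differentiation: the quadratic remainders of the basis functions grow polynomially
    in the index, so their sum against [a] is again quadratic in the increment. *)
Lemma is_derive_synth i a x : rapid a ->
  is_derive x (delta_mx 0 i : 'rV[R]_d) (synth a) (synth (dpart i a) x).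
Proof.
move=> Ra; have [M H] := Ra ((d + 3) + (2 * d + 0))%N.
have [N HN] := Ra (3 * d + 0).+1%N.
have S1 y := summable_byW d_gt0 (synth_term y (sboundW (leqnSn _) HN)).
have [N' HN'] := Ra (d.+3 + (2 * d + 0))%N.
apply: (@is_derive_quadratic _ _ _ _ _ _ (64 * 2 ^+ d * M * 2 ^+ d)) => s.
rewrite /dpart synth_adjoint//.
have SL : exists L, summable_by 0 L (fun b => a b * ladder i 2^-1 (- 2^-1) b x).
  exists (2 ^+ d * 16 * N'); apply: (sbound_summable _ _ HN') => [|b].
    by rewrite mulr_ge0 ?exprn_ge0.
  rewrite normrM mulrC ler_wpM2r// ladder_dh normrM mulrC.
  have -> : 2 ^+ d * 16 * lam b ^+ d.+3 = (2 ^+ d * lam b ^+ d) * (16 * lam b ^+ 3).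
    by rewrite -[d.+3]addn3 exprD; ring.
  apply: ler_pM => //; first exact: prod_others_le.
  apply: (le_trans (dh_le _ _)).
  apply: (@le_trans _ _ ((4 * (b i).+1%:R) ^+ 2)).
    by rewrite lerXn2r ?nnegrE ?mulr_ge0// -natrM ler_nat; lia.
  rewrite exprMn (_ : 4 ^+ 2 = 16); last by ring.
  rewrite ler_wpM2l// (@le_trans _ _ (lam b ^+ 2))//.
    by rewrite lerXn2r ?nnegrE ?weight_ge0// weight_ge_coord.
  by apply: ler_weXn2l => //; exact: weight_ge1.
have [L HL] := SL.
rewrite /synth -(csumB d_gt0 (S1 _) (S1 _)) -(csumZ d_gt0 s HL).
rewrite -(csumB d_gt0 (summable_byB (S1 _) (S1 _)) (summable_byZ s HL)).
have -> : 64 * 2 ^+ d * M * 2 ^+ d * s ^+ 2 = 64 * 2 ^+ d * s ^+ 2 * M * 2 ^+ d by ring.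
apply: csum_le => //.
apply: (sbound_summable _ _ H) => [|b]; first by rewrite mulr_ge0 ?sqr_ge0// mulr_ge0 ?exprn_ge0.
have -> : a b * h b (s *: delta_mx 0 i + x) - a b * h b x - s * (a b * ladder i 2^-1 (- 2^-1) b x)
    = (h b (s *: delta_mx 0 i + x) - h b x - s * ladder i 2^-1 (- 2^-1) b x) * a b by ring.
rewrite normrM ler_wpM2r//; apply: le_trans (hermite_mfun_taylor i b x s) _.
by rewrite mulrAC.
Qed.

Lemma partial_synth i a : rapid a -> partial i (synth a) = synth (dpart i a).
Proof. by move=> Ra; apply/funext => x; case: (is_derive_synth i x Ra). Qed.

Definition dparts (s : seq 'I_d) a := foldr dpart a s.

Lemma rapid_dparts s a : rapid a -> rapid (dparts s a).
Proof. by move=> Ra; elim: s => //= i s; exact: rapid_dpart. Qed.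

Lemma partials_synth s a : rapid a -> partials s (synth a) = synth (dparts s a).
Proof.
move=> Ra; elim: s => //= i s ->.
by rewrite partial_synth//; exact: rapid_dparts.
Qed.

Lemma mul_coord_synth i k a : rapid a -> exists2 c, rapid c &
  forall x, x 0 i ^+ k * synth a x = synth c x.
Proof.
move=> Ra; elim: k => [|k [c Rc Hc]]; first by exists a => // x; rewrite mul1r.
exists (adjoint i 1 1 c); first by apply: rapid_adjoint => //; rewrite normr1.
move=> x; rewrite synth_adjoint// exprS -mulrA Hc.
have [M H] := Rc (3 * d + 0)%N.
rewrite -(csumZ d_gt0 _ (synth_term x H)); congr csum; apply/funext => b.
by rewrite ladder_mul mulrCA.
Qed.

(** Derivatives and multiplication by coordinates preserve rapid coefficients, so every [x_i^k]
    times a derivative is again a bounded Hermite series. The norm of a row vector being the largest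
    absolute coordinate, the bounds for the separate coordinates suffice. *)
Lemma schwartz_synth a : rapid a -> schwartz (synth a).
Proof.
move=> Ra; split=> [s|s k]; rewrite partials_synth//; have Rs := rapid_dparts s Ra.
  split; first exact: continuous_synth.
  by move=> i x; case: (is_derive_synth i x Rs).
have B i : exists C, forall x, `|x 0 i| ^+ k * `|synth (dparts s a) x| <= C.
  have [c Rc Hc] := mul_coord_synth i k Rs; have [M H] := Rc (3 * d)%N.
  by exists (2 ^+ d * M * 2 ^+ d) => x; rewrite -normrX -normrM Hc; exact: synth_le.
have /choice[C HC] := B.
exists (\sum_i `|C i|) => x.
have [i xi] : exists i, `|x| = `|x 0 i|.
  have [->|x0] := eqVneq x 0.
    by exists (Ordinal d_gt0); rewrite normr0 mxE normr0.
  have : mx_norm x != 0 by apply: contra_neq x0; exact: mx_norm_eq0.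
  by move=> /mx_norm_neq0[[j i] /=]; rewrite ord1 => xi; exists i.
rewrite xi (le_trans (HC i x))// (le_trans (ler_norm _))// (bigD1 i)//= lerDl.
by rewrite sumr_ge0.
Qed.

End synthesis.

Lemma cvg_finsum {R : realType} T (F : set_system T) (FF : Filter F) I (s : seq I)
    (f : I -> T -> R) (l : I -> R) :
  (forall i, f i x @[x --> F] --> l i) ->
  \sum_(i <- s) f i x @[x --> F] --> \sum_(i <- s) l i.
Proof.
move=> C; elim: s => [|i s IH].
  by rewrite big_nil; under eq_fun do rewrite big_nil; exact: cvg_cst.
by rewrite big_cons; under eq_fun do rewrite big_cons; exact: cvgD (C i) IH.
Qed.

(** * Finite linear systems with constant coefficients, solved by the exponential series *)

Section linear_ode.
Context {R : realType} (I : finType) (m : I -> I -> R) (y0 : I -> R).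

Let A (u : I -> R) : I -> R := fun i => \sum_j m i j * u j.
Let v k : I -> R := iter k A y0.
Let Lam : R := \sum_i \sum_j `|m i j|.
Let Y : R := \sum_i `|y0 i|.

Let v_le k i : `|v k i| <= Lam ^+ k * Y.
Proof.
have Lam0 : 0 <= Lam by rewrite sumr_ge0// => j _; exact: sumr_ge0.
have Y0 : 0 <= Y by exact: sumr_ge0.
elim: k i => [|k IH] i.
  by rewrite expr0 mul1r /v /= /Y (bigD1 i)//= lerDl sumr_ge0.
rewrite /v iterS -/(v k) /A (le_trans (ler_norm_sum _ _ _))//.
apply: (@le_trans _ _ (\sum_j `|m i j| * (Lam ^+ k * Y))).
  by apply: ler_sum => j _; rewrite normrM ler_wpM2l.
rewrite -mulr_suml exprS -mulrA ler_wpM2r ?mulr_ge0 ?exprn_ge0//.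
by rewrite /Lam [leRHS](bigD1 i)//= lerDl sumr_ge0// => j _; exact: sumr_ge0.
Qed.

(** Taylor coefficients of the [n]-th time derivative of [exp (t A) y0]; formal differentiation of
    the series is thus the shift of [n], as [diffs_c] records. *)
Let c n i k : R := v (k + n) i / k`!%:R.

Let cvg_c n i t : cvgn (pseries (c n i) t).
Proof.
apply: normed_cvg.
apply: (@series_le_cvg _ _ (fun k => Lam ^+ n * Y * exp_coeff (Lam * `|t|) k)).
- by move=> k; exact: normr_ge0.
- move=> k; rewrite !mulr_ge0 ?exprn_ge0 ?sumr_ge0// ?invr_ge0//.
  + by move=> j _; exact: sumr_ge0.
  + by rewrite mulr_ge0// sumr_ge0// => j _; exact: sumr_ge0.
- move=> k /=; rewrite /c /exp_coeff /= !normrM normfV normr_nat normrX exprMn.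
  have -> : Lam ^+ n * Y * (Lam ^+ k * `|t| ^+ k / k`!%:R) =
      (Lam ^+ (k + n) * Y) * (k`!%:R^-1 * `|t| ^+ k) by rewrite exprD; ring.
  by rewrite -mulrA ler_wpM2r// mulr_ge0// ?invr_ge0// exprn_ge0.
- by apply: is_cvg_seriesZ; exact: is_cvg_series_exp_coeff.
Qed.

Let diffs_c n i : pseries_diffs (c n i) = c n.+1 i.
Proof.
apply/funext => k; rewrite /pseries_diffs /c addSnnS factS natrM invfM.
by rewrite mulrCA mulVKf.
Qed.

Lemma linear_ode : exists y : R -> I -> R, (forall i, y 0 i = y0 i) /\
  forall (t : R) i, is_derive t 1 (fun s => y s i) (\sum_j m i j * y t j).
Proof.
exists (fun t i => limn (pseries (c 0 i) t)); split=> [i|t i].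
  apply/cvg_lim => //; rewrite -cvg_shiftS; apply: cvg_near_cst; apply: nearW => n.
  rewrite /pseries /series /= big_nat_recl//= expr0 mulr1 big1 ?addr0; last first.
    by move=> k _; rewrite expr0n mulr0.
  by rewrite /c fact0 invr1 mulr1.
have D := @pseries_snd_diffs R (c 0 i) (`|t| + 1) t.
rewrite !diffs_c in D.
have {}D := D (@cvg_c _ _ _) (@cvg_c _ _ _) (@cvg_c _ _ _).
have lt1 : `|t| < `| `|t| + 1| by rewrite [ltRHS]ger0_norm ?addr_ge0// ltrDl.
apply: is_derive_eq (D lt1) _; apply/cvg_lim => //.
have E : pseries (c 1 i) t = (fun n => \sum_j m i j * pseries (c 0 j) t n).
  apply/funext => n; rewrite /pseries /series /=.
  under [RHS]eq_bigr do rewrite mulr_sumr.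
  rewrite exchange_big; apply: eq_bigr => k _.
  rewrite /c addn1 addn0 /v iterS -/(v k) /A mulr_suml mulr_suml.
  by apply: eq_bigr => j _; rewrite !mulrA.
rewrite E; apply: cvg_finsum => j; apply: cvgM; first exact: cvg_cst.
exact: cvg_c.
Qed.

End linear_ode.

(** * Energy estimates for the Galerkin approximation *)

Section energy.
Context {R : realType} (d : nat).
Hypothesis d_gt0 : (0 < d)%N.
Implicit Types (a u v : multi_index d -> R) (b : multi_index d) (i : 'I_d) (K n : nat).
Local Notation lam := (@hermite_weight R d).

Definition heatop a b : R := 2^-1 * \sum_i dpart i (dpart i a) b.

Definition supported K a := forall b, b \notin box d K -> a b = 0.

(** Integration by parts on coefficients. The sums run over [box d K.+1] because [dpart i a] reaches
    one layer beyond the support of [a]; there are then no boundary terms, whatever [v] is. *)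
Lemma dpart_skew i K a v : supported K a ->
  \sum_(b <- box d K.+1) a b * dpart i v b = - \sum_(b <- box d K.+1) dpart i a b * v b.
Proof.
move=> aK.
have sub b : b \notin box d K.+1 -> a b = 0.
  by move=> bK; apply: aK; apply: contra bK; apply: box_sub.
have out b : incr i b \notin box d K.+1 -> b \in box d K.+1 -> a b = 0.
  rewrite incr_in_box => + bK; rewrite bK /= -leqNgt => Kb; apply: aK.
  by rewrite mem_box; apply/forallPn; exists i; rewrite -leqNgt.
have shift (F : multi_index d -> R) : (forall b, b i = 0%N -> F b = 0) ->
    (forall b, incr i b \notin box d K.+1 -> b \in box d K.+1 -> F (incr i b) = 0) ->
    \sum_(b <- box d K.+1) F b = \sum_(b <- box d K.+1) F (incr i b).
  move=> F0 Fo; rewrite (bigID (fun b => (0 < b i)%N)) /= [X in _ + X]big1 ?addr0; last first.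
    by move=> b; rewrite -eqn0Ngt => /eqP; exact: F0.
  rewrite sum_box_incr [RHS](bigID (fun b => incr i b \in box d K.+1)) /=.
  by rewrite [X in _ = _ + X]big_seq_cond [X in _ = _ + X]big1 ?addr0// => b /andP[bK ib]; exact: Fo.
have E1 := shift (fun b => Num.sqrt (b i)%:R * a (decr i b) * v b).
have E2 := shift (fun b => Num.sqrt (b i)%:R * a b * v (decr i b)).
have {}E1 := E1 (fun b (b0 : b i = 0%N) => ltac:(by rewrite b0 sqrtr0 !mul0r))
  (fun b ib bK => ltac:(by rewrite incrK (out _ ib bK) mulr0 mul0r)).
have {}E2 := E2 (fun b (b0 : b i = 0%N) => ltac:(by rewrite b0 sqrtr0 !mul0r))
  (fun b ib _ => ltac:(by rewrite (sub _ ib) mulr0 mul0r)).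
have -> : \sum_(b <- box d K.+1) a b * dpart i v b = 2^-1 *
    \sum_(b <- box d K.+1) Num.sqrt (b i).+1%:R * a b * v (incr i b) - 2^-1 *
    \sum_(b <- box d K.+1) Num.sqrt (b i)%:R * a b * v (decr i b).
  rewrite !mulr_sumr -sumrB; apply: eq_bigr => b _; rewrite /dpart /adjoint; ring.
have -> : \sum_(b <- box d K.+1) dpart i a b * v b = 2^-1 *
    \sum_(b <- box d K.+1) Num.sqrt (b i).+1%:R * a (incr i b) * v b - 2^-1 *
    \sum_(b <- box d K.+1) Num.sqrt (b i)%:R * a (decr i b) * v b.
  rewrite !mulr_sumr -sumrB; apply: eq_bigr => b _; rewrite /dpart /adjoint; ring.
rewrite E1 E2 opprB; congr (_ * _ - _ * _); apply: eq_bigr => b _.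
  by rewrite incrE incrK.
by rewrite incrE incrK.
Qed.

(** Here [q] is the weight of [decr i b], [q + 4] that of [incr i b] (two steps of 2), and [s] the
    product of the two matrix entries. The gap of the powers is at most [5^n q^(n - 1)], and its
    square compensates for the factor [s] of order [q]. *)
Lemma weight_pow_gap n (q s : R) : 1 <= q -> 0 <= s <= 3 * q ->
  s * ((q + 4) ^+ n - q ^+ n) ^+ 2 <= 3 * 25 ^+ n * ((q + 4) ^+ n * q ^+ n).
Proof.
move=> q1 /andP[s0 sq]; have q0 : 0 < q by exact: lt_le_trans q1.
have D : 0 <= q * ((q + 4) ^+ n - q ^+ n) <= 5 ^+ n * q ^+ n.
  apply/andP; split.
    by rewrite mulr_ge0 ?(ltW q0)// subr_ge0 lerXn2r ?nnegrE ?addr_ge0 ?(ltW q0)// lerDl.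
  (* The induction closes for [5^n - 1] but not for [5^n]: each step multiplies by at most 5 and
     adds 4. *)
  apply: (@le_trans _ _ ((5 ^+ n - 1) * q ^+ n)); last first.
    by rewrite ler_wpM2r ?exprn_ge0 ?(ltW q0)// gerBl.
  elim: n => [|n IH]; first by rewrite !expr0 subrr mulr0 mul0r.
  have -> : q * ((q + 4) ^+ n.+1 - q ^+ n.+1) =
      (q + 4) * (q * ((q + 4) ^+ n - q ^+ n)) + 4 * (q * q ^+ n).
    by rewrite !exprS; ring.
  have -> : (5 ^+ n.+1 - 1) * q ^+ n.+1 =
      5 * q * ((5 ^+ n - 1) * q ^+ n) + 4 * (q * q ^+ n).
    by rewrite !exprS; ring.
  rewrite lerD2r; apply: (@le_trans _ _ ((q + 4) * ((5 ^+ n - 1) * q ^+ n))).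
    by rewrite ler_wpM2l// addr_ge0// ltW.
  rewrite ler_wpM2r; [by []| |by lra].
  by rewrite mulr_ge0 ?exprn_ge0 ?(ltW q0)// subr_ge0 exprn_ege1// ler1n.
have /andP[D0 D1] := D.
set x := (q + 4) ^+ n - q ^+ n in D0 D1 *.
have x2 : (q * x) ^+ 2 <= (5 ^+ n * q ^+ n) ^+ 2.
  by rewrite lerXn2r ?nnegrE// mulr_ge0 ?exprn_ge0 ?(ltW q0).
have E25 : (5 ^+ n * q ^+ n) ^+ 2 = 25 ^+ n * (q ^+ n * q ^+ n).
  by rewrite exprMn -exprM mulnC exprM expr2; congr (_ ^+ _ * _); ring.
have qn : q ^+ n <= (q + 4) ^+ n.
  by rewrite lerXn2r ?nnegrE ?addr_ge0 ?(ltW q0)// lerDl.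
have qn0 : 0 <= q ^+ n by rewrite exprn_ge0// ltW.
rewrite -(ler_pM2l q0).
apply: (@le_trans _ _ (3 * (q * x) ^+ 2)).
  have -> : q * (s * x ^+ 2) = s * (q * x ^+ 2) by ring.
  have -> : 3 * (q * x) ^+ 2 = 3 * q * (q * x ^+ 2) by ring.
  by rewrite ler_wpM2r// mulr_ge0 ?sqr_ge0// ltW.
apply: (@le_trans _ _ (3 * (25 ^+ n * (q ^+ n * q ^+ n)))).
  by rewrite ler_wpM2l// -E25.
rewrite -[leLHS]mul1r; apply: ler_pM => //.
  by rewrite mulr_ge0// mulr_ge0 ?exprn_ge0// mulr_ge0.
by rewrite -!mulrA ler_wpM2l// ler_wpM2l ?exprn_ge0// ler_wpM2r.
Qed.

(* The gap between consecutive powers of the weight is smaller than the powers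
   by a factor of the weight, which compensates for the growth of the matrix
   entries of the derivative: this is why the heat semigroup, which is not
   diagonal in the Hermite basis, is bounded on each weighted space. *)
Lemma dpart_commutator i n a b :
  - (dpart i (fun b => lam b ^+ (2 * n) * a b) b * dpart i a b) <=
  3 / 8 * 25 ^+ n * ((lam (incr i b) ^+ n * a (incr i b)) ^+ 2 +
    (0 < b i)%N%:R * (lam (decr i b) ^+ n * a (decr i b)) ^+ 2).
Proof.
rewrite /dpart /adjoint.
set s := Num.sqrt (b i).+1%:R; set t := Num.sqrt (b i)%:R.
set P := lam (incr i b) ^+ n; set Q := lam (decr i b) ^+ n.
set x := a (incr i b); set y := a (decr i b).
have -> : lam (incr i b) ^+ (2 * n) = P * P by rewrite mul2n -addnn exprD.
have -> : lam (decr i b) ^+ (2 * n) = Q * Q by rewrite mul2n -addnn exprD.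
have k0 : 0 <= 3 / 8 * 25 ^+ n :> R by rewrite mulr_ge0 ?exprn_ge0.
have [b0|b0] := posnP (b i).
  have t0 : t = 0 by rewrite /t b0 sqrtr0.
  apply: (@le_trans _ _ 0); last by rewrite mulr_ge0// mul0r addr0 sqr_ge0.
  rewrite oppr_le0 t0.
  have -> : (2^-1 * (s * (P * P * x)) + - 2^-1 * (0 * (Q * Q * y))) *
      (2^-1 * (s * x) + - 2^-1 * (0 * y)) = (2^-1 * s * (P * x)) ^+ 2 by ring.
  exact: sqr_ge0.
rewrite mul1r.
have q1 : 1 <= lam (decr i b) by exact: weight_ge1.
have eP : P = (lam (decr i b) + 4) ^+ n.
  by rewrite /P weight_incr -{1}(decrK b0) weight_incr -addrA; congr ((_ + _) ^+ _); ring.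
have st : 0 <= s * t <= 3 * lam (decr i b).
  rewrite mulr_ge0 ?sqrtr_ge0//=.
  have s2 : s ^+ 2 = (b i).+1%:R by rewrite sqr_sqrtr.
  have ts : t <= s by rewrite ler_wsqrtr// ler_nat.
  have s0 : 0 <= s by exact: sqrtr_ge0.
  apply: (@le_trans _ _ (b i).+1%:R); first by rewrite -s2 expr2 ler_wpM2l.
  exact: le_trans (weight_ge_coord i b) (weight_le_decr d_gt0 i b).
have G := weight_pow_gap n q1 st; rewrite -eP -/Q in G.
have P0 : 0 <= P by rewrite exprn_ge0// weight_ge0.
have Q0 : 0 < Q by rewrite exprn_gt0// weight_gt0.
have PP : 0 < P by rewrite exprn_gt0// weight_gt0.
(* Completing the square. The negative square is the dissipation and is discarded; the rest carries
   [(P - Q)^2], the squared commutator with the weight. *)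
have -> : - ((2^-1 * (s * (P * P * x)) + - 2^-1 * (t * (Q * Q * y))) *
     (2^-1 * (s * x) + - 2^-1 * (t * y))) =
   4^-1 * (s * t * (P - Q) ^+ 2 * (x * y)) - 4^-1 * (s * (P * x) - t * (Q * y)) ^+ 2.
  by field.
apply: (@le_trans _ _ (4^-1 * (s * t * (P - Q) ^+ 2 * (x * y)))).
  by rewrite gerBl mulr_ge0 ?sqr_ge0// invr_ge0.
have -> : 3 / 8 * 25 ^+ n * ((P * x) ^+ 2 + (Q * y) ^+ 2) =
    4^-1 * (3 * 25 ^+ n * (2^-1 * ((P * x) ^+ 2 + (Q * y) ^+ 2))) by field.
rewrite ler_wpM2l ?invr_ge0//.
apply: (@le_trans _ _ (s * t * (P - Q) ^+ 2 * `|x * y|)).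
  rewrite ler_wpM2l ?ler_norm// mulr_ge0 ?sqr_ge0//; by case/andP: st.
apply: (@le_trans _ _ (3 * 25 ^+ n * (P * Q) * `|x * y|)).
  by rewrite ler_wpM2r.
rewrite -!mulrA ler_wpM2l// ler_wpM2l ?exprn_ge0//.
have -> : P * (Q * `|x * y|) = `|P * x| * `|Q * y|.
  by rewrite !normrM (gtr0_norm PP) (gtr0_norm Q0); ring.
rewrite -[(P * x) ^+ 2]real_normK ?num_real// -[(Q * y) ^+ 2]real_normK ?num_real//.
by have := sqr_ge0 (`|P * x| - `|Q * y|); move: `|P * x| `|Q * y| => X Z; lra.
Qed.

Definition Ener n K a : R := \sum_(b <- box d K) (lam b ^+ n * a b) ^+ 2.

Lemma Ener_ge0 n K a : 0 <= Ener n K a.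
Proof. by apply: sumr_ge0 => b _; exact: sqr_ge0. Qed.

Lemma Ener_supported n K K' a : supported K a -> (K <= K')%N -> Ener n K' a = Ener n K a.
Proof.
move=> aK KK; rewrite /Ener (sum_box_sub _ KK) (bigID (fun b => b \in box d K)) /=.
by rewrite [X in _ + X]big1 ?addr0// => b /aK ->; rewrite mulr0 expr0n.
Qed.

(** Skewness moves one derivative onto the weighted sequence, and [dpart_commutator] is summed. Each
    of its two shifted sums is at most the energy, which doubles the [3 / 8]. *)
Lemma dpart2_energy i n K a : supported K a ->
  \sum_(b <- box d K) lam b ^+ (2 * n) * a b * dpart i (dpart i a) b <=
  3 / 4 * 25 ^+ n * Ener n K a.
Proof.
move=> aK.
have -> : \sum_(b <- box d K) lam b ^+ (2 * n) * a b * dpart i (dpart i a) b =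
    \sum_(b <- box d K.+1) lam b ^+ (2 * n) * a b * dpart i (dpart i a) b.
  rewrite (sum_box_sub _ (leqnSn K)) [RHS](bigID (fun b => b \in box d K)) /=.
  by rewrite [X in _ = _ + X]big1 ?addr0// => b /aK ->; rewrite mulr0 mul0r.
rewrite (@dpart_skew i K (fun b => lam b ^+ (2 * n) * a b)); last first.
  by move=> b /aK ->; rewrite mulr0.
rewrite -sumrN; apply: le_trans (ler_sum _ (fun b _ => dpart_commutator i n a b)) _.
rewrite -mulr_sumr big_split /=.
have -> : 3 / 4 * 25 ^+ n * Ener n K a = 3 / 8 * 25 ^+ n * (Ener n K a + Ener n K a).
  by field.
rewrite ler_wpM2l ?mulr_ge0 ?exprn_ge0//.
rewrite -(Ener_supported n aK (leqnSn K)); set c := fun b => (lam b ^+ n * a b) ^+ 2.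
have c0 b : 0 <= c b by exact: sqr_ge0.
apply: lerD.
  rewrite (bigID (fun b => incr i b \in box d K.+1)) /= [X in _ + X]big1 ?addr0; last first.
    move=> b ib; rewrite aK ?mulr0 ?expr0n//; apply: contra ib; exact: box_sub.
  rewrite -(sum_box_incr i _ c) big_mkcond; apply: ler_sum => b _.
  by case: ifP => _; rewrite ?sqr_ge0.
rewrite (eq_bigr (fun b => if (0 < b i)%N then c (decr i b) else 0)); last first.
  by move=> b _; case: ifP; rewrite ?mul1r ?mul0r.
rewrite -big_mkcond (sum_box_incr i _ (fun b => c (decr i b))) big_mkcond.
by apply: ler_sum => b _; rewrite incrK; case: ifP => _; rewrite ?sqr_ge0.
Qed.

Lemma heatop_energy n K a : supported K a ->
  \sum_(b <- box d K) lam b ^+ (2 * n) * a b * heatop a b <=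
  3 / 8 * d%:R * 25 ^+ n * Ener n K a.
Proof.
move=> aK.
have -> : \sum_(b <- box d K) lam b ^+ (2 * n) * a b * heatop a b =
    2^-1 * \sum_i \sum_(b <- box d K) lam b ^+ (2 * n) * a b * dpart i (dpart i a) b.
  rewrite exchange_big /= mulr_sumr; apply: eq_bigr => b _.
  by rewrite /heatop mulrCA mulr_sumr.
have -> : 3 / 8 * d%:R * 25 ^+ n * Ener n K a =
    2^-1 * \sum_(i < d) (3 / 4 * 25 ^+ n * Ener n K a).
  by rewrite sumr_const card_ord -[_ *+ d]mulr_natr; field.
rewrite ler_wpM2l ?invr_ge0//; apply: ler_sum => i _; exact: dpart2_energy.
Qed.

End energy.

(** * Truncated systems and the Gronwall estimate *)

Section galerkin.
Context {R : realType} (d : nat).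
Hypothesis d_gt0 : (0 < d)%N.
Implicit Types (a u v : multi_index d -> R) (b : multi_index d) (i : 'I_d) (K n : nat).
Local Notation lam := (@hermite_weight R d).

Lemma adjoint_sum i p q I (s : seq I) (r : I -> R) (F : I -> multi_index d -> R) b :
  adjoint i p q (fun b => \sum_(k <- s) r k * F k b) b =
  \sum_(k <- s) r k * adjoint i p q (F k) b.
Proof.
rewrite /adjoint !mulr_sumr -big_split; apply: eq_bigr => k _ /=; ring.
Qed.

Lemma heatop_sum I (s : seq I) (r : I -> R) (F : I -> multi_index d -> R) b :
  heatop (fun b => \sum_(k <- s) r k * F k b) b = \sum_(k <- s) r k * heatop (F k) b.
Proof.
rewrite /heatop; under [RHS]eq_bigr do rewrite mulrCA mulr_sumr.
rewrite -mulr_sumr exchange_big; congr (_ * _); apply: eq_bigr => i _ /=.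
rewrite -[RHS]adjoint_sum; congr (dpart i _ b).
by apply/funext => c; exact: adjoint_sum.
Qed.

Lemma heatopB u v b : heatop (fun b => u b - v b) b = heatop u b - heatop v b.
Proof.
rewrite /heatop -mulrBr -sumrB; congr (_ * _); apply: eq_bigr => i _.
rewrite /dpart /adjoint; ring.
Qed.

Lemma is_derive_adjoint i p q (u : R -> multi_index d -> R) (u' : multi_index d -> R) (t : R) b :
  (forall b, is_derive t 1 (fun s => u s b) (u' b)) ->
  is_derive t 1 (fun s => adjoint i p q (u s) b) (adjoint i p q u' b).
Proof.
move=> D; have D1 := D (incr i b); have D2 := D (decr i b).
by rewrite /adjoint; apply: is_derive_eq; rewrite /GRing.scale /=; ring.
Qed.

Lemma is_derive_heatop (u : R -> multi_index d -> R) (u' : multi_index d -> R) (t : R) b :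
  (forall b, is_derive t 1 (fun s => u s b) (u' b)) ->
  is_derive t 1 (fun s => heatop (u s) b) (heatop u' b).
Proof.
move=> D.
have D' (i : 'I_d) : is_derive t 1 (fun s => dpart i (dpart i (u s)) b) (dpart i (dpart i u') b).
  by apply: is_derive_adjoint => c; exact: is_derive_adjoint.
have S := is_derive_sum D'.
have -> : (fun s => heatop (u s) b) =
    (fun s => 2^-1 * (\sum_i (fun s => dpart i (dpart i (u s)) b)) s).
  by apply/funext => s; rewrite /heatop fct_sumE.
by apply: is_derive_eq; rewrite /GRing.scale /= /heatop.
Qed.

Lemma cvg_adjoint i p q T (F : set_system T) (FF : Filter F) (u : T -> multi_index d -> R)
    (v : multi_index d -> R) b :
  (forall b, u s b @[s --> F] --> v b) ->
  adjoint i p q (u s) b @[s --> F] --> adjoint i p q v b.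
Proof.
move=> C; rewrite /adjoint; apply: cvgD; (apply: cvgM; first exact: cvg_cst);
  (apply: cvgM; first exact: cvg_cst); exact: C.
Qed.

Lemma cvg_heatop T (F : set_system T) (FF : Filter F) (u : T -> multi_index d -> R)
    (v : multi_index d -> R) b :
  (forall b, u s b @[s --> F] --> v b) -> heatop (u s) b @[s --> F] --> heatop v b.
Proof.
move=> C; rewrite /heatop; apply: cvgM; first exact: cvg_cst.
by apply: cvg_finsum => i; apply: cvg_adjoint => c; exact: cvg_adjoint.
Qed.

Definition heat_const n : R := 2^-1 * (d%:R * ((1 + 3 ^+ n.+1) * (1 + 3 ^+ n.+2))).

Lemma heat_const_ge0 n : 0 <= heat_const n.
Proof.
by rewrite /heat_const !mulr_ge0 ?invr_ge0 ?addr_ge0 ?exprn_ge0.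
Qed.

Lemma heatop_sbound n M a : sbound n.+2 M a -> sbound n (heat_const n * M) (heatop a).
Proof.
move=> H.
have H1 i : sbound n ((1 + 3 ^+ n.+1) * ((1 + 3 ^+ n.+2) * M)) (dpart i (dpart i a)).
  by apply: dpart_sbound => //; exact: dpart_sbound.
have := sboundZ 2^-1 (sbound_sum (enum 'I_d) H1).
rewrite size_enum_ord ger0_norm ?invr_ge0// /heat_const !mulrA => H2 b.
by have := H2 b; rewrite /heatop big_enum.
Qed.

Lemma rapid_heatop a : rapid a -> rapid (heatop a).
Proof.
by move=> Ra n; have [M H] := Ra n.+2; exists (heat_const n * M); exact: heatop_sbound.
Qed.

Definition trunc K a b : R := if b \in box d K then a b else 0.

Lemma supported_trunc K a : supported K (trunc K a).
Proof. by move=> b /negbTE bK; rewrite /trunc bK. Qed.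

Lemma trunc_sbound n M K a : sbound n M a -> sbound n M (trunc K a).
Proof.
move=> H b; rewrite /trunc; case: ifP => _ //; rewrite normr0 mulr0.
exact: sbound_ge0 H.
Qed.

(** On sequences supported in the box the truncated equation is a finite linear system; its matrix
    is obtained by applying [heatop] to the unit sequences. *)
Lemma galerkin_exists K a : supported K a -> exists u : R -> multi_index d -> R,
  [/\ u 0 = a, forall t, supported K (u t) &
  forall (t : R) b, is_derive t 1 (fun s => u s b) (trunc K (heatop (u t)) b)].
Proof.
move=> aK; pose I := {ffun 'I_d -> 'I_K}.
pose emb (g : I) : multi_index d := [ffun j => val (g j)].
have embI : injective emb.
  by move=> g h /ffunP gh; apply/ffunP => j; apply/val_inj; have := gh j; rewrite !ffunE.
have embP b : b \in box d K -> exists g, b = emb g.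
  by move=> /mapP[g _ ->]; exists g.
have embK g : emb g \in box d K by apply/mapP; exists g; rewrite ?mem_enum.
pose dl c b : R := (c == b)%:R.
have [y [y0 Dy]] := linear_ode (fun g h => heatop (dl (emb h)) (emb g)) (a \o emb).
pose u t b := \sum_(g : I) y t g * dl (emb g) b.
have uE t g : u t (emb g) = y t g.
  rewrite /u (bigD1 g)//= /dl eqxx mulr1 big1 ?addr0// => h hg.
  by rewrite (inj_eq embI) (negbTE hg) mulr0.
have u0 t b : b \notin box d K -> u t b = 0.
  move=> bK; rewrite /u big1// => g _; rewrite /dl.
  by case: eqP => [gb|]; rewrite ?mulr0//; move: bK; rewrite -gb embK.
exists u; split.
- apply/funext => b; case bK: (b \in box d K).
    by have [g ->] := embP _ bK; rewrite uE y0.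
  by rewrite u0 ?bK// aK ?bK.
- by move=> t b; exact: u0.
- move=> t b; rewrite /trunc; case: ifP => bK; last first.
    have -> : (fun s => u s b) = cst 0 by apply/funext => s; rewrite u0 ?bK.
    exact: is_derive_cst.
  have [g ->] := embP _ bK.
  have -> : (fun s => u s (emb g)) = (fun s => y s g) by apply/funext => s; rewrite uE.
  apply: is_derive_eq (Dy t g) _.
  rewrite [RHS](heatop_sum _ (y t) (fun g => dl (emb g))).
  by apply: eq_bigr => h _; rewrite mulrC.
Qed.

(** Twice the constant of [heatop_energy], plus 1 from splitting the product with the residual:
    [2 x z <= x^2 + z^2]. *)
Definition grow n : R := 3 / 4 * d%:R * 25 ^+ n + 1.

(** Gronwall's inequality for the energy. The residual [r] allows one statement to serve three uses:
    bounds on the truncated flows, their comparison, and stability under perturbation of the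
    equation. *)
Lemma galerkin_energy n K (T : R) (a r : R -> multi_index d -> R) (rho : R) :
  0 <= T -> 0 <= rho -> (forall t, supported K (a t)) ->
  (forall t b, 0 < t < T -> b \in box d K ->
     is_derive t 1 (fun s => a s b) (heatop (a t) b + r t b)) ->
  (forall b, {within `[0, T], continuous (fun s => a s b)}) ->
  (forall t, 0 < t < T -> Ener n K (r t) <= rho) ->
  forall t, 0 <= t <= T -> Ener n K (a t) <= expR (grow n * T) * (Ener n K (a 0) + rho * T).
Proof.
move=> T0 rho0 aK Da ca Hr t /andP[t0 tT].
have g0 : 0 <= grow n by rewrite /grow addr_ge0// !mulr_ge0 ?exprn_ge0 ?invr_ge0.
pose V s := Ener n K (a s).
pose V' s := \sum_(b <- box d K) 2 * lam b ^+ (2 * n) * a s b * (heatop (a s) b + r s b).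
have DV s : 0 < s < T -> is_derive s 1 V (V' s).
  move=> sT; rewrite /V /V' /Ener.
  have : {subset box d K <= box d K} by [].
  elim: {1 3 4}(box d K) => [|b l IH] sub.
    under eq_fun do rewrite big_nil; rewrite big_nil; exact: is_derive_cst.
  under eq_fun do rewrite big_cons; rewrite big_cons.
  have D1 := Da s b sT (sub b (mem_head b l)).
  have {}IH := IH (fun c cl => sub c (mem_behead (s := b :: l) cl)).
  apply: is_derive_eq; rewrite /GRing.scale /= mulnC exprM; ring.
have V'le s : 0 < s < T -> V' s <= grow n * V s + rho.
  move=> sT; apply: (@le_trans _ _ (2 * (3 / 8 * d%:R * 25 ^+ n * Ener n K (a s)) +
      (Ener n K (a s) + Ener n K (r s)))); last first.
    have -> : grow n * V s = 2 * (3 / 8 * d%:R * 25 ^+ n * Ener n K (a s)) + Ener n K (a s).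
      by rewrite /grow /V; field.
    by rewrite -addrA lerD2l lerD2l; exact: Hr.
  apply: le_trans (lerD (ler_wpM2l (ler0n _ 2) (heatop_energy d_gt0 n (aK s))) (lexx _)).
  rewrite mulr_sumr /Ener -!big_split /=; apply: ler_sum => b _.
  have -> : lam b ^+ (2 * n) = lam b ^+ n * lam b ^+ n by rewrite mul2n -addnn exprD.
  move: (lam b ^+ n) (a s b) (heatop (a s) b) (r s b) => l x y z.
  have := sqr_ge0 (l * x - l * z); lra.
(* The integrating factor is at most 1, so subtracting [rho * s] absorbs the residual and makes [W]
   nonincreasing. *)
pose W s := expR (- (grow n * s)) * V s - rho * s.
have DW s : 0 < s < T -> is_derive s 1 W
    (expR (- (grow n * s)) * (V' s - grow n * V s) - rho).
  move=> sT; have D1 := DV s sT.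
  by apply: is_derive_eq; rewrite /GRing.scale /=; ring.
have cW : {within `[0, T], continuous W}.
  have cV : {within `[0, T], continuous V}.
    by apply: continuous_sum => b; exact: continuous_scale_sqr (ca b).
  have cE (k : R) : {within `[0, T], continuous (fun s : R => expR (- (k * s)))}.
    apply: continuous_subspaceT => z; apply: cvg_comp; last exact: continuous_expR.
    by apply: cvgN; apply: cvgM; [exact: cvg_cst|exact: cvg_id].
  have cl : {within `[0, T], continuous (fun s : R => rho * s)}.
    by apply: continuous_subspaceT => z; apply: cvgM; [exact: cvg_cst|exact: cvg_id].
  by move=> z; apply: cvgB; [apply: cvgM; [exact: cE|exact: cV]|exact: cl].
have W0 : W t <= W 0.
  apply: (derive_le0_left _ DW _ cW); first by rewrite t0 tT.
  move=> s sT.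
  have e1 : expR (- (grow n * s)) <= 1.
    by rewrite -expR0 ler_expR oppr_le0 mulr_ge0//; case/andP: sT => /ltW.
  rewrite subr_le0; apply: (@le_trans _ _ (expR (- (grow n * s)) * rho)).
    by rewrite ler_wpM2l ?expR_ge0// lerBlDl V'le.
  by rewrite ler_piMl.
move: W0; rewrite /W mulr0 oppr0 expR0 mul1r mulr0 subr0 lerBlDr => W0.
have Vt : V t <= expR (grow n * t) * (V 0 + rho * t).
  by rewrite -ler_pdivrMl ?expR_gt0// -expRN.
apply: (le_trans Vt); apply: ler_pM.
- exact: expR_ge0.
- by rewrite addr_ge0 ?mulr_ge0//; exact: Ener_ge0.
- by rewrite ler_expR ler_wpM2l.
- by rewrite lerD2l ler_wpM2l.
Qed.

(** The [d] extra powers of the weight, once squared, are those that [sum_box_weight] makes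
    summable. *)
Lemma Ener_le_sbound n K M a : sbound (n + d) M a -> Ener n K a <= 2 ^+ d * M ^+ 2.
Proof.
move=> H; have M0 := sbound_ge0 H.
apply: (@le_trans _ _ (\sum_(b <- box d K) M ^+ 2 * (lam b ^+ (2 * d))^-1)).
  apply: ler_sum => b _; rewrite ler_pdivlMr ?exprn_gt0 ?weight_gt0//.
  rewrite mulnC exprM -exprMn -real_normK ?num_real// lerXn2r ?nnegrE//.
  rewrite !normrM !(ger0_norm (exprn_ge0 _ (weight_ge0 b))) mulrAC -exprD; exact: H.
by rewrite -mulr_sumr mulrC ler_wpM2r ?sqr_ge0// sum_box_weight.
Qed.

Lemma Ener_ge n K (X : R) a b : 0 <= X -> Ener n K a <= X ^+ 2 -> b \in box d K ->
  lam b ^+ n * `|a b| <= X.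
Proof.
move=> X0 H bK; have l0 : 0 <= lam b ^+ n by rewrite exprn_ge0 ?weight_ge0.
rewrite -(ler_pXn2r (n := 2))// ?nnegrE ?mulr_ge0//.
apply: le_trans H; rewrite -{1}(ger0_norm l0) -normrM real_normK ?num_real//.
rewrite /Ener (bigD1_seq b) ?box_uniq//= lerDl.
by apply: sumr_ge0 => c _; exact: sqr_ge0.
Qed.

End galerkin.

(** * The heat flow on rapidly decreasing coefficients *)

Section heat_flow.
Context {R : realType} (d : nat).
Hypothesis d_gt0 : (0 < d)%N.
Variable T : R.
Hypothesis T_gt0 : 0 < T.
Implicit Types (a u v : multi_index d -> R) (b : multi_index d) (i : 'I_d) (K n : nat).
Local Notation lam := (@hermite_weight R d).

(** The square root turns a bound on the quadratic energy into one linear in the datum; the constant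
    involves neither the datum nor the truncation. *)
Definition flow_const n : R := Num.sqrt (expR (grow d n * T) * 2 ^+ d).

Lemma galerkin_sbound n K M a (u : R -> multi_index d -> R) : sbound (n + d) M a ->
  u 0 = trunc K a -> (forall t : R, supported K (u t)) ->
  (forall (t : R) b, is_derive t 1 (fun s => u s b) (trunc K (heatop (u t)) b)) ->
  forall t : R, 0 <= t <= T -> sbound n (flow_const n * M) (u t).
Proof.
move=> H u0 uK Du t tT b; have M0 := sbound_ge0 H.
have C0 : 0 <= flow_const n * M by rewrite mulr_ge0 ?sqrtr_ge0.
have [bK|bK] := boolP (b \in box d K); last by rewrite (uK t b bK) normr0 mulr0.
apply: (@Ener_ge _ _ n K) => //.
apply: le_trans (galerkin_energy d_gt0 (rho := 0) (r := fun _ _ => 0) (ltW T_gt0) _ uK _ _ _ tT) _ => //.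
- move=> s c _ cK; apply: is_derive_eq (Du s c) _.
  by rewrite /trunc cK addr0.
- move=> c; apply: continuous_subspaceT => s; exact: is_derive_continuous (Du s c).
- by move=> s _; rewrite /Ener big1// => c _; rewrite mulr0 expr0n.
rewrite mul0r addr0 exprMn sqr_sqrtr ?mulr_ge0 ?expR_ge0 ?exprn_ge0//.
rewrite -mulrA ler_wpM2l ?expR_ge0// u0; apply: Ener_le_sbound => //.
exact: trunc_sbound.
Qed.

(** Outside [box d K] one power of the weight is worth at least [K + 1]. *)
Lemma outer_energy K K' M (f : multi_index d -> R) : sbound d.+1 M f ->
  (forall b, b \in box d K -> f b = 0) -> Ener 0 K' f <= 2 ^+ d * (M / K.+1%:R) ^+ 2.
Proof.
move=> H f0; apply: Ener_le_sbound => // b; have M0 := sbound_ge0 H.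
have [bK|bK] := boolP (b \in box d K); first by rewrite f0// normr0 mulr0 divr_ge0.
rewrite ler_pdivlMr//; apply: le_trans (H b).
rewrite add0n exprSr mulrAC ler_wpM2r// ler_wpM2l ?exprn_ge0 ?weight_ge0//.
exact: notin_box_weight.
Qed.

(** The difference of two truncated flows solves the larger system with a residual and an initial
    value living outside the smaller box, both [O(1 / K)] by [outer_energy]. The unweighted energy
    is enough, since only convergence of each coefficient is wanted; weighted bounds pass to the
    limit. *)
Lemma galerkin_cauchy a (u : nat -> R -> multi_index d -> R) : rapid a ->
  (forall K, u K 0 = trunc K a) -> (forall K (t : R), supported K (u K t)) ->
  (forall K (t : R) b, is_derive t 1 (fun s => u K s b) (trunc K (heatop (u K t)) b)) ->
  exists Z : R, forall K K' (t : R) b, (K <= K')%N -> 0 <= t <= T ->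
    `|u K' t b - u K t b| <= Z / K.+1%:R.
Proof.
move=> Ra u0 uK Du.
have [M0 H0] := Ra d.+1; have [M H] := Ra (d.+3 + d)%N.
pose Q := heat_const d d.+1 * (flow_const d.+3 * M).
have HQ K t : 0 <= t <= T -> sbound d.+1 Q (heatop (u K t)).
  move=> tT; apply: heatop_sbound => //.
  exact: galerkin_sbound H (u0 K) (uK K) (Du K) t tT.
have Q0 : 0 <= Q by apply: sbound_ge0 (HQ 0%N 0 _); rewrite lexx ltW.
have M00 := sbound_ge0 H0.
pose Y := expR (grow d 0 * T) * (2 ^+ d * M0 ^+ 2 + 2 ^+ d * Q ^+ 2 * T).
have Y0 : 0 <= Y.
  apply: mulr_ge0; first exact: expR_ge0.
  have q0 (x : R) : 0 <= 2 ^+ d * x ^+ 2 by rewrite mulr_ge0 ?sqr_ge0// exprn_ge0.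
  by apply: addr_ge0 => //; apply: mulr_ge0 => //; exact: ltW.
exists (Num.sqrt Y) => K K' t b KK tT.
have Z0 : 0 <= Num.sqrt Y / K.+1%:R by rewrite divr_ge0 ?sqrtr_ge0.
pose e s b := u K' s b - u K s b.
have eK s : supported K' (e s).
  move=> c cK; rewrite /e uK// uK ?subr0//; apply: contra cK; exact: box_sub.
have [bK|bK] := boolP (b \in box d K'); last first.
  by rewrite -/(e t b) eK// normr0.
(* The part of the equation that the smaller truncation cuts off. *)
pose r s b := if b \in box d K then 0 else heatop (u K s) b.
have rQ s : 0 <= s <= T -> sbound d.+1 Q (r s).
  by move=> sT c; rewrite /r; case: ifP => _; [rewrite normr0 mulr0|exact: HQ].
suff H1 : Ener 0 K' (e t) <= (Num.sqrt Y / K.+1%:R) ^+ 2.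
  by have := Ener_ge Z0 H1 bK; rewrite mul1r.
have rho0 : 0 <= 2 ^+ d * (Q / K.+1%:R) ^+ 2 by rewrite mulr_ge0 ?sqr_ge0// exprn_ge0.
apply: le_trans (galerkin_energy d_gt0 (r := r) (ltW T_gt0) rho0 eK _ _ _ tT) _.
- move=> s c sT cK'; have D1 := Du K' s c; have D2 := Du K s c.
  apply: is_derive_eq; rewrite /e heatopB /trunc /r cK'.
  by case: ifP => _; rewrite ?addr0 ?subrK ?subr0//.
- move=> c; apply: continuous_subspaceT => s.
  exact: (cvgB (is_derive_continuous (Du K' s c)) (is_derive_continuous (Du K s c))).
- move=> s /andP[s0 sT]; apply: (outer_energy (K := K)); first by apply: rQ; rewrite !ltW.
  by move=> c cK; rewrite /r cK.
rewrite [leRHS]exprMn sqr_sqrtr// /Y -[leRHS]mulrA ler_wpM2l ?expR_ge0// [leRHS]mulrDl lerD//.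
  rewrite -[leRHS]mulrA -exprMn; apply: outer_energy.
    move=> c; rewrite /e !u0 /trunc; apply: le_trans (H0 c).
    rewrite ler_wpM2l ?exprn_ge0 ?weight_ge0//.
    by case: ifP => _; case: ifP => _; rewrite ?subrr ?subr0 ?sub0r ?normrN ?normr0.
  by move=> c cK; rewrite /e !u0 /trunc cK (box_sub KK cK) subrr.
by rewrite le_eqVlt; apply/orP; left; apply/eqP; ring.
Qed.

(* The quadratic remainder expresses differentiability uniformly in every
   weighted norm, also at the end points of the time interval. *)
Theorem heat_flow a : rapid a -> exists u : R -> multi_index d -> R,
  [/\ u 0 = a,
      forall n (M : R), sbound (n + d) M a -> forall t : R, 0 <= t <= T ->
        sbound n (flow_const n * M) (u t) &
      forall n, exists C : R, forall s t : R, 0 <= s <= T -> 0 <= t <= T ->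
        sbound n (C * (s - t) ^+ 2) (fun b => u s b - u t b - (s - t) * heatop (u t) b)].
Proof.
move=> Ra.
have /choice[g Hg] K := galerkin_exists (@supported_trunc _ _ K a).
have g0 K : g K 0 = trunc K a by case: (Hg K).
have gK K : forall t : R, supported K (g K t) by case: (Hg K).
have Dg K : forall (t : R) b, is_derive t 1 (fun s => g K s b) (trunc K (heatop (g K t)) b).
  by case: (Hg K).
have [Z HZ] := galerkin_cauchy Ra g0 gK Dg.
pose u t b := limn (fun K => g K t b).
have Cu t b : 0 <= t <= T -> g K t b @[K --> \oo] --> u t b.
  move=> tT; apply/cauchy_cvgP; apply/cauchy_exP => e e0.
  have : Z * harmonic K @[K --> \oo] --> (0 : R).
    rewrite -[X in _ --> X](mulr0 Z).
    by apply: cvgM; [exact: cvg_cst|exact: cvg_harmonic].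
  move=> /cvgrPdist_lt /(_ e e0) [K _ /(_ K (leqnn K))] /=.
  rewrite sub0r normrN => HK; exists (g K t b); exists K => // K' /= KK.
  rewrite /ball /= distrC; apply: le_lt_trans (HZ K K' t b KK tT) _.
  exact: le_lt_trans (ler_norm _) HK.
have Cb n M (f : nat -> multi_index d -> R) v : (forall K, sbound n M (f K)) ->
    (forall b, f K b @[K --> \oo] --> v b) -> sbound n M v.
  move=> Hf Cf b.
  have HC : lam b ^+ n * `|f K b| @[K --> \oo] --> lam b ^+ n * `|v b|.
    by apply: cvgM; [exact: cvg_cst|exact: cvg_norm (Cf b)].
  by apply: (cvgr_to_le HC); apply: nearW => K; exact: Hf.
exists u; split.
- apply/funext => b; apply/cvg_lim => //; apply: cvg_near_cst.
  by apply: filterS (box_near b) => K bK; rewrite g0 /trunc bK.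
- move=> n M H t tT; apply: (Cb _ _ (fun K => g K t)) => [K|b]; last exact: Cu.
  exact: galerkin_sbound H (g0 K) (gK K) (Dg K) t tT.
(* The second time derivative involves two heat operators, of two powers each, and the bound on the
   flow costs [d] more. The Taylor estimate is uniform in [K], so it survives the limit. *)
- move=> n; have [M H] := Ra (n.+4 + d)%N.
  pose C := heat_const d n * (heat_const d n.+2 * (flow_const n.+4 * M)).
  exists C => s t sT tT.
  apply: (Cb _ _ (fun K b => g K s b - g K t b - (s - t) * trunc K (heatop (g K t)) b)).
    move=> K b.
    have DD (x : R) : is_derive x 1 (fun y => trunc K (heatop (g K y)) b)
        (trunc K (heatop (trunc K (heatop (g K x)))) b).
      rewrite /trunc; case: ifP => _; last exact: is_derive_cst.
      by apply: is_derive_heatop => c; exact: Dg.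
    have HM z : 0 <= z <= T ->
        lam b ^+ n * `|trunc K (heatop (trunc K (heatop (g K z)))) b| <= C.
      move=> zT; apply: trunc_sbound => //; apply: heatop_sbound => //.
      apply: trunc_sbound => //; apply: heatop_sbound => //.
      exact: galerkin_sbound H (g0 K) (gK K) (Dg K) z zT.
    have l0 : 0 < lam b ^+ n by rewrite exprn_gt0// weight_gt0.
    rewrite -ler_pdivlMl//.
    have -> : (lam b ^+ n)^-1 * (C * (s - t) ^+ 2) = C / lam b ^+ n * (s - t) ^+ 2 by ring.
    apply: (@taylor2 R (fun y => g K y b) (fun y => trunc K (heatop (g K y)) b)
      (fun z => trunc K (heatop (trunc K (heatop (g K z)))) b) t s _
      (fun x => Dg K x b) DD) => z /andP[z1 z2].
    rewrite ler_pdivlMr// mulrC; apply: HM.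
    move: sT tT => /andP[s0 sT] /andP[t0 tT].
    apply/andP; split.
      by apply: le_trans z1; rewrite le_min t0 s0.
    by apply: (le_trans z2); rewrite ge_max tT sT.
  move=> b; apply: cvgB; first by apply: cvgB; exact: Cu.
  apply: cvgM; first exact: cvg_cst.
  apply: (@cvg_trans _ (heatop (g K t) b @[K --> \oo])).
    apply: near_eq_cvg; apply: filterS (box_near b) => K bK.
    by rewrite /trunc bK.
  by apply: cvg_heatop => c; exact: Cu.
Qed.

End heat_flow.

(** * Norms and coefficients *)

Section norms.
Context {R : realType} (d : nat).
Hypothesis d_gt0 : (0 < d)%N.
Implicit Types (a c : multi_index d -> R) (b : multi_index d) (S : set (multi_index d -> R)).
Local Notation lam := (@hermite_weight R d).

Lemma sbound_esum n (X : R) a : 0 <= X ->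
  (\esum_(b in [set: multi_index d]) (lam b ^+ (2 * n) * a b ^+ 2)%:E <= (X ^+ 2)%:E)%E ->
  sbound n X a.
Proof.
move=> X0 H b; have t0 (c : multi_index d) : (0 <= (lam c ^+ (2 * n) * a c ^+ 2)%:E)%E.
  by rewrite lee_fin mulr_ge0 ?sqr_ge0// exprn_ge0// weight_ge0.
have Hb : ((lam b ^+ (2 * n) * a b ^+ 2)%:E <= (X ^+ 2)%:E)%E.
  apply: le_trans H; rewrite -(esum_set1 (t := b) (a := fun b => (lam b ^+ (2 * n) * a b ^+ 2)%:E))//.
  apply: esum_ge; exists [set b] => //.
  by rewrite esum_set1// fsbig_set1.
move: Hb; rewrite lee_fin mulnC exprM -exprMn -real_normK ?num_real//.
rewrite normrM ger0_norm ?exprn_ge0 ?weight_ge0// => Hb.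
by rewrite -(ler_pXn2r (n := 2))// ?nnegrE ?mulr_ge0 ?exprn_ge0 ?weight_ge0.
Qed.

Lemma le_sum_uniq_box (s : seq (multi_index d)) K (G : multi_index d -> R) :
  (forall b, 0 <= G b) -> uniq s -> {subset s <= box d K} ->
  \sum_(b <- s) G b <= \sum_(b <- box d K) G b.
Proof.
move=> G0 us sK; rewrite [leRHS](bigID (fun b => b \in s)) /= -[leLHS]addr0 lerD//.
  rewrite le_eqVlt; apply/orP; left; apply/eqP.
  rewrite -[RHS]big_filter; apply: perm_big; apply: uniq_perm => //.
    by rewrite filter_uniq// box_uniq.
  by move=> b; rewrite mem_filter; case bs: (b \in s) => //=; rewrite sK.
by apply: sumr_ge0.
Qed.

Lemma esum_sbound n (M : R) a : sbound (n + d) M a ->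
  (\esum_(b in [set: multi_index d]) (lam b ^+ (2 * n) * a b ^+ 2)%:E <= (2 ^+ d * M ^+ 2)%:E)%E.
Proof.
move=> H; apply: ub_ereal_sup => _ [F [Ffin _] <-].
have [K HK] : exists K, forall b, F b -> b \in box d K.
  have /finite_seqP[s sF] := Ffin.
  exists (\sum_(b <- s) (\sum_j b j).+1)%N => b; rewrite sF /= => bs.
  rewrite mem_box; apply/forallP => j.
  rewrite (big_rem b)//=; apply: (@leq_trans (\sum_j b j).+1); last exact: leq_addr.
  by rewrite ltnS (bigD1 j)//= leq_addr.
rewrite fsbig_finite//= sumEFin lee_fin.
apply: le_trans (Ener_le_sbound d_gt0 (n := n) K H); rewrite /Ener.
have E b : lam b ^+ (2 * n) * a b ^+ 2 = (lam b ^+ n * a b) ^+ 2.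
  by rewrite mulnC exprM exprMn.
under eq_bigr do rewrite E.
apply: le_sum_uniq_box; [by move=> b; exact: sqr_ge0|exact: finmap.fset_uniq|move=> b bF].
by apply: HK; move: bF; rewrite in_fset_set// inE.
Qed.

Lemma hermite_norm_ge0 n (phi : 'rV[R]_d -> R) : (0 <= hermite_norm n phi)%E.
Proof. exact: sqrte_ge0. Qed.

Lemma hermite_norm_sbound n (M : R) (phi : 'rV[R]_d -> R) :
  (hermite_norm n phi <= M%:E)%E -> sbound n M (hermite_coef phi).
Proof.
move=> H; have M0 : 0 <= M by rewrite -lee_fin (le_trans (hermite_norm_ge0 n phi)).
apply: sbound_esum => //; move: H; rewrite /hermite_norm.
have : (0 <= \esum_(b in [set: multi_index d])
    (hermite_weight R b ^+ (2 * n) * hermite_coef phi b ^+ 2)%:E)%E.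
  by apply: esum_ge0 => c _; rewrite lee_fin mulr_ge0 ?sqr_ge0// exprn_ge0// weight_ge0.
case: (\esum_(b in _) _)%E => [r| |] //=.
rewrite !lee_fin => r0 H; rewrite -(sqr_sqrtr r0) lerXn2r ?nnegrE ?sqrtr_ge0//.
Qed.

Lemma sbound_hermite_norm n (M : R) (phi : 'rV[R]_d -> R) :
  sbound (n + d) M (hermite_coef phi) -> (hermite_norm n phi <= (2 ^+ d * M)%:E)%E.
Proof.
move=> H; have M0 := sbound_ge0 H; have := esum_sbound H; rewrite /hermite_norm.
have : (0 <= \esum_(b in [set: multi_index d])
    (hermite_weight R b ^+ (2 * n) * hermite_coef phi b ^+ 2)%:E)%E.
  by apply: esum_ge0 => c _; rewrite lee_fin mulr_ge0 ?sqr_ge0// exprn_ge0// weight_ge0.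
case: (\esum_(b in _) _)%E => [r| |] //=.
rewrite !lee_fin => r0 H2; rewrite -[leRHS]ger0_norm ?mulr_ge0 ?exprn_ge0//.
rewrite -sqrtr_sqr ler_wsqrtr// (le_trans H2)// exprMn ler_wpM2r ?sqr_ge0//.
by rewrite expr2 ler_peMl ?exprn_ge0// exprn_ege1// ler1n.
Qed.

Lemma rapid_seqP a : rapid_seq a <-> rapid a.
Proof.
split=> [H n|H n].
  have := H n; have : (0 <= \esum_(b in [set: multi_index d])
      (lam b ^+ (2 * n) * `|a b| ^+ 2)%:E)%E.
    by apply: esum_ge0 => c _; rewrite lee_fin mulr_ge0 ?sqr_ge0// exprn_ge0// weight_ge0.
  have E : (\esum_(b in [set: multi_index d]) (lam b ^+ (2 * n) * `|a b| ^+ 2)%:E =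
      \esum_(b in [set: multi_index d]) (lam b ^+ (2 * n) * a b ^+ 2)%:E)%E.
    by apply: eq_esum => b _; rewrite real_normK ?num_real.
  rewrite E; case Es: (\esum_(b in _) _)%E => [r| |] //= r0 _.
  exists (Num.sqrt r); apply: sbound_esum; first exact: sqrtr_ge0.
  by rewrite Es lee_fin sqr_sqrtr.
have [M HM] := H (n + d)%N.
apply: (@le_lt_trans _ _ (2 ^+ d * M ^+ 2)%:E); last exact: ltry.
apply: le_trans (esum_sbound HM); apply: le_esum => b _.
by rewrite real_normK ?num_real.
Qed.

(* What the arguments below use of the spaces [s_d] and [s_d']. *)
Record seq_ideal S : Prop := SeqIdeal {
  ideal_dom : forall a c (C : R), S a -> (forall b, `|c b| <= C * `|a b|) -> S c;
  ideal_add : forall a c, S a -> S c -> S (fun b => a b + c b);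
  ideal0 : S (fun=> 0) }.

Lemma rapid_ideal : seq_ideal (@rapid_seq R d).
Proof.
split.
- move=> a c C /rapid_seqP Ra ac; apply/rapid_seqP => n; have [M H] := Ra n.
  exists (`|C| * M) => b; apply: (@le_trans _ _ (`|C| * (lam b ^+ n * `|a b|))).
    rewrite mulrCA ler_wpM2l ?exprn_ge0 ?weight_ge0//.
    by rewrite (le_trans (ac b))// ler_wpM2r// ler_norm.
  by rewrite ler_wpM2l.
- move=> a c /rapid_seqP Ra /rapid_seqP Rc; apply/rapid_seqP => n.
  have [M HM] := Ra n; have [N HN] := Rc n.
  by exists (M + N); exact: sboundD.
- by apply/rapid_seqP => n; exists 0 => b; rewrite normr0 mulr0.
Qed.

Lemma tempered_ideal : seq_ideal (@tempered_seq R d).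
Proof.
split.
- move=> a c C [M [m H]] ac; exists (`|C| * M), m => b.
  rewrite (le_trans (ac b))// -mulrA (le_trans (ler_wpM2r _ (ler_norm C)))//.
  by rewrite ler_wpM2l.
- move=> a c [M [m HM]] [N [k HN]]; exists (`|M| + `|N|), (m + k)%N => b.
  have l1 := weight_ge1 (R := R) d_gt0 b; have l0 := weight_ge0 (R := R) b.
  rewrite (le_trans (ler_normD _ _))// mulrDl lerD//.
    apply: (le_trans (HM b)); apply: (le_trans (ler_wpM2r (exprn_ge0 _ l0) (ler_norm M))).
    by rewrite ler_wpM2l//; apply: ler_weXn2l; rewrite ?leq_addr.
  apply: (le_trans (HN b)); apply: (le_trans (ler_wpM2r (exprn_ge0 _ l0) (ler_norm N))).
  by rewrite ler_wpM2l//; apply: ler_weXn2l; rewrite ?leq_addl.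
- by exists 0, 0%N => b; rewrite normr0 mul0r.
Qed.

Lemma rapid_tempered a : rapid_seq a -> tempered_seq a.
Proof.
move=> /rapid_seqP Ra; have [M H] := Ra 0%N; exists M, 0%N => b.
by have := H b; rewrite expr0 mul1r mulr1.
Qed.

(** Since [S] is closed under domination, any majorant in [S] is enough, and it also makes the
    extended reals finite. *)
Lemma in_seq_spaceP S (X : multi_index d -> \bar R) : seq_ideal S ->
  (forall b, (0 <= X b)%E) ->
  in_seq_space S X <-> exists2 M, S M & forall b, (X b <= (M b)%:E)%E.
Proof.
move=> IS X0; split=> [[a Sa ->]|[M SM XM]]; first by exists a.
have E b : X b = (fine (X b))%:E.
  rewrite fineK// ge0_fin_numE//; exact: le_lt_trans (XM b) (ltry _).
exists (fine \o X); last by apply/funext => b; rewrite /= -E.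
apply: (ideal_dom IS (C := 1)) SM _ => b.
have := XM b; rewrite mul1r E lee_fin => XMb; rewrite /= ger0_norm ?fine_ge0//.
by rewrite (le_trans XMb)// ler_norm.
Qed.

Variable T : R.
Hypothesis T_gt0 : 0 < T.
Local Notation tfun := (R -> 'rV[R]_d -> R).

Definition tbound n (M : R) (f : tfun) :=
  forall t : R, 0 <= t <= T -> sbound n M (hermite_coef (f t)).

Lemma sup_norm_ge0 n (f : tfun) : (0 <= sup_norm T n f)%E.
Proof.
apply: le_trans (hermite_norm_ge0 n (f 0)) _; apply: ereal_sup_ubound.
by exists 0 => //=; rewrite in_itv /= lexx ltW.
Qed.

Lemma sup_norm_tbound n (M : R) (f : tfun) : (sup_norm T n f <= M%:E)%E -> tbound n M f.
Proof.
move=> H t tT; apply: hermite_norm_sbound; apply: le_trans H.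
by apply: ereal_sup_ubound; exists t => //=; rewrite in_itv.
Qed.

Lemma tbound_sup_norm n (M : R) (f : tfun) : tbound (n + d) M f ->
  (sup_norm T n f <= (2 ^+ d * M)%:E)%E.
Proof.
move=> H; apply: ub_ereal_sup => _ [t /= tT <-]; apply: sbound_hermite_norm.
by apply: H; move: tT; rewrite in_itv.
Qed.

(** All weighted bounds hold uniformly in the parameter, with constants forming a sequence of [S] in
    the family index. The parameter is a time in [D], or a dummy of type [unit] for families without
    time. *)
Definition bounded_in S (I : Type) (A : multi_index d -> I -> multi_index d -> R) (D : set I) :=
  forall n, exists2 M, S M & forall b t, D t -> sbound n (M b) (A b t).

Lemma sup_norm_bounded_in S (f : multi_index d -> tfun) : seq_ideal S ->
  (forall n, in_seq_space S (fun b => sup_norm T n (f b))) <->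
  bounded_in S (fun b t => hermite_coef (f b t)) [set t | 0 <= t <= T].
Proof.
move=> IS; split=> H n.
  have /(in_seq_spaceP IS (fun b => sup_norm_ge0 n (f b))) [M SM HM] := H n.
  by exists M => // b t tT; exact: (sup_norm_tbound (HM b)).
have [M SM HM] := H (n + d)%N.
apply/(in_seq_spaceP IS (fun b => sup_norm_ge0 n (f b))); exists (fun b => 2 ^+ d * M b).
  apply: (ideal_dom IS (C := 2 ^+ d) SM) => b.
  by rewrite normrM ger0_norm ?exprn_ge0.
by move=> b; apply: tbound_sup_norm => t; exact: HM.
Qed.

Lemma hermite_norm_bounded_in S (f : multi_index d -> 'rV[R]_d -> R) : seq_ideal S ->
  (forall n, in_seq_space S (fun b => hermite_norm n (f b))) <->
  bounded_in S (fun b (_ : unit) => hermite_coef (f b)) setT.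
Proof.
move=> IS; split=> H n.
  have /(in_seq_spaceP IS (fun b => hermite_norm_ge0 n (f b))) [M SM HM] := H n.
  by exists M => // b t _; exact: hermite_norm_sbound.
have [M SM HM] := H (n + d)%N.
apply/(in_seq_spaceP IS (fun b => hermite_norm_ge0 n (f b))); exists (fun b => 2 ^+ d * M b).
  apply: (ideal_dom IS (C := 2 ^+ d) SM) => b.
  by rewrite normrM ger0_norm ?exprn_ge0.
by move=> b; apply: sbound_hermite_norm; exact: (HM b tt).
Qed.

Lemma bounded_in_rapid S I (A : multi_index d -> I -> multi_index d -> R) (D : set I) b t :
  bounded_in S A D -> D t -> rapid (A b t).
Proof. by move=> H Dt n; have [M _ HM] := H n; exists (M b); exact: HM. Qed.

Lemma bounded_inD S I (A B : multi_index d -> I -> multi_index d -> R) (D : set I) :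
  seq_ideal S -> bounded_in S A D -> bounded_in S B D ->
  bounded_in S (fun b t (g : multi_index d) => A b t g + B b t g) D.
Proof.
move=> IS HA HB n; have [M SM HM] := HA n; have [N SN HN] := HB n.
exists (fun b => M b + N b); first exact: ideal_add.
by move=> b t Dt; apply: sboundD; [exact: HM|exact: HN].
Qed.

Lemma bounded_inZ S I r (A : multi_index d -> I -> multi_index d -> R) (D : set I) :
  seq_ideal S -> bounded_in S A D -> bounded_in S (fun b t (g : multi_index d) => r * A b t g) D.
Proof.
move=> IS HA n; have [M SM HM] := HA n.
exists (fun b => `|r| * M b).
  by apply: (ideal_dom IS (C := `|r|) SM) => b; rewrite normrM normr_id.
by move=> b t Dt; apply: sboundZ; exact: HM.
Qed.

Lemma bounded_in_heatop S I (A : multi_index d -> I -> multi_index d -> R) (D : set I) :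
  seq_ideal S -> bounded_in S A D -> bounded_in S (fun b t => heatop (A b t)) D.
Proof.
move=> IS HA n; have [M SM HM] := HA n.+2.
exists (fun b => heat_const d n * M b).
  apply: (ideal_dom IS (C := heat_const d n) SM) => b.
  by rewrite normrM ger0_norm ?heat_const_ge0.
by move=> b t Dt; apply: heatop_sbound => //; exact: HM.
Qed.

Lemma bounded_in_eq S I (A B : multi_index d -> I -> multi_index d -> R) (D : set I) :
  (forall b t, D t -> A b t = B b t) -> bounded_in S A D -> bounded_in S B D.
Proof.
move=> E HA n; have [M SM HM] := HA n.
by exists M => // b t Dt; rewrite -E//; exact: HM.
Qed.

End norms.

(** * Differentiability on the closed time interval *)

Section time_interval.
Context {R : realType} (T : R).
Hypothesis T_gt0 : 0 < T.

(** This gives uniqueness of the limit that defines [time_derivative]: the interval accumulates at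
    [t] from the right if [t < T] and from the left if [t = T]. *)
Lemma within_dnbhs_proper (t : R) : 0 <= t <= T -> ProperFilter (within `[0, T] t^').
Proof.
move=> /andP[t0 tT]; apply: Build_ProperFilter_ex => P [e /= e0 HP].
have e20 : 0 < e / 2 by rewrite divr_gt0.
have ltee : e / 2 < e by rewrite ltr_pdivrMr// ltr_pMr// ltr1n.
have [t2|t2] := ltP t T.
  pose s := Num.min (t + e / 2) T.
  have ts : t < s by rewrite lt_min t2 ltrDl andbT.
  exists s; apply: HP.
  - rewrite /ball_ /= distrC ger0_norm ?subr_ge0 ?ltW// ltrBlDl.
    by rewrite (@le_lt_trans _ _ (t + e / 2))// ?ltrD2l// ge_min lexx.
  - by rewrite gt_eqF.
  - by rewrite /= in_itv /= ge_min lexx orbT andbT (le_trans t0)// ltW.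
have {t2}tE : t = T by apply/le_anti; rewrite tT.
pose s := Num.max (t - e / 2) 0.
have st : s < t by rewrite gt_max ltrBlDr ltrDl e20 tE T_gt0.
exists s; apply: HP.
- rewrite /ball_ /= ger0_norm ?subr_ge0 ?ltW// ltrBlDr -ltrBlDl.
  by rewrite (@lt_le_trans _ _ (t - e / 2))// ?ltrD2l ?ltrN2// le_max lexx.
- by rewrite lt_eqF.
- by rewrite /= in_itv /= le_max lexx orbT /= (le_trans (ltW st)).
Qed.

(** Differentiability relative to [[0, T]] without division, hence meaningful at [s = t] too and
    one-sided at the end points; [quotient_cvgP] relates it to the difference quotient. *)
Definition diff_within (f : R -> R) (t l : R) := forall e : R, 0 < e ->
  exists2 r : R, 0 < r & forall s : R, 0 <= s <= T -> `|s - t| < r ->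
    `|f s - f t - (s - t) * l| <= e * `|s - t|.

Lemma quotient_cvgP (f : R -> R) (t l : R) :
  ((f s - f t) / (s - t) @[s --> within `[0, T] t^'] --> l) <-> diff_within f t l.
Proof.
split=> [/cvgrPdist_le H e e0|H].
  have [r /= r0 Hr] := H e e0; exists r => // s sT st.
  have [->|nst] := eqVneq s t; first by rewrite !subrr mul0r subrr normr0 mulr0.
  have st0 : s - t != 0 by rewrite subr_eq0.
  have := Hr s; rewrite /ball_ /= distrC in_itv /= => /(_ st nst sT) Hs.
  have -> : f s - f t - (s - t) * l = - ((l - (f s - f t) / (s - t)) * (s - t)).
    by field.
  by rewrite normrN normrM ler_wpM2r.
apply/cvgrPdist_le => e e0; have [r r0 Hr] := H e e0; exists r => //= s.
rewrite /ball_ /= distrC in_itv /= => st nst sT; have := Hr s sT st.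
have st0 : s - t != 0 by rewrite subr_eq0.
have -> : f s - f t - (s - t) * l = - ((l - (f s - f t) / (s - t)) * (s - t)).
  by field.
by rewrite normrN normrM ler_pM2r// normr_gt0.
Qed.

Lemma diff_within_cvg (f : R -> R) (t l : R) : diff_within f t l ->
  f s @[s --> within `[0, T] (nbhs t)] --> f t.
Proof.
move=> H; apply/cvgrPdist_le => e e0; have [r r0 Hr] := H 1 ltr01.
pose k := 1 + `|l|; have k0 : 0 < k by rewrite ltr_pwDl.
exists (Num.min r (e / k)) => /=; first by rewrite lt_min r0 divr_gt0.
move=> s; rewrite /ball_ /= distrC lt_min in_itv /= => /andP[sr se] sT.
have := Hr s sT sr; rewrite mul1r => Hs; rewrite distrC.
have -> : f s - f t = f s - f t - (s - t) * l + (s - t) * l by ring.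
rewrite (le_trans (ler_normD _ _))// (@le_trans _ _ (`|s - t| * k))//.
  by rewrite mulrDr mulr1 lerD// normrM.
by rewrite -ler_pdivlMr// ltW.
Qed.

Lemma diff_within_is_derive (f : R -> R) (t l : R) : 0 < t < T -> diff_within f t l ->
  is_derive t 1 f l.
Proof.
move=> /andP[t0 tT] H.
have L : (h^-1 *: (f (h *: (1 : R) + t) - f t)) @[h --> (0:R)^'] --> l.
  apply/cvgrPdist_le => e e0; have [r r0 Hr] := H e e0.
  exists (Num.min r (Num.min t (T - t))) => /=; first by rewrite !lt_min r0 t0 subr_gt0.
  move=> h; rewrite /ball_ /= sub0r normrN !lt_min => /andP[hr /andP[ht hT]] h0.
  have := Hr (h *: (1 : R) + t); rewrite addrK /GRing.scale /= mulr1 => Hh.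
  have {Hh} Hh := Hh _ hr.
  move: ht hT; rewrite !ltr_norml => /andP[h1 h2] /andP[h3 h4].
  have /Hh : 0 <= h + t <= T by apply/andP; split; lra.
  have -> : f (h + t) - f t - h * l = - ((l - h^-1 * (f (h + t) - f t)) * h) by field.
  by rewrite normrN normrM ler_pM2r// normr_gt0.
apply: DeriveDef; first by apply/cvg_ex; exists l.
exact: cvg_lim L.
Qed.

Lemma lipschitz_within (f : R -> R) (C : R) :
  (forall s t : R, 0 <= s <= T -> 0 <= t <= T -> `|f s - f t| <= C * `|s - t|) ->
  {within `[0, T], continuous f}.
Proof.
move=> H; apply/subspace_continuousP => t /=; rewrite in_itv /= => tT.
apply/cvgrPdist_le => e e0; pose k := 1 + `|C|; have k0 : 0 < k by rewrite ltr_pwDl.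
exists (e / k) => /=; first by rewrite divr_gt0.
move=> s; rewrite /ball_ /= in_itv /= => se sT.
apply: (le_trans (H _ _ tT sT)); apply: (@le_trans _ _ (k * `|t - s|)).
  by rewrite ler_wpM2r// (le_trans (ler_norm C))// lerDr.
by rewrite mulrC -ler_pdivlMr// ltW.
Qed.

Lemma diff_within_continuous (f df : R -> R) :
  (forall t : R, 0 <= t <= T -> diff_within f t (df t)) -> {within `[0, T], continuous f}.
Proof.
move=> H; apply/subspace_continuousP => t /=; rewrite in_itv /= => tT.
exact: diff_within_cvg (H t tT).
Qed.

Lemma lipschitz_of_derive (f df : R -> R) (M : R) :
  {within `[0, T], continuous f} ->
  (forall t : R, 0 < t < T -> is_derive t 1 f (df t)) ->
  (forall t : R, 0 < t < T -> `|df t| <= M) ->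
  forall s t : R, 0 <= s <= T -> 0 <= t <= T -> `|f s - f t| <= M * `|s - t|.
Proof.
move=> cf Hf HM.
have W (s t : R) : 0 <= s <= T -> 0 <= t <= T -> s <= t -> `|f t - f s| <= M * `|t - s|.
  move=> /andP[s0 sT] /andP[t0 tT] st; rewrite (ger0_norm (_ : 0 <= t - s)) ?subr_ge0//.
  apply: (mean_value_bound (df := df)) => //.
  - by move=> x /andP[x1 x2]; apply: Hf; rewrite (le_lt_trans s0)//= (lt_le_trans x2).
  - apply: continuous_subspaceW cf => x /=; rewrite !in_itv /= => /andP[x1 x2].
    by rewrite (le_trans s0)//= (le_trans x2).
  - by move=> x /andP[x1 x2]; apply: HM; rewrite (le_lt_trans s0)//= (lt_le_trans x2).
move=> s t sT tT; have [st|st] := leP s t; last exact: W (ltW st).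
by rewrite distrC (distrC s); exact: W.
Qed.

Lemma within_eq (f g : R -> R) : (forall t : R, 0 <= t <= T -> f t = g t) ->
  {within `[0, T], continuous f} -> {within `[0, T], continuous g}.
Proof.
move=> E; apply: subspace_eq_continuous => t; rewrite inE /= in_itv /=; exact: E.
Qed.

Lemma within_lin (f g : R -> R) (r : R) : {within `[0, T], continuous f} ->
  {within `[0, T], continuous g} -> {within `[0, T], continuous (fun t => f t + r * g t)}.
Proof.
move=> /subspace_continuousP cf /subspace_continuousP cg.
apply/subspace_continuousP => t tT; apply: cvgD; first exact: cf.
by apply: cvgM; [exact: cvg_cst|exact: cg].
Qed.

End time_interval.

Section schwartz_coefficients.
Context {R : realType} (d : nat).
Hypothesis d_gt0 : (0 < d)%N.
Implicit Types phi psi : 'rV[R]_d -> R.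

Lemma schwartz_continuous phi : schwartz phi -> continuous phi.
Proof. by move=> [/(_ [::])[]]. Qed.

Lemma schwartz_bounded phi : schwartz phi -> exists C : R, forall x, `|phi x| <= C.
Proof.
move=> [_ /(_ [::] 0%N)[C H]]; exists C => x.
by have := H x; rewrite expr0 mul1r.
Qed.

Lemma schwartz_eq_synth phi : schwartz phi -> rapid (hermite_coef phi) ->
  phi = synth (hermite_coef phi).
Proof.
move=> Sphi; have [C HC] := schwartz_bounded Sphi.
by move=> r; apply: synth_coef (schwartz_continuous Sphi) HC r.
Qed.

Lemma hermite_coefB phi psi (M N : R) b : continuous phi -> continuous psi ->
  (forall x, `|phi x| <= M) -> (forall x, `|psi x| <= N) ->
  hermite_coef (fun x => phi x - psi x) b = hermite_coef phi b - hermite_coef psi b.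
Proof.
move=> cphi cpsi HM HN; rewrite /hermite_coef /integral_rV -RintB.
- by apply: eq_Rintegral => t _; rewrite mulrBl.
- exact: (intg_mul_hermite b cphi HM).
- exact: (intg_mul_hermite b cpsi HN).
Qed.

Lemma hermite_coefZ r phi (M : R) b : continuous phi -> (forall x, `|phi x| <= M) ->
  hermite_coef (fun x => r * phi x) b = r * hermite_coef phi b.
Proof.
move=> cphi HM; rewrite /hermite_coef /integral_rV -RintZ.
- by apply: eq_Rintegral => t _; rewrite mulrA.
- exact: (intg_mul_hermite b cphi HM).
Qed.

End schwartz_coefficients.

Lemma continuous_sub {R : realType} (X : topologicalType) (f g : X -> R) :
  continuous f -> continuous g -> continuous (fun x => f x - g x).
Proof. by move=> cf cg x; apply: cvgB; [exact: cf|exact: cg]. Qed.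

Lemma continuous_scale_sub {R : realType} (X : topologicalType) (r : R) (f g : X -> R) :
  continuous f -> continuous g -> continuous (fun x => r * (f x - g x)).
Proof.
move=> cf cg x; apply: cvgM; first exact: cvg_cst.
by apply: cvgB; [exact: cf|exact: cg].
Qed.

(** * Time regularity of the Hermite coefficients *)

Section time_regularity.
Context {R : realType} (d : nat) (T : R).
Hypotheses (d_gt0 : (0 < d)%N) (T_gt0 : 0 < T).
Local Notation tfun := (R -> 'rV[R]_d -> R).
Local Notation lam := (@hermite_weight R d).

Lemma time_derivativeE (v : tfun) (t : R) x l : 0 <= t <= T ->
  diff_within T (v ^~ x) t l -> time_derivative T v t x = l.
Proof.
move=> tT H; have /quotient_cvgP L := H.
have PF := within_dnbhs_proper T_gt0 tT.
exact: (cvg_lim _ L).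
Qed.

Lemma S1_diff_within (v : tfun) (t : R) x : S1 T v -> 0 <= t <= T ->
  diff_within T (v ^~ x) t (time_derivative T v t x).
Proof. by move=> [_ /(_ x)[H _]] tT; apply/quotient_cvgP; exact: H. Qed.

Variables (v : tfun).
Hypotheses (S1v : S1 T v) (Sv' : forall t : R, 0 <= t <= T -> schwartz (time_derivative T v t)).
Hypothesis Bv' : forall n, exists M : R, tbound T n M (time_derivative T v).
Local Notation v' := (time_derivative T v).

(** [S1] speaks of time derivatives at each [x] separately; uniformity in [x] is recovered from the
    weighted bounds by summing the Hermite series. *)
Lemma time_derivative_bounded : exists M : R, forall (t : R) x, 0 <= t <= T -> `|v' t x| <= M.
Proof.
have [M HM] := Bv' (3 * d); exists (2 ^+ d * M * 2 ^+ d) => t x tT.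
have rv : rapid (hermite_coef (v' t)).
  by move=> n; have [N HN] := Bv' n; exists N; exact: HN.
rewrite {1}(schwartz_eq_synth d_gt0 (Sv' tT) rv); apply: synth_le => //; exact: HM.
Qed.

Lemma S1_lipschitz : exists M : R, forall (s t : R) x, 0 <= s <= T -> 0 <= t <= T ->
  `|v s x - v t x| <= M * `|s - t|.
Proof.
have [M HM] := time_derivative_bounded; exists M => s t x sT tT.
apply: (lipschitz_of_derive (f := v ^~ x) (df := v' ^~ x) _ _ _ sT tT).
- by apply: (diff_within_continuous (df := v' ^~ x)) => r rT; exact: S1_diff_within.
- move=> r rT; apply: (@diff_within_is_derive _ T _ r (v' r x) rT).
  apply: S1_diff_within => //.
  by case/andP: rT => r0 r1; rewrite !ltW.
- by move=> r /andP[r0 r1]; apply: HM; rewrite !ltW.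
Qed.

(** Differentiation under the integral sign; the domination comes from the Lipschitz bound in time,
    uniform in [x]. *)
Lemma is_derive_hermite_coef (t : R) b : 0 < t < T ->
  is_derive t 1 (fun s => hermite_coef (v s) b) (hermite_coef (v' t) b).
Proof.
move=> tT'; have /andP[t0 t1] := tT'; have tT : 0 <= t <= T by rewrite !ltW.
have [M HM] := time_derivative_bounded; have [L HL] := S1_lipschitz.
pose r := Num.min t (T - t); have r0 : 0 < r by rewrite lt_min t0 subr_gt0.
have hT (h : R) : `|h| < r -> 0 <= h + t <= T.
  rewrite lt_min !ltr_norml => /andP[/andP[h1 h2] /andP[h3 h4]]; apply/andP; split; lra.
(* Outside the admissible increments the quotient is replaced by its limit, so
   that dominated convergence applies to every sequence of increments. *)
pose Q (h : R) x : R := if (h != 0) && (`|h| < r) then h^-1 * (v (h + t) x - v t x) else v' t x.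
have cv (s : R) : 0 <= s <= T -> continuous (v s).
  by move=> sT; apply: schwartz_continuous; case: S1v => H _; exact: H.
have cQ (h : R) : continuous (Q h).
  rewrite /Q; case: (boolP ((h != 0) && (`|h| < r))) => [/andP[_ hr]|_]; last exact: schwartz_continuous (Sv' tT).
  by apply: continuous_scale_sub; [exact: cv (hT _ hr)|exact: cv].
pose N := Num.max M L.
have QN h x : `|Q h x| <= N.
  rewrite /Q; case: ifP => [/andP[h0 hr]|_]; last by rewrite le_max HM.
  rewrite normrM normfV ler_pdivrMl ?normr_gt0//; apply: (le_trans (HL _ _ _ (hT _ hr) tT)).
  by rewrite addrK mulrC ler_wpM2l// le_max lexx orbT.
have QL x : Q h x @[h --> (0:R)] --> v' t x.
  apply/cvgrPdist_le => e e0; have [q q0 Hq] := S1_diff_within x S1v tT e0.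
  exists q => //= h; rewrite /ball_ /= sub0r normrN => hq; rewrite /Q.
  case: ifP => [/andP[h0 hr]|_]; last by rewrite subrr normr0 ltW.
  have := Hq _ (hT _ hr); rewrite addrK => /(_ hq) Hh.
  rewrite -(@ler_pM2r _ `|h|) ?normr_gt0//; apply: le_trans Hh; rewrite -normrM -normrN.
  by rewrite le_eqVlt; apply/orP; left; apply/eqP; congr `|_|; field.
have GL : hermite_coef (Q h) b @[h --> (0:R)] --> hermite_coef (v' t) b.
  apply/(@cvg_nbhsP _ R^o) => u u0.
  refine (hermite_coef_dominated (b := b) (u := fun n => Q (u n)) (phi := v' t) (M := N) _ _ _) => //.
  by move=> x; have /(@cvg_nbhsP _ R^o)/(_ u u0) := QL x.
have D : h^-1 *: (hermite_coef (v (h *: (1 : R) + t)) b - hermite_coef (v t) b)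
    @[h --> (0:R)^'] --> hermite_coef (v' t) b.
  have /(cvg_trans _) : hermite_coef (Q h) b @[h --> (0:R)^'] --> hermite_coef (v' t) b.
    exact: cvg_within_filter GL.
  apply; apply: near_eq_cvg; exists r => //= h; rewrite /ball_ /= sub0r normrN => hr h0.
  have [C HC] : exists C : R, forall x, `|v (h + t) x| <= C.
    by apply: schwartz_bounded; case: S1v => H _; exact: H (hT _ hr).
  have [C' HC'] : exists C : R, forall x, `|v t x| <= C.
    by apply: schwartz_bounded; case: S1v => H _; exact: H.
  rewrite /Q h0 hr /= /GRing.scale /= mulr1 -(hermite_coefB b (cv _ (hT _ hr)) (cv _ tT) HC HC').
  rewrite -(hermite_coefZ (M := C + C') h^-1 b)//.
    by apply: continuous_sub; [exact: cv (hT _ hr)|exact: cv].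
  by move=> x; rewrite (le_trans (ler_normB _ _))// lerD.
by apply: DeriveDef; [apply/cvg_ex; eexists; exact: D|exact: cvg_lim D].
Qed.

Lemma within_hermite_coef b : {within `[0, T], continuous (fun s => hermite_coef (v s) b)}.
Proof.
have [C C0 HC] := hermite_coef_bound (R := R) b; have [L HL] := S1_lipschitz.
apply: (lipschitz_within (C := C * L)) => s t sT tT.
have S0 (r : R) : 0 <= r <= T -> schwartz (v r) by case: S1v => H _; exact: H.
have [M HM] := schwartz_bounded (S0 _ sT); have [N HN] := schwartz_bounded (S0 _ tT).
have cs := schwartz_continuous (S0 _ sT); have ct := schwartz_continuous (S0 _ tT).
rewrite -(hermite_coefB b cs ct HM HN) -mulrA; apply: HC => [|x]; last exact: HL.
exact: continuous_sub.
Qed.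

Lemma hermite_coef_lipschitz n : exists M : R, forall s t : R, 0 <= s <= T -> 0 <= t <= T ->
  sbound n (M * `|s - t|) (fun b => hermite_coef (v s) b - hermite_coef (v t) b).
Proof.
have [M HM] := Bv' n; exists M => s t sT tT b.
have l0 : 0 < lam b ^+ n by rewrite exprn_gt0// weight_gt0.
rewrite mulrC -ler_pdivlMr// mulrAC.
apply: (lipschitz_of_derive (T := T) (f := fun s => hermite_coef (v s) b)
   (df := fun s => hermite_coef (v' s) b)) => //.
- exact: within_hermite_coef.
- by move=> r rT; exact: is_derive_hermite_coef.
- by move=> r /andP[r0 r1]; rewrite ler_pdivlMr// mulrC; apply: HM; rewrite !ltW.
Qed.

End time_regularity.

(** * Stability of the heat flow *)

Section perturbed_flow.
Context {R : realType} (d : nat) (T : R).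
Hypotheses (d_gt0 : (0 < d)%N) (T_gt0 : 0 < T).
Local Notation lam := (@hermite_weight R d).

(** As [flow_const], with [1 + T] collecting the initial energy and the residual accumulated over a
    time [T]. *)
Definition perturbed_const n : R := Num.sqrt (expR (grow d n * T) * 2 ^+ d * (1 + T)).

Lemma tail_sbound n K (M : R) (a : multi_index d -> R) : sbound n.+1 M a ->
  sbound n (M / K.+1%:R) (fun b => a b - trunc K a b).
Proof.
move=> H b; rewrite /trunc; case: (boolP (b \in box d K)) => bK.
  by rewrite subrr normr0 mulr0 divr_ge0// (sbound_ge0 H).
rewrite subr0 ler_pdivlMr// mulrAC; apply: le_trans (H b).
rewrite ler_wpM2r// exprSr ler_wpM2l ?exprn_ge0 ?weight_ge0//.
exact: notin_box_weight.
Qed.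

(* The energy estimate is applied to the truncations of [A]; truncating
   introduces an error in the equation which is [O(1 / K)] because [A] has one
   more weight than needed. *)
Lemma perturbed_flow_bound n (A A' : R -> multi_index d -> R) (M1 M2 : R) :
  (exists M : R, forall t : R, 0 <= t <= T -> sbound (n + d).+3 M (A t)) ->
  (forall (t : R) b, 0 < t < T -> is_derive t 1 (fun s => A s b) (A' t b)) ->
  (forall b, {within `[0, T], continuous (fun s => A s b)}) ->
  sbound (n + d) M1 (A 0) ->
  (forall t : R, 0 <= t <= T -> sbound (n + d) M2 (fun b => A' t b - heatop (A t) b)) ->
  forall t : R, 0 <= t <= T -> sbound n (perturbed_const n * (M1 + M2)) (A t).
Proof.
move=> [Q HQ] dA cA HM1 HM2 t tT b.
have T0 := ltW T_gt0; have zT : 0 <= (0:R) <= T by rewrite lexx.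
have M1ge := sbound_ge0 HM1; have M2ge := sbound_ge0 (HM2 _ zT); have Qge := sbound_ge0 (HQ _ zT).
(* Of the three extra powers required of [A], the heat operator uses two, and the tail outside the
   box trades the third for [1 / (K + 1)]. *)
pose Z := heat_const d (n + d) * Q.
have Z0 : 0 <= Z by rewrite mulr_ge0// heat_const_ge0.
pose e K := Z / K.+1%:R; have e0 K : 0 <= e K by rewrite divr_ge0.
have key K : b \in box d K -> lam b ^+ n * `|A t b| <= perturbed_const n * (M1 + M2 + e K).
  move=> bK; pose a s := trunc K (A s).
  pose r s c := A' s c - heatop (a s) c.
  have rE s : r s = (fun c => (A' s c - heatop (A s) c) + heatop (fun c => A s c - a s c) c).
    by apply/funext => c; rewrite heatopB /r addrA subrK.
  have Hr (s : R) : 0 <= s <= T -> sbound (n + d) (M2 + e K) (r s).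
    move=> sT; rewrite rE; apply: sboundD; first exact: HM2.
    rewrite /e /Z -mulrA; apply: heatop_sbound => //; apply: tail_sbound; exact: HQ.
  have G := galerkin_energy d_gt0 (n := n) (K := K) (a := a) (r := r)
    (rho := 2 ^+ d * (M2 + e K) ^+ 2) T0.
  have {}G : Ener n K (a t) <= expR (grow d n * T) * (Ener n K (a 0) + 2 ^+ d * (M2 + e K) ^+ 2 * T).
    apply: G => //.
    - by rewrite mulr_ge0 ?sqr_ge0// exprn_ge0.
    - by move=> s; exact: supported_trunc.
    - move=> s c sT cK; rewrite /r addrC subrK.
      suff -> : (fun s => a s c) = (fun s => A s c) by exact: dA.
      by apply/funext => s'; rewrite /a /trunc cK.
    - move=> c; rewrite /a /trunc; case: (c \in box d K); first exact: cA.
      exact: cst_continuous.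
    - move=> s /andP[s0 s1]; apply: Ener_le_sbound => //; apply: Hr; rewrite !ltW//.
  have Ab : a t b = A t b by rewrite /a /trunc bK.
  rewrite -Ab; apply: Ener_ge bK.
    by rewrite mulr_ge0 ?sqrtr_ge0// !addr_ge0.
  apply: (le_trans G); rewrite exprMn sqr_sqrtr; last first.
    by rewrite !mulr_ge0 ?expR_ge0 ?exprn_ge0// addr_ge0.
  rewrite -!(mulrA (expR _)) -(mulrA (2 ^+ d)) ler_wpM2l ?expR_ge0//.
  have E0 : Ener n K (a 0) <= 2 ^+ d * M1 ^+ 2.
    by apply: Ener_le_sbound => //; exact: trunc_sbound.
  apply: (@le_trans _ _ (2 ^+ d * (M1 ^+ 2 + (M2 + e K) ^+ 2 * T))).
    by rewrite mulrDr lerD// mulrA.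
  rewrite -mulrA ler_wpM2l ?exprn_ge0// mulrDl mul1r (mulrC _ T) lerD//.
    by rewrite lerXn2r ?nnegrE ?addr_ge0// -addrA lerDl addr_ge0.
  by rewrite ler_wpM2l// lerXn2r ?nnegrE ?addr_ge0// -addrA lerDr.
(* Letting [K] grow removes the truncation error, so the a priori bound [Q] does not enter the final
   constant. *)
have L : perturbed_const n * (M1 + M2 + e K) @[K --> \oo] --> perturbed_const n * (M1 + M2 + Z * 0).
  apply: cvgM; first exact: cvg_cst.
  apply: cvgD; first exact: cvg_cst.
  by apply: cvgM; [exact: cvg_cst|exact: cvg_harmonic].
rewrite mulr0 addr0 in L; apply: (cvgr_to_ge L).
by apply: filterS (box_near b) => K; exact: key.
Qed.

End perturbed_flow.

(** * The spaces of families *)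

Section families.
Context {R : realType} (d : nat) (T : R).
Hypotheses (d_gt0 : (0 < d)%N) (T_gt0 : 0 < T).
Local Notation tfun := (R -> 'rV[R]_d -> R).
Local Notation D := [set t : R | 0 <= t <= T].
Implicit Types (a : multi_index d -> R) (S : set (multi_index d -> R)).
Implicit Types (A B : multi_index d -> R -> multi_index d -> R).
Implicit Types (f g w : multi_index d -> tfun).

Lemma heatop_lin (a c : multi_index d -> R) r b :
  heatop (fun b => a b + r * c b) b = heatop a b + r * heatop c b.
Proof.
have E (F : bool -> multi_index d -> R) (s : bool -> R) e :
    \sum_(k <- [:: true; false]) s k * F k e = s true * F true e + s false * F false e.
  by rewrite big_cons big_seq1.
pose F k := if k then a else c; pose s k := if k then 1 else r.
have -> : (fun b => a b + r * c b) =
    (fun b => \sum_(k <- [:: true; false]) s k * F k b).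
  by apply/funext => e; rewrite E mul1r.
by rewrite heatop_sum (E (fun k => heatop (F k))) mul1r.
Qed.

Lemma laplacian_synth a : rapid a ->
  laplacian (synth a) = synth (fun b => 2 * heatop a b) :> ('rV[R]_d -> R).
Proof.
move=> Ra; have [M HM] := Ra (3 * d).+2.
have E : (fun b => 2 * heatop a b) = (fun b => \sum_i dpart i (dpart i a) b).
  by apply/funext => b; rewrite /heatop mulrA divff ?mul1r// pnatr_eq0.
apply/funext => x; rewrite E /laplacian (synth_sum d_gt0 (M := (1 + 3 ^+ (3 * d).+1) *
  ((1 + 3 ^+ (3 * d).+2) * M))).
  apply: eq_bigr => i _; rewrite (partial_synth d_gt0 i Ra).
  by rewrite (partial_synth d_gt0 i (rapid_dpart d_gt0 i Ra)).
by move=> i; do 2! apply: dpart_sbound => //.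
Qed.

Lemma diff_within_synth (A A' : R -> multi_index d -> R) (t : R) x : 0 <= t <= T ->
  (forall t : R, 0 <= t <= T -> rapid (A t)) -> rapid (A' t) ->
  (exists C : R, forall s : R, 0 <= s <= T ->
    sbound (3 * d) (C * (s - t) ^+ 2) (fun b => A s b - A t b - (s - t) * A' t b)) ->
  diff_within T (fun s => synth (A s) x) t (synth (A' t) x).
Proof.
move=> tT RA RA' [C HC] e e0; pose k := 1 + `|2 ^+ d * C * 2 ^+ d|.
have k0 : 0 < k by rewrite ltr_pwDl.
exists (e / k) => [|s sT st]; first by rewrite divr_gt0.
have [M HM] := RA _ sT (3 * d)%N; have [N HN] := RA _ tT (3 * d)%N.
have [P HP] := RA' (3 * d)%N.
rewrite -(synthB d_gt0 _ HM HN) -(synthZ d_gt0 (s - t) x HP).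
rewrite -(synthB d_gt0 x (sboundB HM HN) (sboundZ _ HP)).
apply: (le_trans (synth_le d_gt0 x (HC _ sT))).
apply: (@le_trans _ _ (k * `|s - t| ^+ 2)); last first.
  by rewrite expr2 mulrA ler_wpM2r// mulrC -ler_pdivlMr// ltW.
rewrite real_normK ?num_real// mulrA mulrAC ler_wpM2r ?sqr_ge0//.
by rewrite (le_trans (ler_norm _))// lerDr.
Qed.

Lemma diff_within_lin (f g : R -> R) (t l m r : R) : diff_within T f t l ->
  diff_within T g t m -> diff_within T (fun s => f s + r * g s) t (l + r * m).
Proof.
move=> /quotient_cvgP Hf /quotient_cvgP Hg; apply/quotient_cvgP.
have -> : (fun s : R => (f s + r * g s - (f t + r * g t)) / (s - t)) =
    (fun s : R => (f s - f t) / (s - t) + r * ((g s - g t) / (s - t))).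
  by apply/funext => s; ring.
by apply: cvgD => //; apply: cvgM => //; exact: cvg_cst.
Qed.

Lemma bounded_in_lin S (I : Type) (A B : multi_index d -> I -> multi_index d -> R) (E : set I) r :
  seq_ideal S -> bounded_in S A E -> bounded_in S B E ->
  bounded_in S (fun b t (c : multi_index d) => A b t c + r * B b t c) E.
Proof. by move=> IS HA HB; apply: bounded_inD => //; exact: bounded_inZ. Qed.

Lemma synth_lin (a c : multi_index d -> R) r x : rapid a -> rapid c ->
  synth (fun b => a b + r * c b) x = synth a x + r * synth c x.
Proof.
move=> Ra Rc; have [M HM] := Ra (3 * d)%N; have [N HN] := Rc (3 * d)%N.
by rewrite (synthD d_gt0 x HM (sboundZ r HN)) (synthZ d_gt0 r x HN).
Qed.

Lemma in_seq_spaceS S S' X : S `<=` S' -> in_seq_space S X -> in_seq_space S' X.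
Proof. by move=> SS [a Sa ->]; exists a => //; exact: SS. Qed.

(** One direction is completeness; in the other the Schwartz property comes from [schwartz_synth].
    With its two analogues in time it allows the closure properties of families to be checked on
    coefficients. *)
Lemma space_familiesP S (f : multi_index d -> 'rV[R]_d -> R) : seq_ideal S ->
  space_families S f <-> exists2 A : multi_index d -> multi_index d -> R,
    bounded_in S (fun b (_ : unit) => A b) setT & forall b, f b = synth (A b).
Proof.
move=> IS; split=> [[Sf /(hermite_norm_bounded_in d_gt0 f IS) Bf]|[A BA fA]].
  exists (fun b => hermite_coef (f b)) => // b.
  by apply: schwartz_eq_synth => //; exact: (bounded_in_rapid b (t := tt) Bf).
have RA b : rapid (A b) by exact: (bounded_in_rapid b (t := tt) BA).
split=> [b|]; first by rewrite fA; exact: schwartz_synth.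
apply/(hermite_norm_bounded_in d_gt0 f IS); apply: bounded_in_eq BA => b _ _.
by apply/funext => c; rewrite fA hermite_coef_synth.
Qed.

Lemma time_families0P S f : seq_ideal S ->
  time_families0 T S f <-> exists A, [/\ bounded_in S A D,
    forall b (t : R), 0 <= t <= T -> f b t = synth (A b t) &
    forall b x, {within `[0, T], continuous (f b ^~ x)}].
Proof.
move=> IS; split=> [[Sf /(sup_norm_bounded_in d_gt0 T_gt0 f IS) Bf]|[A [BA fA cf]]].
  exists (fun b t => hermite_coef (f b t)); split=> // [b t tT|b x].
    apply: schwartz_eq_synth => //; last exact: (bounded_in_rapid b Bf).
    by case: (Sf b) => H _; exact: H.
  by case: (Sf b).
have RA b (t : R) : 0 <= t <= T -> rapid (A b t) by exact: (bounded_in_rapid b BA).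
split=> [b|].
  by split=> // t tT; rewrite fA//; apply: schwartz_synth => //; exact: RA.
apply/(sup_norm_bounded_in d_gt0 T_gt0 f IS); apply: bounded_in_eq BA => b t tT.
by apply/funext => c; rewrite fA// hermite_coef_synth//; exact: RA.
Qed.

(** The derivative enters through [diff_within], because [time_derivative], being a [lim], can be
    computed only once convergence is known. *)
Lemma time_families1P S w : seq_ideal S ->
  time_families1 T S w <-> exists A A', [/\ bounded_in S A D, bounded_in S A' D,
    forall b (t : R), 0 <= t <= T -> w b t = synth (A b t),
    forall b (t : R) x, 0 <= t <= T -> diff_within T (w b ^~ x) t (synth (A' b t) x) &
    forall b x, {within `[0, T], continuous (fun t => synth (A' b t) x)}].
Proof.
move=> IS; split=> [[S1w Sw' N]|[A [A' [BA BA' wA dw cA']]]].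
  have /(sup_norm_bounded_in d_gt0 T_gt0 w IS) BA : forall n,
      in_seq_space S (fun b => sup_norm T n (w b)) by move=> n; case: (N n).
  have /(sup_norm_bounded_in d_gt0 T_gt0 (fun b => time_derivative T (w b)) IS) BA' : forall n,
      in_seq_space S (fun b => sup_norm T n (time_derivative T (w b))).
    by move=> n; case: (N n).
  have E b (t : R) : 0 <= t <= T -> time_derivative T (w b) t =
      synth (hermite_coef (time_derivative T (w b) t)).
    move=> tT; apply: schwartz_eq_synth => //; first exact: Sw'.
    exact: (bounded_in_rapid b BA').
  exists (fun b t => hermite_coef (w b t)), (fun b t => hermite_coef (time_derivative T (w b) t)).
  split=> // [b t tT|b t x tT|b x].
  - apply: schwartz_eq_synth => //; last exact: (bounded_in_rapid b BA).
    by case: (S1w b) => H _; exact: H.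
  - by rewrite -E//; exact: S1_diff_within.
  - apply: (within_eq (f := time_derivative T (w b) ^~ x)) => [t tT|]; first by rewrite {1}E.
    by case: (S1w b) => _ /(_ x)[].
have RA b (t : R) : 0 <= t <= T -> rapid (A b t) by exact: (bounded_in_rapid b BA).
have RA' b (t : R) : 0 <= t <= T -> rapid (A' b t) by exact: (bounded_in_rapid b BA').
have E b (t : R) : 0 <= t <= T -> time_derivative T (w b) t = synth (A' b t).
  by move=> tT; apply/funext => x; apply: time_derivativeE => //; exact: dw.
split=> [b|b t tT|n].
- split=> [t tT|x]; first by rewrite wA//; apply: schwartz_synth => //; exact: RA.
  split=> [t tT|].
    by apply/cvg_ex; exists (synth (A' b t) x); apply/quotient_cvgP; exact: dw.
  by apply: (within_eq (f := fun t => synth (A' b t) x)) => // t tT; rewrite E.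
- by rewrite E//; apply: schwartz_synth => //; exact: RA'.
split; move: n.
  apply/(sup_norm_bounded_in d_gt0 T_gt0 w IS); apply: bounded_in_eq BA => b t tT.
  by apply/funext => c; rewrite wA// hermite_coef_synth//; exact: RA.
apply/(sup_norm_bounded_in d_gt0 T_gt0 (fun b => time_derivative T (w b)) IS).
apply: bounded_in_eq BA' => b t tT.
by apply/funext => c; rewrite E// hermite_coef_synth//; exact: RA'.
Qed.

Lemma space_families_lin S (f g : multi_index d -> 'rV[R]_d -> R) r : seq_ideal S ->
  space_families S f -> space_families S g -> space_families S (fun b x => f b x + r * g b x).
Proof.
move=> IS /(space_familiesP f IS)[A BA fA] /(space_familiesP g IS)[B BB gB].
apply/(space_familiesP _ IS); exists (fun b c => A b c + r * B b c).
  exact: (bounded_in_lin r IS BA BB).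
move=> b; apply/funext => x; rewrite fA gB synth_lin//.
  exact: (bounded_in_rapid b (t := tt) BA).
exact: (bounded_in_rapid b (t := tt) BB).
Qed.

Lemma time_families0_lin S f g r : seq_ideal S ->
  time_families0 T S f -> time_families0 T S g ->
  time_families0 T S (fun b t x => f b t x + r * g b t x).
Proof.
move=> IS /(time_families0P f IS)[A [BA fA cA]] /(time_families0P g IS)[B [BB gB cB]].
apply/(time_families0P _ IS); exists (fun b t c => A b t c + r * B b t c); split.
- exact: (bounded_in_lin r IS BA BB).
- move=> b t tT; apply/funext => x; rewrite fA// gB// synth_lin//.
    exact: (bounded_in_rapid b BA).
  exact: (bounded_in_rapid b BB).
- by move=> b x; apply: within_lin; [exact: cA|exact: cB].
Qed.

Lemma time_families1_lin S f g r : seq_ideal S ->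
  time_families1 T S f -> time_families1 T S g ->
  time_families1 T S (fun b t x => f b t x + r * g b t x).
Proof.
move=> IS /(time_families1P f IS)[A [A' [BA BA' fA dA cA]]].
move=> /(time_families1P g IS)[B [B' [BB BB' gB dB cB]]].
apply/(time_families1P _ IS).
exists (fun b t c => A b t c + r * B b t c), (fun b t c => A' b t c + r * B' b t c).
have RA' b (t : R) : 0 <= t <= T -> rapid (A' b t) by exact: (bounded_in_rapid b BA').
have RB' b (t : R) : 0 <= t <= T -> rapid (B' b t) by exact: (bounded_in_rapid b BB').
split.
- exact: (bounded_in_lin r IS BA BB).
- exact: (bounded_in_lin r IS BA' BB').
- move=> b t tT; apply/funext => x; rewrite fA// gB// synth_lin//.
    exact: (bounded_in_rapid b BA).
  exact: (bounded_in_rapid b BB).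
- move=> b t x tT; rewrite synth_lin//; [|exact: RA'|exact: RB'].
  by apply: diff_within_lin; [exact: dA|exact: dB].
- move=> b x; apply: (within_eq (f := fun t => synth (A' b t) x + r * synth (B' b t) x)).
    by move=> t tT; rewrite synth_lin//; [exact: RA'|exact: RB'].
  by apply: within_lin; [exact: cA|exact: cB].
Qed.

Lemma time_derivative_lin S f g r b (t : R) : time_families1 T S f -> time_families1 T S g ->
  0 <= t <= T -> time_derivative T (fun t x => f b t x + r * g b t x) t =
    (fun x => time_derivative T (f b) t x + r * time_derivative T (g b) t x).
Proof.
move=> [Sf _ _] [Sg _ _] tT; apply/funext => x; apply: time_derivativeE => //.
by apply: diff_within_lin; apply: S1_diff_within.
Qed.

Lemma time_families0_eq S f g : (forall b (t : R), 0 <= t <= T -> f b t = g b t) ->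
  seq_ideal S -> time_families0 T S f -> time_families0 T S g.
Proof.
move=> E IS /(time_families0P f IS)[A [BA fA cA]]; apply/(time_families0P g IS).
exists A; split=> // [b t tT|b x]; first by rewrite -E// fA.
by apply: (within_eq (f := f b ^~ x)) (cA b x) => t tT; rewrite E.
Qed.

Lemma time_families1_dt S w : time_families1 T S w ->
  time_families0 T S (fun b => time_derivative T (w b)).
Proof.
move=> [S1w Sw' N]; split=> [b|n]; last by case: (N n).
by split=> [|x]; [exact: Sw'|case: (S1w b) => _ /(_ x)[]].
Qed.

Lemma time_families1_tbound S w : seq_ideal S -> time_families1 T S w ->
  forall b n, exists M : R, tbound T n M (time_derivative T (w b)).
Proof.
move=> IS [_ _ N] b n.
have /(sup_norm_bounded_in d_gt0 T_gt0 (fun b => time_derivative T (w b)) IS)/(_ n)[M _ HM] :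
    forall n, in_seq_space S (fun b => sup_norm T n (time_derivative T (w b))).
  by move=> k; case: (N k).
by exists (M b) => t; exact: HM.
Qed.

Lemma time_families1_initial S w : seq_ideal S -> time_families1 T S w ->
  space_families S (fun b => w b 0).
Proof.
move=> IS /(time_families1P w IS)[A [_ [BA _ wA _ _]]].
have zT : 0 <= (0 : R) <= T by rewrite lexx ltW.
apply/(space_familiesP _ IS); exists (fun b => A b 0) => [n|b]; last exact: wA.
by have [M SM HM] := BA n; exists M => // b _ _; exact: HM.
Qed.

(** The point is continuity in time of the Laplacian, which the definition of the family does not
    state. The bounds on the time derivative make the coefficients Lipschitz in every weighted norm,
    and the heat operator preserves this. *)
Lemma time_families1_laplacian S w : seq_ideal S -> time_families1 T S w ->
  time_families0 T S (fun b t => laplacian (w b t)).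
Proof.
move=> IS Fw; have /(time_families1P w IS)[A [A' [BA BA' wA dw cA']]] := Fw.
have RA b (t : R) : 0 <= t <= T -> rapid (A b t) by exact: (bounded_in_rapid b BA).
have E b (t : R) : 0 <= t <= T ->
    laplacian (w b t) = synth (fun c => 2 * heatop (A b t) c).
  by move=> tT; rewrite wA// laplacian_synth//; exact: RA.
apply/(time_families0P _ IS); exists (fun b t c => 2 * heatop (A b t) c); split=> //.
  by apply: bounded_inZ => //; exact: bounded_in_heatop.
move=> b x; have [S1w Sw' N] := Fw; have Bv' := time_families1_tbound IS Fw b.
have [M HM] := hermite_coef_lipschitz d_gt0 (S1w b) (Sw' b) Bv' (3 * d).+2.
pose C := 2 ^+ d * (`|2| * (heat_const d (3 * d) * M)) * 2 ^+ d.
apply: (lipschitz_within (C := C)) => s t sT tT; rewrite !E//.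
have H2 (r : R) : 0 <= r <= T -> exists M : R, sbound (3 * d) M (fun c => 2 * heatop (A b r) c).
  move=> rT; have [K HK] := rapid_heatop d_gt0 (RA b _ rT) (3 * d)%N.
  by eexists; apply: sboundZ; exact: HK.
have [P HP] := H2 _ sT; have [Q HQ] := H2 _ tT; rewrite -(synthB d_gt0 x HP HQ).
have -> : C * `|s - t| = 2 ^+ d * (`|2| * (heat_const d (3 * d) * (M * `|s - t|))) * 2 ^+ d.
  by rewrite /C; ring.
apply: synth_le => //.
have -> : (fun c => 2 * heatop (A b s) c - 2 * heatop (A b t) c) =
    (fun c => 2 * heatop (fun c => hermite_coef (w b s) c - hermite_coef (w b t) c) c).
  apply/funext => c; rewrite heatopB -mulrBr.
  by congr (2 * (heatop _ c - heatop _ c)); apply/funext => e;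
    rewrite wA// hermite_coef_synth//; exact: RA.
by apply: sboundZ; apply: heatop_sbound => //; exact: HM.
Qed.

Lemma time_families1_laplacian_lin S f g r b (t : R) : seq_ideal S ->
  time_families1 T S f -> time_families1 T S g -> 0 <= t <= T ->
  laplacian (fun x => f b t x + r * g b t x) =
    (fun x => laplacian (f b t) x + r * laplacian (g b t) x).
Proof.
move=> IS /(time_families1P f IS)[A [_ [BA _ fA _ _]]].
move=> /(time_families1P g IS)[B [_ [BB _ gB _ _]]] tT.
have RA : rapid (A b t) by exact: (bounded_in_rapid b BA).
have RB : rapid (B b t) by exact: (bounded_in_rapid b BB).
have R2 (a : multi_index d -> R) : rapid a -> rapid (fun c => 2 * heatop a c).
  move=> Ra n; have [M HM] := rapid_heatop d_gt0 Ra n.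
  by eexists; apply: sboundZ; exact: HM.
rewrite fA// gB//.
have -> : (fun x => synth (A b t) x + r * synth (B b t) x) =
    synth (fun c => A b t c + r * B b t c) by apply/funext => x; rewrite synth_lin.
rewrite !laplacian_synth//; last first.
  move=> n; have [M HM] := RA n; have [N HN] := RB n.
  by eexists; apply: sboundD; [exact: HM|apply: sboundZ; exact: HN].
apply/funext => x; rewrite -synth_lin//; [|exact: R2|exact: R2].
by congr (synth _ x); apply/funext => c; rewrite heatop_lin; ring.
Qed.

Lemma bounded_in0 S I (E : set I) : seq_ideal S ->
  bounded_in S (fun (_ : multi_index d) (_ : I) (_ : multi_index d) => 0 : R) E.
Proof.
move=> IS n; exists (fun=> 0); first exact: (ideal0 IS).
by move=> b t _ c; rewrite normr0 mulr0.
Qed.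

Lemma space_families_zero S : seq_ideal S ->
  space_families S (fun (_ : multi_index d) (_ : 'rV[R]_d) => 0 : R).
Proof.
move=> IS; apply/(space_familiesP _ IS); exists (fun _ _ => 0); first exact: bounded_in0.
by move=> b; apply/funext => x; rewrite synth0.
Qed.

Lemma time_families0_zero S : seq_ideal S -> time_families0 T S (fun _ _ (_ : 'rV[R]_d) => 0 : R).
Proof.
move=> IS; apply/(time_families0P _ IS); exists (fun _ _ _ => 0); split.
- exact: bounded_in0.
- by move=> b t _; apply/funext => x; rewrite synth0.
- by move=> b x; exact: cst_continuous.
Qed.

Lemma time_families1_zero S : seq_ideal S -> time_families1 T S (fun _ _ (_ : 'rV[R]_d) => 0 : R).
Proof.
move=> IS; apply/(time_families1P _ IS); exists (fun _ _ _ => 0), (fun _ _ _ => 0); split.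
- exact: bounded_in0.
- exact: bounded_in0.
- by move=> b t _; apply/funext => x; rewrite synth0.
- move=> b t x _ e e0; exists 1 => // s _ _.
  by rewrite synth0 mulr0 !subr0 normr0 mulr_ge0// ltW.
- by move=> b x; exact: cst_continuous.
Qed.

Lemma time_families1S S S' w : S `<=` S' -> time_families1 T S w -> time_families1 T S' w.
Proof.
move=> SS [S1w Sw' N]; split=> // n; have [N1 N2] := N n.
by split; [exact: in_seq_spaceS SS N1|exact: in_seq_spaceS SS N2].
Qed.

End families.

(** * Quotients and the Cauchy problem *)

Section cosets.
Implicit Types V W : zmodType.

Definition subgroup V (N : set V) := N 0 /\ forall v w, N v -> N w -> N (v - w).

Lemma coset_set_eq V (N : set V) v w : subgroup N ->
  coset_set N v = coset_set N w <-> N (v - w).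
Proof.
move=> [N0 NB]; have NN x : N x -> N (- x) by move=> Nx; rewrite -sub0r; exact: NB.
split=> [E|Nvw].
  by have : coset_set N w v by rewrite -E /coset_set /= subrr.
apply/seteqP; split=> x; rewrite /coset_set /= => Nx.
  have -> : x - w = (x - v) - - (v - w) by rewrite opprK addrA subrK.
  by apply: NB => //; exact: NN.
have -> : x - v = (x - w) - (v - w) by rewrite opprB addrA subrK.
exact: NB.
Qed.

(** Compatibility is asked at the single representative [u] and [P] need not be additive:
    [time_derivative] and [laplacian] are so only on regular families. *)
Lemma quotient_map_coset V W (N : set V) (N' : set W) (P : V -> W) u :
  subgroup N -> subgroup N' -> (forall v, N (v - u) -> N' (P v - P u)) ->
  quotient_map N' P (coset_set N u) = coset_set N' (P u).
Proof.
move=> [N0 _] N'S H; apply/seteqP; split=> [x [v Nv]|x Hx].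
  by have /(coset_set_eq _ _ N'S) <- := H v Nv.
by exists u => //; rewrite /coset_set /= subrr.
Qed.

End cosets.

Section solution.
Context {R : realType} (d : nat) (T : R).
Hypotheses (d_gt0 : (0 < d)%N) (T_gt0 : 0 < T).
Local Notation tfun := (R -> 'rV[R]_d -> R).
Local Notation family := (multi_index d -> 'rV[R]_d -> R).
Local Notation tfamily := (multi_index d -> tfun).
Local Notation D := [set t : R | 0 <= t <= T].
Local Notation IR := (@rapid_ideal R d d_gt0).
Local Notation IT := (@tempered_ideal R d d_gt0).

Lemma familyB (f g : family) : f - g = (fun b x => f b x + (-1) * g b x).
Proof. by apply/funext => b; apply/funext => x; rewrite mulN1r. Qed.

Lemma tfamilyB (f g : tfamily) : f - g = (fun b t x => f b t x + (-1) * g b t x).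
Proof.
by apply/funext => b; apply/funext => t; apply/funext => x; rewrite mulN1r.
Qed.

Lemma subgroup_negligible : subgroup (@H_negligible R d).
Proof.
split; first exact: (space_families_zero d_gt0 IR).
by move=> f g Nf Ng; rewrite familyB; exact: (space_families_lin d_gt0 _ IR).
Qed.

Lemma subgroup0_negligible : subgroup (@H0_negligible R d T).
Proof.
split; first exact: (time_families0_zero d_gt0 T_gt0 IR).
by move=> f g Nf Ng; rewrite tfamilyB; exact: (time_families0_lin d_gt0 T_gt0 (-1) IR Nf Ng).
Qed.

Lemma subgroup1_negligible : subgroup (@H1_negligible R d T).
Proof.
split; first exact: (time_families1_zero d_gt0 T_gt0 IR).
by move=> f g Nf Ng; rewrite tfamilyB; exact: (time_families1_lin d_gt0 T_gt0 (-1) IR Nf Ng).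
Qed.

Lemma negligible1_moderate (w : tfamily) : H1_negligible T w -> H1_moderate T w.
Proof. by apply: time_families1S => a; exact: rapid_tempered. Qed.

Lemma tfamily_addB (v u : tfamily) : v = (fun b t x => u b t x + 1 * (v - u) b t x).
Proof.
apply/funext => b; apply/funext => t; apply/funext => x.
by rewrite mul1r /= addrC subrK.
Qed.

(** Another representative [v] is written as [u] plus a negligible family, so that both limits are
    known to exist before additivity is used; the identity holds on [[0, T]], which is all that
    negligibility sees. *)
Lemma class_dt_coset (u : tfamily) : H1_moderate T u ->
  class_dt T (coset_set (H1_negligible T) u) =
  coset_set (H0_negligible T) (fun b => time_derivative T (u b)).
Proof.
move=> Mu; apply: quotient_map_coset => [||v Nv].
- exact: subgroup1_negligible.
- exact: subgroup0_negligible.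
rewrite tfamilyB; have := time_families1_dt Nv.
apply: (time_families0_eq d_gt0 T_gt0 _ IR) => b t tT; apply/funext => x.
have vE : v b = (fun t x => u b t x + 1 * (v - u) b t x).
  exact: (congr1 (fun w => w b) (tfamily_addB v u)).
rewrite vE (time_derivative_lin T_gt0 1 b Mu (negligible1_moderate Nv) tT).
by rewrite mul1r mulN1r addrAC subrr add0r.
Qed.

Lemma class_laplacian_coset (u : tfamily) : H1_moderate T u ->
  class_laplacian T (coset_set (H1_negligible T) u) =
  coset_set (H0_negligible T) (fun b t => laplacian (u b t)).
Proof.
move=> Mu; apply: quotient_map_coset => [||v Nv].
- exact: subgroup1_negligible.
- exact: subgroup0_negligible.
rewrite tfamilyB; have := time_families1_laplacian d_gt0 T_gt0 IR Nv.
apply: (time_families0_eq d_gt0 T_gt0 _ IR) => b t tT; apply/funext => x.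
have vE : v b t = (fun x => u b t x + 1 * (v - u) b t x).
  exact: (congr1 (fun w => w b t) (tfamily_addB v u)).
rewrite vE (time_families1_laplacian_lin d_gt0 T_gt0 1 b IT Mu (negligible1_moderate Nv) tT).
by rewrite mul1r mulN1r addrAC subrr add0r.
Qed.

Lemma class_scale_coset r (u : tfamily) :
  class_scale T r (coset_set (H0_negligible T) u) =
  coset_set (H0_negligible T) (fun b t x => r * u b t x).
Proof.
apply: quotient_map_coset => [||v Nv]; [exact: subgroup0_negligible..|].
have N0 : H0_negligible T (fun _ _ (_ : 'rV[R]_d) => 0 : R).
  exact: (time_families0_zero d_gt0 T_gt0 IR).
move: Nv; rewrite !tfamilyB => Nv.
have := time_families0_lin d_gt0 T_gt0 r IR N0 Nv.
apply: (time_families0_eq d_gt0 T_gt0 _ IR) => b t tT; apply/funext => x.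
by rewrite add0r mulrDr mulrCA.
Qed.

Lemma class_initial_coset (u : tfamily) :
  class_initial (coset_set (H1_negligible T) u) =
  coset_set (@H_negligible R d) (fun b => u b 0).
Proof.
apply: quotient_map_coset => [||v Nv].
- exact: subgroup1_negligible.
- exact: subgroup_negligible.
have := time_families1_initial d_gt0 T_gt0 IR Nv.
rewrite familyB; congr H_negligible; apply/funext => b; apply/funext => x.
by rewrite mulN1r.
Qed.

Lemma generalized_solution_coset (f0 : family) (u : tfamily) : H1_moderate T u ->
  generalized_solution T (coset_set (@H_negligible R d) f0) (coset_set (H1_negligible T) u) <->
  H0_negligible T (fun b t x => time_derivative T (u b) t x - 2^-1 * laplacian (u b t) x) /\
  H_negligible (fun b x => u b 0 x - f0 b x).
Proof.
move=> Mu; rewrite /generalized_solution class_dt_coset// class_laplacian_coset//.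
rewrite class_scale_coset class_initial_coset.
rewrite (coset_set_eq _ _ subgroup0_negligible) (coset_set_eq _ _ subgroup_negligible).
by [].
Qed.

(** [perturbed_flow_bound] is applied for each family index to the coefficients of [w], moderateness
    supplying the a priori bound. The resulting constants are linear in two rapidly decreasing
    sequences, one for the initial value and one for the residual. *)
Lemma heat_negligible (w : tfamily) : H1_moderate T w ->
  H0_negligible T (fun b t x => time_derivative T (w b) t x - 2^-1 * laplacian (w b t) x) ->
  H_negligible (fun b => w b 0) -> H1_negligible T w.
Proof.
move=> Mw N0 Ninit; have [S1w Sw' N] := Mw.
have /(time_families1P d_gt0 T_gt0 w IT)[A [A' [BA BA' wA dw cA']]] := Mw.
have RA b (t : R) : 0 <= t <= T -> rapid (A b t) by exact: (bounded_in_rapid b BA).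
have RA' b (t : R) : 0 <= t <= T -> rapid (A' b t) by exact: (bounded_in_rapid b BA').
have AE b (t : R) : 0 <= t <= T -> hermite_coef (w b t) = A b t.
  by move=> tT; apply/funext => c; rewrite wA// hermite_coef_synth//; exact: RA.
have w'E b (t : R) : 0 <= t <= T -> time_derivative T (w b) t = synth (A' b t).
  by move=> tT; apply/funext => x; apply: time_derivativeE => //; exact: dw.
have A'E b (t : R) : 0 <= t <= T -> hermite_coef (time_derivative T (w b) t) = A' b t.
  by move=> tT; apply/funext => c; rewrite w'E// hermite_coef_synth//; exact: RA'.
have /(time_families0P d_gt0 T_gt0 _ IR)[B [BB rB _]] := N0.
have RB b (t : R) : 0 <= t <= T -> rapid (B b t) by exact: (bounded_in_rapid b BB).
have BE b (t : R) c : 0 <= t <= T -> B b t c = A' b t c - heatop (A b t) c.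
  move=> tT; rewrite -(hermite_coef_synth d_gt0 c (RB b t tT)) -rB//.
  have R2 : rapid (fun c => 2 * heatop (A b t) c).
    move=> n; have [M HM] := rapid_heatop d_gt0 (RA b t tT) n.
    by eexists; apply: sboundZ; exact: HM.
  have Rl : rapid (fun c => A' b t c - heatop (A b t) c).
    move=> n; have [M HM] := RA' b t tT n.
    have [P HP] := rapid_heatop d_gt0 (RA b t tT) n.
    by exists (M + P); exact: sboundB.
  rewrite -[RHS](hermite_coef_synth d_gt0 c Rl); congr (hermite_coef _ c).
  apply/funext => x; rewrite w'E// wA// laplacian_synth//; last exact: RA.
  rewrite -mulNr -synth_lin//; last exact: RA'.
  by congr (synth _ x); apply/funext => e; rewrite mulNr mulKf ?pnatr_eq0.
have /(hermite_norm_bounded_in d_gt0 _ IR) B0 :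
    forall n, in_seq_space (@rapid_seq R d) (fun b => hermite_norm n (w b 0)).
  by case: Ninit.
have zT : 0 <= (0 : R) <= T by rewrite lexx ltW.
have NA : bounded_in (@rapid_seq R d) A D.
  move=> n; have [M1 SM1 HM1] := B0 (n + d)%N; have [M2 SM2 HM2] := BB (n + d)%N.
  exists (fun b => perturbed_const d T n * (M1 b + M2 b)).
    apply: (ideal_dom IR (C := `|perturbed_const d T n|)
      (ideal_add IR SM1 SM2)) => b.
    by rewrite normrM.
  move=> b t tT; rewrite -AE//.
  have Bv' := time_families1_tbound d_gt0 T_gt0 IT Mw b.
  apply: (perturbed_flow_bound d_gt0 T_gt0 (A := fun t => hermite_coef (w b t))
    (A' := fun t => hermite_coef (time_derivative T (w b) t))) => //.
  - have [M SM HM] := BA (n + d).+3; exists (M b) => s sT; rewrite AE//; exact: HM.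
  - by move=> s c sT; exact: (is_derive_hermite_coef d_gt0 (S1w b) (Sw' b) Bv').
  - by move=> c; exact: (within_hermite_coef d_gt0 (S1w b) (Sw' b) Bv').
  - exact: (HM1 b tt).
  - move=> s sT c; rewrite A'E// AE// -BE//; exact: HM2.
apply/(time_families1P d_gt0 T_gt0 w IR).
exists A, A'; split => //.
(* The equation itself yields the time derivative: its coefficients are the residual plus the heat
   operator, both now negligible. *)
apply: (bounded_in_eq (A := fun b t c => B b t c + heatop (A b t) c)).
  by move=> b t tT; apply/funext => c; rewrite BE// subrK.
by apply: bounded_inD => //; [exact: IR|apply: bounded_in_heatop => //; exact: IR].
Qed.

Lemma heat_exists (f0 : family) : H_moderate f0 -> exists u : tfamily,
  [/\ H1_moderate T u,
      H0_negligible T (fun b t x => time_derivative T (u b) t x - 2^-1 * laplacian (u b t) x) &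
      forall b, u b 0 = f0 b].
Proof.
move=> /(space_familiesP d_gt0 _ IT)[C BC fC].
have RC b : rapid (C b) by exact: (bounded_in_rapid b (t := tt) BC).
have /choice[U HU] := fun b => heat_flow d_gt0 T_gt0 (RC b).
have BU : bounded_in (@tempered_seq R d) U D.
  move=> n; have [M SM HM] := BC (n + d)%N; exists (fun b => flow_const d T n * M b).
    apply: (ideal_dom IT (C := `|flow_const d T n|) SM) => b.
    by rewrite normrM.
  move=> b t tT; have [_ H _] := HU b; apply: H => //; exact: (HM b tt).
have RU b (t : R) : 0 <= t <= T -> rapid (U b t) by exact: (bounded_in_rapid b BU).
have zT : 0 <= (0 : R) <= T by rewrite lexx ltW.
pose u b t := synth (U b t).
have du b (t : R) x : 0 <= t <= T -> diff_within T (u b ^~ x) t (synth (heatop (U b t)) x).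
  move=> tT; apply: (diff_within_synth d_gt0 (A := U b) (A' := fun t => heatop (U b t)) x tT).
  - exact: RU.
  - by apply: rapid_heatop => //; exact: RU.
  - have [_ _ /(_ (3 * d)%N)[M HM]] := HU b; exists M => s sT; exact: HM.
(* The time derivative is itself differentiable in time, whence the continuity that [S1] demands;
   the remainder estimate is inherited by linearity of [heatop]. *)
have dhu b (t : R) x : 0 <= t <= T -> diff_within T (fun s => synth (heatop (U b s)) x) t
    (synth (heatop (heatop (U b t))) x).
  move=> tT; apply: (diff_within_synth d_gt0 (A := fun t => heatop (U b t))
      (A' := fun t => heatop (heatop (U b t))) x tT).
  - by move=> s sT; apply: rapid_heatop => //; exact: RU.
  - by do 2! apply: rapid_heatop => //; exact: RU.
  - have [_ _ /(_ (3 * d).+2)[M HM]] := HU b; exists (heat_const d (3 * d) * M) => s sT.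
    rewrite -mulrA; have := heatop_sbound d_gt0 (HM _ _ sT tT).
    congr sbound; apply/funext => c.
    have -> : (fun c => U b s c - U b t c - (s - t) * heatop (U b t) c) =
        (fun c => U b s c - U b t c + (- (s - t)) * heatop (U b t) c).
      by apply/funext => e; rewrite mulNr.
    by rewrite heatop_lin heatopB mulNr.
have Mu : H1_moderate T u.
  apply/(time_families1P d_gt0 T_gt0 u IT); exists U, (fun b t => heatop (U b t)); split=> //.
    by apply: bounded_in_heatop => //; exact: IT.
  move=> b x.
  by apply: (diff_within_continuous (df := fun t => synth (heatop (heatop (U b t))) x)) => t; exact: dhu.
exists u; split=> //; last by move=> b; rewrite fC /u; case: (HU b) => ->.
apply: (time_families0_eq d_gt0 T_gt0 _ IR
  (time_families0_zero d_gt0 T_gt0 IR)) => b t tT.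
apply/funext => x; rewrite (time_derivativeE T_gt0 tT (du b t x tT)).
rewrite /u laplacian_synth//; last exact: RU.
have [M HM] := rapid_heatop d_gt0 (RU b t tT) (3 * d)%N.
by rewrite (synthZ d_gt0 2 x HM) mulKf ?subrr// pnatr_eq0.
Qed.

End solution.

Theorem proposition4p1 (R : realType) (d : nat) (T : R)
    (d_gt0 : (0 < d)%N) (T_gt0 : 0 < T)
    (f : set (multi_index d -> 'rV[R]_d -> R)) (Hf : H_algebra f) :
  exists! u : set (multi_index d -> R -> 'rV[R]_d -> R),
    H1_algebra T u /\ generalized_solution T f u.
Proof.
have [f0 Mf0 <-] := Hf; have [u [Mu u_eq u0]] := heat_exists d_gt0 T_gt0 Mf0.
have IR := @rapid_ideal R d d_gt0; have IT := @tempered_ideal R d d_gt0.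
exists (coset_set (H1_negligible T) u); split.
  split; first by exists u.
  apply/(generalized_solution_coset d_gt0 T_gt0 f0 Mu); split=> //.
  have -> : (fun b x => u b 0 x - f0 b x) = (fun _ _ => 0).
    by apply/funext => b; apply/funext => x; rewrite u0 subrr.
  exact: (space_families_zero d_gt0 IR).
move=> _ [[v Mv <-] /(generalized_solution_coset d_gt0 T_gt0 f0 Mv)[v_eq v0]].
apply/(coset_set_eq _ _ (subgroup1_negligible d_gt0 T_gt0)); rewrite tfamilyB.
have Mw := time_families1_lin d_gt0 T_gt0 (-1) IT Mu Mv.
apply: (heat_negligible d_gt0 T_gt0 Mw).
  have := time_families0_lin d_gt0 T_gt0 (-1) IR u_eq v_eq.
  apply: (time_families0_eq d_gt0 T_gt0 _ IR) => b t tT; apply/funext => x.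
  rewrite (time_derivative_lin T_gt0 (-1) b Mu Mv tT).
  rewrite (time_families1_laplacian_lin d_gt0 T_gt0 (-1) b IT Mu Mv tT).
  have comb (p q k m : R) :
    p - 2^-1 * q + -1 * (k - 2^-1 * m) = p + -1 * k - 2^-1 * (q + -1 * m) by ring.
  exact: comb.
have := space_families_lin d_gt0 (-1) IR (space_families_zero d_gt0 IR) v0.
congr H_negligible; apply/funext => b; apply/funext => x.
by rewrite u0 add0r !mulN1r opprB.
Qed.
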